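(* Let $\Gamma$ be a finite-index subgroup of $\mathrm{GL}_2(\mathbb Z)$. There is a real neighbourhood $K$ of $(1,\mathbf 0)$ such that for every $0<\xi<\frac15$ there is a constant $0<\eta<1$ with $$\|\mathcal L^n_{s,\mathbf w}\|_{(t)}\ll \eta^n\lambda_{\sigma,\mathbf x}^n|t|^\xi$$ for all $s=\sigma+it$, $\mathbf w=\mathbf x+i\mathbf y$ with $(\sigma,\mathbf x)\in K$, all $n\ge1$ and all $|t|\ge 1/\rho^2$, where $\|\cdot\|_{(t)}$ denotes the operator norm on $\mathcal C^1(I_\Gamma)$ induced by the norm $\|\cdot\|_{(t)}$.
   Context: $k=[\mathrm{GL}_2(\mathbb Z):\Gamma]$; $I_\Gamma=[0,1]\times\Gamma\backslash\mathrm{GL}_2(\mathbb Z)$. $\mathcal C^1(I_\Gamma)$: functions whose restriction to each $[0,1]\times\{u\}$ is $C^1$. For $t\ne0$, $\|\Psi\|_{(t)}=\|\Psi\|_0+|t|^{-1}\|\partial\Psi\|_0$ with $\|\cdot\|_0$ the sup norm and $\partial\Psi=\frac1k\sum_u\frac{d}{dx}\Psi|_{[0,1]\times\{u\}}$. With $A_m=\begin{pmatrix}0&1\\1&m\end{pmatrix}$ and $\mathbf w=(w_u)_u$ indexed by cosets, $\mathcal L_{s,\mathbf w}\Psi(x,v)=\sum_{m\ge1}\exp(w_{vA_m})(m+x)^{-2s}\Psi(\frac1{m+x},vA_m)$. For real $(\sigma,\mathbf x)$ near $(1,\mathbf 0)$, $\lambda_{\sigma,\mathbf x}$ is the positive real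 eigenvalue of maximal modulus of $\mathcal L_{\sigma,\mathbf x}$ on $\mathcal C^1(I_\Gamma)$. $\rho=\frac12$ is the contraction ratio of the Gauss map $T(x)=1/x-\lfloor 1/x\rfloor$, i.e. $\limsup_n(\max_h\sup|h'|)^{1/n}$ over inverse branches $h$ of $T^n$. *)

(* Defs.v *)
From HB Require Import structures.
From mathcomp Require Import all_boot all_order all_algebra.
From mathcomp Require Import all_classical all_reals all_analysis.
From mathcomp Require Import finmap.
From mathcomp Require Export complex.

Set Implicit Arguments.
Unset Strict Implicit.
Unset Printing Implicit Defensive.

Import Order.TTheory GRing.Theory Num.Theory.
Import numFieldNormedType.Exports.

Local Open Scope classical_set_scope.
Local Open Scope ring_scope.
Local Open Scope complex_scope.

(* The topology and norm of a numFieldType are not inferred on the concrete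
   type R[i]; they are copied from R[i]^o. *)
#[non_forgetful_inheritance]
HB.instance Definition _ (R : rcfType) := PseudoPointedMetric.copy R[i] R[i]^o.
#[non_forgetful_inheritance]
HB.instance Definition _ (R : rcfType) := NormedModule.copy R[i] R[i]^o.

Definition GL2Z : set 'M[int]_2 := [set A | A \in unitmx].

Definition is_subgroup_GL2Z (G : set 'M[int]_2) : Prop :=
  [/\ G `<=` GL2Z, G 1%:M,
      (forall A B, G A -> G B -> G (A *m B)) &
      (forall A, G A -> G (invmx A))].

Definition right_cosets (G : set 'M[int]_2) : set (set 'M[int]_2) :=
  [set C | exists2 g, GL2Z g & C = [set B *m g | B in G]].

Definition finite_index (G : set 'M[int]_2) : Prop :=
  finite_set (right_cosets G).

Definition GL2Z_index (G : set 'M[int]_2) : nat := #|` fset_set (right_cosets G)|%fset.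

Definition coset (G : set 'M[int]_2) : Type := set_type (right_cosets G).
HB.instance Definition _ (G : set 'M[int]_2) := Choice.on (coset G).

Definition digit_mx (m : nat) : 'M[int]_2 :=
  \matrix_(i, j) if i == 0 then (if j == 0 then 0 else 1)
                 else (if j == 0 then 1 else m%:Z).

Lemma digit_mx_unit (m : nat) : GL2Z (digit_mx m).
Proof.
rewrite /GL2Z /= unitmxE (expand_det_row _ 0) !big_ord_recl big_ord0.
by rewrite /cofactor !det_mx11 !mxE /= mul0r add0r addr0 mul1r mulr1.
Qed.

Lemma right_cosets_mulr (G C : set 'M[int]_2) (A : 'M[int]_2) :
  GL2Z A -> right_cosets G C -> right_cosets G [set B *m A | B in C].
Proof.
move=> uA [g ug ->]; exists (g *m A); first by rewrite /GL2Z /= unitmx_mul ug.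
apply/seteqP; split=> X /=.
  by move=> [_ [B GB <-] <-]; exists B => //; rewrite mulmxA.
by move=> [B GB <-]; exists (B *m g); [exists B|rewrite mulmxA].
Qed.

Definition coset_digit (G : set 'M[int]_2) (v : coset G) (m : nat) : coset G :=
  exist _ [set B *m digit_mx m | B in val v]
    (mem_set (right_cosets_mulr (digit_mx_unit m) (set_valP v))).

Section TransferOperator.
Variable R : realType.
Variable G : set 'M[int]_2.

Definition cexp (z : R[i]) : R[i] :=
  (expR (complex.Re z))%:C * (cos (complex.Im z) +i* sin (complex.Im z)).

(* A function on [0,1] x (cosets) is represented by a total function of the
   real variable; every notion below only uses its values on [0,1]. *)
Definition fun_I : Type := R -> coset G -> R[i].

(* Derivative within [0,1], hence one-sided at the endpoints. *)
Definition dquot01 (f : R -> R[i]) (x y : R) : R[i] :=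
  (f y - f x) / (y - x)%:C.
Definition deriv01 (f : R -> R[i]) (x : R) : R[i] :=
  lim (dquot01 f x y @[y --> within `[0, 1] x^']).
Definition C1_01 (f : R -> R[i]) : Prop :=
  (forall x, x \in `[0, 1] -> cvg (dquot01 f x y @[y --> within `[0, 1] x^']))
  /\ {within `[0, 1], continuous (deriv01 f)}.

Definition C1 (Psi : fun_I) : Prop := forall u, C1_01 (Psi ^~ u).

(* The restriction of Psi to [0,1] x {u}, extended by zero to all of I_Gamma.
   The sum over u in partialI is a sum of functions on I_Gamma, so that
   partialI Psi (x, v) is 1/k times the derivative of Psi(., v) at x; it is not
   the average over u of these derivatives, for which normt would not even be a
   norm with respect to which the transfer operators are bounded. *)
Definition restr (u : coset G) (Psi : fun_I) : fun_I :=
  fun x v => if v == u then Psi x v else 0.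

Definition partialI (Psi : fun_I) : fun_I := fun x v =>
  (GL2Z_index G)%:R^-1 * \sum_(u \in [set: coset G]) deriv01 (restr u Psi ^~ v) x.

Definition norm0 (Psi : fun_I) : \bar R :=
  ereal_sup [set (Normc.normc (Psi x v))%:E | x in `[0, 1] & v in [set: coset G]].

Definition normt (t : R) (Psi : fun_I) : \bar R :=
  (norm0 Psi + `|t|^-1%:E * norm0 (partialI Psi))%E.

Definition opnormt (t : R) (L : fun_I -> fun_I) : \bar R :=
  ereal_sup [set normt t (L Psi) | Psi in [set Psi | C1 Psi /\ (normt t Psi <= 1)%E]].

Definition transfer (s : R[i]) (w : coset G -> R[i]) (Psi : fun_I) : fun_I :=
  fun x v => lim ((\sum_(1 <= m < n)
    cexp (w (coset_digit v m)) * cexp (- (2 * s) * (ln (m%:R + x))%:C)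
      * Psi (m%:R + x)^-1 (coset_digit v m)) @[n --> \oo]).

Definition is_eigenvalue (L : fun_I -> fun_I) (mu : R[i]) : Prop :=
  exists Psi : fun_I, [/\ C1 Psi,
    (exists2 x, x \in `[0, 1] & exists v, Psi x v != 0) &
    (forall x v, x \in `[0, 1] -> L Psi x v = mu * Psi x v)].

Definition is_dominant_eigenvalue (L : fun_I -> fun_I) (l : R) : Prop :=
  [/\ 0 < l, is_eigenvalue L l%:C &
      forall mu, is_eigenvalue L mu -> Normc.normc mu <= l].

(* The number l with is_dominant_eigenvalue (unique when it exists), and 0,
   which is not one, if there is none. *)
Definition lambda (sigma : R) (x : coset G -> R) : R :=
  xget 0 (is_dominant_eigenvalue (transfer sigma%:C (fun u => (x u)%:C))).

(* The value taken for the contraction ratio of the Gauss map; it bounds the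
   limsup from above, so the threshold 1 / rho ^+ 2 = 4 is the less
   restrictive one. *)
Definition rho : R := 2^-1.

End TransferOperator.

(* Main.v *)
(* A function psi is followed through a positive majorant u that also controls
   its oscillation: |psi| <= u and |psi x - psi y| <= (e^{b D(x,y)} - 1) u(y),
   with b = 20 |t| and D(x,y) = |ln (1 + x) - ln (1 + y)|, a metric which every
   inverse branch of the Gauss map contracts by 1/2.  The transfer operator acts
   on such pairs.  For two large digits M and 2M the phases t ln (m + x) of the
   corresponding branches turn at different speeds, so that at one of the points
   x and x + 1/|t| the two terms cannot be nearly aligned; the majorant may
   therefore be lowered there (Dolgopyat's cancellation), and by Cauchy-Schwarz
   the integral of (1 + x) u^2, which the operator with parameter s = 1 does not
   increase, decreases by a definite factor.  Another log_2 |t| steps smooth u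
   and turn this integral bound into a uniform one, at the price of a factor |t|.
   Interpolating with the trivial bound lambda^n replaces |t| by |t|^xi.

   The dominant eigenfunction is a limit, along an ultrafilter, of weighted sums
   of iterates of the constant 1, taken in the cone of functions satisfying all
   the linear inequalities satisfied by the kernels (1 + th x)^{-2 s}: this cone
   is stable under the operator, its members are Lipschitz with Lipschitz
   derivative, and pointwise limits remain in it.  The eigenfunction does not
   vanish since the digits act transitively on the cosets; it dominates any
   other eigenfunction. *)

Require Import Defs.
From mathcomp Require Import all_boot all_order all_algebra.
From mathcomp Require Import all_classical all_reals all_analysis.
From mathcomp Require finmap.
From mathcomp Require Import ring lra zify.
Import Order.TTheory GRing.Theory Num.Theory.
Import numFieldNormedType.Exports.

Local Open Scope classical_set_scope.
Local Open Scope ring_scope.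
Local Open Scope complex_scope.

Set Implicit Arguments.
Unset Strict Implicit.
Unset Printing Implicit Defensive.

(** * The logarithmic metric *)

(** Gain and loss are compared at one fixed scale. Each Cauchy-Schwarz step costs a factor [A] that
    tends to 1 at the point (1, 0), while the cancellation saves [cgap M / 4], which depends only on
    a digit [M] chosen once and for all. The neighbourhood K is cut so small that this saving
    dominates both [A - 1] and the possible defect of the eigenvalue below 1; explicit one-sided
    estimates suffice, and no spectral perturbation theory enters.

    The imaginary parts of w may be arbitrary: they are constant along each branch and drop out of
    the phase increments between two points, which are all that the cancellation uses.

    Majorants also avoid the differentiation of series: the derivative of an iterate is bounded at
    the very end from its oscillation at scales below 1 / |t|. *)

Section Elementary.
Variable R : realType.
Implicit Types x y z : R.

Lemma expR_sub1_le z : expR z - 1 <= z * expR z.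
Proof.
have h := expR_ge1Dx (- z); have e0 := expR_gt0 z.
have hN : expR (- z) * expR z = 1 by rewrite -expRD addNr expR0.
nra.
Qed.

(** Convexity of the exponential: spare room in an exponent pays for at least the same factor in
    front. *)
Lemma expR_sub1_scale (c y : R) : 1 <= c -> 0 <= y ->
  c * (expR y - 1) <= expR (c * y) - 1.
Proof.
move=> c1 y0; have h := expR_sub1_le y.
have h2 := expR_ge1Dx ((c - 1) * y); have e0 := expR_gt0 y.
have -> : c * y = y + (c - 1) * y by ring.
rewrite expRD; nra.
Qed.

Lemma expR_ge1 z : 0 <= z -> 1 <= expR z.
Proof. by move=> z0; have := expR_ge1Dx z; lra. Qed.

Lemma expR_small z : 0 <= z <= 2^-1 -> expR z - 1 <= 2 * z.
Proof.
move=> /andP[z0 z1]; have h := expR_ge1Dx (- z); have e0 := expR_gt0 z.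
have hN : expR (- z) * expR z = 1 by rewrite -expRD addNr expR0.
nra.
Qed.

Lemma expR1_le3 : expR 1 <= 3 :> R.
Proof.
have h6 := expR_ge1Dx (- 8^-1 : R).
have p : expR (- 1 : R) = expR (- 8^-1) ^+ 8.
  by rewrite -expRM_natl; congr expR; field.
have q : 7 / 8 <= expR (- 8^-1 : R) by lra.
have : (7/8) ^+ 8 <= expR (- 8^-1 : R) ^+ 8 by apply: lerXn2r => //; rewrite nnegrE; lra.
rewrite -p => h8.
have hN : expR (- 1 : R) * expR 1 = 1 by rewrite -expRD addNr expR0.
nra.
Qed.

Definition hb (m : nat) (x : R) : R := (m%:R + x)^-1.
Definition DD (x y : R) : R := `|ln (1 + x) - ln (1 + y)|.

Lemma hb01 m x : (1 <= m)%N -> 0 <= x <= 1 -> 0 <= hb m x <= 1.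
Proof.
move=> m1 /andP[x0 _]; have m1R : 1 <= m%:R :> R by rewrite (ler_nat R 1).
by rewrite /hb invr_ge0 invf_le1; lra.
Qed.

Lemma DD_ge0 x y : 0 <= DD x y. Proof. exact: normr_ge0. Qed.

Lemma DDC x y : DD x y = DD y x. Proof. exact: distrC. Qed.

Lemma DDxx x : DD x x = 0. Proof. by rewrite /DD subrr normr0. Qed.

Lemma DDE x y : 0 <= x -> x <= y -> DD x y = ln (1 + y) - ln (1 + x).
Proof.
move=> x0 xy; rewrite /DD distrC ger0_norm// subr_ge0 ler_ln ?posrE; lra.
Qed.

Lemma ln_ratio (a b : R) : 0 < a -> 0 < b -> ln a - ln b = ln (a / b).
Proof. by move=> a0 b0; rewrite lnM ?posrE ?invr_gt0// lnV ?posrE. Qed.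

Lemma lnMpos (a b : R) : 0 < a -> 0 < b -> ln (a * b) = ln a + ln b.
Proof. by move=> a0 b0; rewrite lnM ?posrE. Qed.

Lemma DD_le_aux x y : 0 <= x -> x <= y -> DD x y <= y - x.
Proof.
move=> x0 xy; rewrite DDE// ln_ratio; [|lra|lra].
have -> : (1 + y) / (1 + x) = 1 + (y - x) / (1 + x) by field; lra.
have h : 0 <= (y - x) / (1 + x) by apply: divr_ge0; lra.
apply: le_trans (le_ln1Dx _) _; first lra.
by rewrite ler_pdivrMr; nra.
Qed.

Lemma DD_le x y : 0 <= x -> 0 <= y -> DD x y <= `|x - y|.
Proof.
move=> x0 y0; have [xy|/ltW yx] := leP x y.
  by rewrite distrC ger0_norm ?DD_le_aux// subr_ge0.
by rewrite DDC ger0_norm ?DD_le_aux// subr_ge0.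
Qed.

Lemma DD_ge_aux x y : 0 <= x -> x <= y -> y <= 1 -> y - x <= 2 * DD x y.
Proof.
move=> x0 xy y1; rewrite DDE//.
have -> : ln (1 + y) - ln (1 + x) = - (ln (1 + x) - ln (1 + y)) by ring.
rewrite (ln_ratio (a := 1 + x)); [|lra|lra].
have e : (1 + x) / (1 + y) = 1 + - ((y - x) / (1 + y)) by field; lra.
have h0 : 0 < (1 + x) / (1 + y) by apply: divr_gt0; lra.
have := @le_ln1Dx R (- ((y - x) / (1 + y))); rewrite -e => /(_ ltac:(lra)).
have : (y - x) / 2 <= (y - x) / (1 + y).
  by apply: ler_wpM2l; [lra|rewrite lef_pV2 ?posrE; lra].
lra.
Qed.

Lemma DD_ge x y : 0 <= x <= 1 -> 0 <= y <= 1 -> `|x - y| <= 2 * DD x y.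
Proof.
move=> /andP[x0 x1] /andP[y0 y1]; have [xy|/ltW yx] := leP x y.
  by rewrite distrC ger0_norm ?DD_ge_aux// subr_ge0.
by rewrite DDC ger0_norm ?DD_ge_aux// subr_ge0.
Qed.

Lemma DD_le1 x y : 0 <= x <= 1 -> 0 <= y <= 1 -> DD x y <= 1.
Proof.
move=> /andP[x0 x1] /andP[y0 y1]; apply: le_trans (DD_le x0 y0) _.
by rewrite ler_norml; lra.
Qed.

Lemma hb_le m x y : (1 <= m)%N -> 0 <= x -> x <= y -> hb m y <= hb m x.
Proof.
move=> m1 x0 xy; have m1R : 1 <= m%:R :> R by rewrite (ler_nat R 1).
by rewrite /hb lef_pV2 ?posrE; lra.
Qed.

Lemma hb_ge0 m x : 0 <= x -> 0 <= hb m x.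
Proof. by move=> x0; rewrite invr_ge0 addr_ge0. Qed.

Lemma onehb m x : (1 <= m)%N -> 0 <= x -> 1 + hb m x = (m%:R + 1 + x) / (m%:R + x).
Proof.
move=> m1 x0; have m1R : 1 <= m%:R :> R by rewrite (ler_nat R 1).
by rewrite /hb; field; lra.
Qed.

Lemma ln_sqM_le (a b c d : R) : 0 < a -> 0 < b -> 0 < c -> 0 < d ->
  ln (a * a * c) <= ln (b * b * d) -> ln a - ln b <= (ln d - ln c) / 2.
Proof. by move=> a0 b0 c0 d0; rewrite !lnMpos ?mulr_gt0//; lra. Qed.

(** In the coordinate ln (1 + x) the branch has derivative (1 + x) / ((m + x) (m + 1 + x)) in
    modulus, at most 1 / 2. The Euclidean metric would not do: 1 / (1 + x) has slope -1 at 0. *)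
Lemma DD_hb m x y : (1 <= m)%N -> 0 <= x <= 1 -> 0 <= y <= 1 ->
  DD (hb m x) (hb m y) <= DD x y / 2.
Proof.
move=> m1; wlog xy : x y / x <= y => [H hx hy|/andP[x0 x1] /andP[y0 y1]].
  have [xy|/ltW yx] := leP x y; first exact: H.
  by rewrite DDC (DDC x); exact: H.
have m1R : 1 <= m%:R :> R by rewrite (ler_nat R 1).
rewrite DDC DDE ?hb_ge0 ?hb_le// DDE// !onehb//.
set A := _ / _; set B := (_ + _ + y) / _.
have A0 : 0 < A by apply: divr_gt0; lra.
have B0 : 0 < B by apply: divr_gt0; lra.
suff : ln (A * A * (1 + x)) <= ln (B * B * (1 + y)).
  by apply: ln_sqM_le => //; lra.
pose p : R := m%:R + x; pose q : R := m%:R + y.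
(* With [A = B * (1 + z)] the goal becomes (1 + z)^2 (1 + x) <= 1 + y. *)
pose z := (y - x) / (p * (q + 1)).
have ez : z * (p * (q + 1)) = y - x by rewrite /z /p /q; field; lra.
have eA : A = B * (1 + z) by rewrite /A /B /z /p /q; field; lra.
have p1 : 1 + x <= p by rewrite /p; lra.
have q1 : 1 + y <= q by rewrite /q; lra.
have z0 : 0 <= z by rewrite /z divr_ge0 ?mulr_ge0//; lra.
have pq : 1 <= p * (q + 1) by nra.
have zy : z <= y.
  by apply: (@le_trans _ _ (z * (p * (q + 1)))); [rewrite ler_peMr|lra].
have key : (1 + z) * (1 + z) * (1 + x) <= 1 + y.
  have : z * (2 + z) * (1 + x) <= z * (q + 1) * p.
    by apply: ler_pM => //; [rewrite mulr_ge0; lra|lra|apply: ler_wpM2l => //; lra].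
  nra.
clearbody A B.
rewrite ler_ln ?posrE; [|by rewrite !mulr_gt0//; lra|by rewrite !mulr_gt0//; lra].
rewrite eA; have -> : B * (1 + z) * (B * (1 + z)) * (1 + x) = B * B * ((1 + z) * (1 + z) * (1 + x)) by ring.
by apply: ler_wpM2l => //; rewrite mulr_ge0 ?ltW.
Qed.

(** Large digits contract by far more than 1 / 2, which keeps psi / u nearly constant along the
    branches M and 2M at distance 1 / |t|. *)
Lemma DD_hb_big m x y : (1 <= m)%N -> 0 <= x <= 1 -> 0 <= y <= 1 ->
  DD (hb m x) (hb m y) <= `|x - y| / m%:R ^+ 2.
Proof.
move=> m1; wlog xy : x y / x <= y => [H hx hy|/andP[x0 x1] /andP[y0 y1]].
  have [xy|/ltW yx] := leP x y; first exact: H.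
  by rewrite DDC distrC; exact: H.
have m1R : 1 <= m%:R :> R by rewrite (ler_nat R 1).
rewrite distrC ger0_norm ?subr_ge0// DDC.
apply: le_trans (DD_le_aux _ _) _; rewrite ?hb_ge0 ?hb_le//.
have -> : hb m x - hb m y = (y - x) / ((m%:R + x) * (m%:R + y)).
  by rewrite /hb; field; lra.
apply: ler_wpM2l; first lra.
rewrite lef_pV2 ?posrE; [|by rewrite mulr_gt0; lra|by rewrite exprn_gt0; lra].
by rewrite expr2; apply: ler_pM; lra.
Qed.

(** Since 1 / (a + x) <= 1 / (1 + x), the phases and weights of all digits are Lipschitz for [DD]
    with a constant independent of the digit. *)
Lemma ln_shift (a x y : R) : 1 <= a -> 0 <= x -> 0 <= y ->
  `|ln (a + x) - ln (a + y)| <= DD x y.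
Proof.
move=> a1; wlog xy : x y / x <= y => [H hx hy|x0 y0].
  have [xy|/ltW yx] := leP x y; first exact: H.
  by rewrite DDC distrC; exact: H.
rewrite DDE// distrC ger0_norm; last by rewrite subr_ge0 ler_ln ?posrE; lra.
rewrite !ln_ratio; [|lra..].
rewrite ler_ln ?posrE; [|apply: divr_gt0; lra|apply: divr_gt0; lra].
rewrite ler_pdivrMr; last lra.
by rewrite mulrAC ler_pdivlMr; last lra; nra.
Qed.

(* Telescoping, and of the order of m^{-3/2}: it bounds all the terms to be summed. *)
Definition kap (m : nat) : R := (Num.sqrt m%:R)^-1 - (Num.sqrt m.+1%:R)^-1.

Lemma kap_ge0 m : (1 <= m)%N -> 0 <= kap m.
Proof.
move=> m1; have m1R : 1 <= m%:R :> R by rewrite (ler_nat R 1).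
rewrite /kap subr_ge0 lef_pV2 ?posrE ?sqrtr_gt0 ?ltr0n//.
by rewrite ler_sqrt ?ler_nat// ltr0n.
Qed.

Lemma sum_kap p q : (1 <= p)%N -> (p <= q)%N ->
  \sum_(p <= m < q) kap m = (Num.sqrt p%:R)^-1 - (Num.sqrt q%:R)^-1.
Proof.
move=> p1 pq; rewrite -[RHS]opprB -(telescope_sumr (fun m => (Num.sqrt m%:R : R)^-1) pq).
by rewrite -sumrN; apply: eq_bigr => i _; rewrite opprB.
Qed.

(** With s = sqrt y and b = sqrt (y + 1), the difference of inverses is 1 / (s b (s + b)), and b (s
    + b) <= 4 s^2 because b^2 = s^2 + 1 <= 2 s^2. *)
Lemma inv_pow32_le (y a : R) : 1 <= y -> 3 / 2 <= a ->
  expR (- (a * ln y)) <= 4 * ((Num.sqrt y)^-1 - (Num.sqrt (y + 1))^-1).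
Proof.
move=> y1 a32; set s := Num.sqrt y; set b := Num.sqrt (y + 1).
have s1 : 1 <= s by rewrite -sqrtr1 ler_sqrt; lra.
have ss : s ^+ 2 = y by rewrite sqr_sqrtr; lra.
have bb : b ^+ 2 = y + 1 by rewrite sqr_sqrtr; lra.
have sb : s <= b by rewrite ler_sqrt; lra.
have ly : ln y = ln s * 2 by rewrite -ss lnXn ?mulr_natr//; lra.
have ls : 0 <= ln s by apply: ln_ge0.
have : expR (- (a * ln y)) <= expR (- (ln s * 3)) by rewrite ler_expR ly; nra.
have -> : expR (- (ln s * 3)) = (s ^+ 3)^-1.
  by rewrite expRN mulrC expRM_natl lnK// posrE; lra.
move=> /le_trans; apply.
have -> : s^-1 - b^-1 = 1 / (s * b * (s + b)).
  have -> : s^-1 - b^-1 = (b ^+ 2 - s ^+ 2) / (s * b * (s + b)) by field; lra.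
  by rewrite bb ss; congr (_ / _); ring.
rewrite mul1r ler_pdivlMr ?invr_gt0; last by rewrite !mulr_gt0; lra.
rewrite mulrC ler_pdivrMr; last by apply: exprn_gt0; lra.
have : b * (s + b) <= 4 * s ^+ 2 by nra.
nra.
Qed.

End Elementary.

(** * Sums over the digits *)

Section RealSums.
Variable R : realType.
Implicit Types (a b : nat -> R) (C : R).

Definition psum a n := \sum_(1 <= m < n) a m.
Definition rsum a : R := lim (psum a n @[n --> \oo]).
Definition dominated C a := forall m, (1 <= m)%N -> `|a m| <= C * kap R m.

Lemma inv_sqrt_small C (e : R) : 0 < e ->
  exists2 N, (1 <= N)%N & forall n, (N <= n)%N -> C * (Num.sqrt n%:R)^-1 < e.
Proof.
move=> e0; pose x := (`|C| / e) ^+ 2.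
exists (Num.bound x).+1 => // n Nn.
have xn : x < n%:R.
  apply: lt_le_trans (archi_boundP (sqr_ge0 _)) _.
  by rewrite ler_nat (leq_trans _ Nn).
have n0 : 0 < n%:R :> R by apply: le_lt_trans xn; exact: sqr_ge0.
have s0 : 0 < Num.sqrt n%:R :> R by rewrite sqrtr_gt0.
rewrite ltr_pdivrMr//; apply: le_lt_trans (ler_norm _) _.
rewrite mulrC -ltr_pdivrMr//.
have c0 : 0 <= `|C| / e by apply: divr_ge0 (normr_ge0 _) (ltW e0).
have -> : `|C| / e = Num.sqrt x by rewrite sqrtr_sqr (ger0_norm c0).
by rewrite ltr_sqrt.
Qed.

Lemma psumS a n : (1 <= n)%N -> psum a n.+1 = psum a n + a n.
Proof. by move=> n1; rewrite /psum big_nat_recr. Qed.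

Lemma psum_split a p q : (1 <= p)%N -> (p <= q)%N ->
  psum a q - psum a p = \sum_(p <= m < q) a m.
Proof. move=> p1 pq; have -> : psum a q = psum a p + \sum_(p <= m < q) a m by exact: big_cat_nat.
by rewrite addrC addKr. Qed.

Lemma psum_tail C a p q : dominated C a -> (1 <= p)%N -> (p <= q)%N ->
  `|psum a q - psum a p| <= C * (Num.sqrt p%:R)^-1.
Proof.
move=> Da p1 pq; rewrite psum_split//.
apply: le_trans (ler_norm_sum _ _ _) _.
apply: (@le_trans _ _ (\sum_(p <= m < q) C * kap R m)).
  by rewrite !big_nat; apply: ler_sum => i /andP[pi _]; apply: Da; exact: leq_trans pi.
rewrite -mulr_sumr sum_kap//.
have C0 : 0 <= C.
  have := Da 1%N isT; have := @kap_ge0 R 1 isT => k0 h.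
  have k1 : 0 < kap R 1.
    rewrite /kap subr_gt0 ltf_pV2 ?posrE ?sqrtr_gt0 ?ltr0n//.
    by rewrite ltr_sqrt ?ltr_nat.
  by rewrite -(pmulr_lge0 _ k1); apply: le_trans h.
by apply: ler_wpM2l => //; rewrite gerBl invr_ge0 sqrtr_ge0.
Qed.

Lemma cvg_psum C a : dominated C a -> psum a n @[n --> \oo] --> rsum a.
Proof.
move=> Da; suff h : cvg (psum a n @[n --> \oo]) by exact: h.
apply: (@R_complete R (psum a n @[n --> \oo])); apply: (@cauchy_exP R R) => e e0.
have [N N1 HN] := inv_sqrt_small C e0.
exists (psum a N); exists N => // n /= Nn.
rewrite /ball /= distrC; apply: le_lt_trans (psum_tail Da N1 Nn) _.
exact: HN.
Qed.

Lemma rsum_tail C a n : dominated C a -> (1 <= n)%N ->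
  `|rsum a - psum a n| <= C * (Num.sqrt n%:R)^-1.
Proof.
move=> Da n1.
have h : `|psum a k - psum a n| @[k --> \oo] --> `|rsum a - psum a n|.
  by apply: cvg_norm; apply: cvgB; [exact: cvg_psum Da|exact: cvg_cst].
apply: (cvgr_to_le h); exists n => // k /= nk.
exact: psum_tail.
Qed.

Lemma rsum_eq C a (l : R) : (forall n, (1 <= n)%N -> `|l - psum a n| <= C * (Num.sqrt n%:R)^-1) ->
  psum a n @[n --> \oo] --> l /\ rsum a = l.
Proof.
move=> H; suff h : psum a n @[n --> \oo] --> l by split => //; apply: cvg_lim.
apply/cvgrPdist_lt => e e0; have [N N1 HN] := inv_sqrt_small C e0.
exists N => // n /= Nn; apply: le_lt_trans (H _ _) (HN _ Nn); exact: leq_trans Nn.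
Qed.

Lemma dominatedD C C' a b : dominated C a -> dominated C' b ->
  dominated (C + C') (fun m => a m + b m).
Proof.
by move=> Da Db m m1; rewrite mulrDl (le_trans (ler_normD _ _))// lerD ?Da ?Db.
Qed.

Lemma dominatedZ C (k : R) a : dominated C a -> dominated (`|k| * C) (fun m => k * a m).
Proof.
by move=> Da m m1; rewrite normrM -mulrA ler_wpM2l// Da.
Qed.

Lemma psumD a b n : psum (fun m => a m + b m) n = psum a n + psum b n.
Proof. exact: big_split. Qed.

Lemma psumZ (k : R) a n : psum (fun m => k * a m) n = k * psum a n.
Proof. by rewrite /psum mulr_sumr. Qed.

Lemma rsumD C C' a b : dominated C a -> dominated C' b ->
  rsum (fun m => a m + b m) = rsum a + rsum b.
Proof.
move=> Da Db; apply: cvg_lim => //.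
rewrite (_ : psum _ = (fun n => psum a n + psum b n)); last by apply/funext => n; exact: psumD.
by apply: cvgD; [exact: cvg_psum Da|exact: cvg_psum Db].
Qed.

Lemma rsumZ C (k : R) a : dominated C a -> rsum (fun m => k * a m) = k * rsum a.
Proof.
move=> Da; apply: cvg_lim => //.
rewrite (_ : psum _ = (fun n => k * psum a n)); last by apply/funext => n; exact: psumZ.
by apply: cvgM; [exact: cvg_cst|exact: cvg_psum Da].
Qed.

Lemma psum_le a b n : (forall m, (1 <= m)%N -> a m <= b m) -> psum a n <= psum b n.
Proof.
by move=> H; rewrite /psum !big_nat; apply: ler_sum => i /andP[i1 _]; exact: H.
Qed.

Lemma rsum_psum_le C C' a b (c d : R) N : dominated C a -> dominated C' b ->
  (forall n, (N <= n)%N -> c * psum a n + d <= psum b n) -> c * rsum a + d <= rsum b.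
Proof.
move=> Da Db H.
have h : psum b n - (c * psum a n + d) @[n --> \oo] --> rsum b - (c * rsum a + d).
  apply: cvgB; first exact: cvg_psum Db.
  apply: cvgD; last exact: cvg_cst.
  by apply: cvgM; [exact: cvg_cst|exact: cvg_psum Da].
rewrite -subr_ge0; apply: (cvgr_to_ge h); exists N => // n /= Nn.
by rewrite subr_ge0 H.
Qed.

Lemma rsum_le C C' a b : dominated C a -> dominated C' b ->
  (forall m, (1 <= m)%N -> a m <= b m) -> rsum a <= rsum b.
Proof.
move=> Da Db H; have := @rsum_psum_le _ _ _ _ 1 0 0%N Da Db.
by rewrite mul1r addr0; apply => n _; rewrite mul1r addr0; exact: psum_le.
Qed.

Lemma dominated0 : dominated 0 (fun=> 0 : R).
Proof. by move=> m m1; rewrite normr0 mul0r. Qed.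

Lemma rsum0 : rsum (fun=> 0) = 0.
Proof.
apply: cvg_lim => //; rewrite (_ : psum _ = fun=> 0); first exact: cvg_cst.
by apply/funext => n; rewrite /psum big1.
Qed.

Lemma rsum_ge0 C a : dominated C a -> (forall m, (1 <= m)%N -> 0 <= a m) -> 0 <= rsum a.
Proof. by move=> Da H; rewrite -rsum0; apply: (rsum_le dominated0 Da). Qed.

Lemma psum_le_rsum C a n : dominated C a -> (forall m, (1 <= m)%N -> 0 <= a m) ->
  psum a n <= rsum a.
Proof.
move=> Da H; apply: (cvgr_to_ge (cvg_psum Da)); exists n => // k /= nk.
case: n nk => [|n] nk; first by rewrite /psum big_geq// big_nat; apply: sumr_ge0 => i /andP[i1 _]; exact: H.
rewrite -subr_ge0 psum_split// big_nat; apply: sumr_ge0 => i /andP[ni _]; apply: H.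
exact: leq_trans ni.
Qed.

Lemma term_le_rsum C a m : dominated C a -> (forall m, (1 <= m)%N -> 0 <= a m) ->
  (1 <= m)%N -> a m <= rsum a.
Proof.
move=> Da H m1; apply: le_trans (psum_le_rsum m.+1 Da H).
rewrite psumS// lerDr /psum big_nat; apply: sumr_ge0 => i /andP[i1 _]; exact: H.
Qed.

Lemma rsum_abs_le C a : dominated C a -> `|rsum a| <= C.
Proof.
move=> Da; have := rsum_tail Da (leqnn 1).
by rewrite [psum _ 1]big_geq// subr0 sqrtr1 invr1 mulr1.
Qed.

Lemma cauchy_schwarz_sum a b (q : nat -> R) n : (forall m, (1 <= m)%N -> 0 < q m) ->
  (psum (fun m => a m * b m) n) ^+ 2 <=
  psum (fun m => a m ^+ 2 / q m) n * psum (fun m => q m * b m ^+ 2) n.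
Proof.
move=> q0; case: n => [|n]; first by rewrite /psum !big_geq// expr0n mul0r.
elim: n => [|n IH]; first by rewrite /psum !big_geq// expr0n mul0r.
rewrite !(psumS _ (ltn0Sn n)).
set X := psum _ _ in IH *; set P := psum _ _ in IH *; set Q := psum _ _ in IH *.
have P0 : 0 <= P.
  rewrite /P /psum big_nat; apply: sumr_ge0 => i /andP[i1 _].
  by rewrite divr_ge0 ?sqr_ge0// ltW// q0.
have Q0 : 0 <= Q.
  rewrite /Q /psum big_nat; apply: sumr_ge0 => i /andP[i1 _].
  by rewrite mulr_ge0 ?sqr_ge0// ltW// q0.
have qn := q0 n.+1 isT; set k := q n.+1 in qn *.
set u := a _; set v := b _.
have -> : (P + u ^+ 2 / k) * (Q + k * v ^+ 2) =
  P * Q + (P * (k * v ^+ 2) + Q * (u ^+ 2 / k)) + (u * v) ^+ 2 by field; lra.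
have -> : (X + u * v) ^+ 2 = X ^+ 2 + 2 * (X * (u * v)) + (u * v) ^+ 2 by ring.
rewrite lerD2r lerD//.
set s := P * (k * v ^+ 2); set t := Q * (u ^+ 2 / k).
have s0 : 0 <= s by rewrite mulr_ge0// mulr_ge0 ?sqr_ge0// ltW.
have t0 : 0 <= t by rewrite mulr_ge0// divr_ge0 ?sqr_ge0// ltW.
have st : s * t = P * Q * (u * v) ^+ 2 by rewrite /s /t; field; lra.
(* It remains that |2 X u v| <= s + t. Squared, this is X^2 (u v)^2 <= P Q (u v)^2 = s t together
   with 4 s t <= (s + t)^2. *)
apply: le_trans (ler_norm _) _.
rewrite -(ger0_norm (addr_ge0 s0 t0)) -ler_sqr ?nnegrE ?normr_ge0// !real_normK ?num_real//.
have : X ^+ 2 * (u * v) ^+ 2 <= s * t by rewrite st ler_wpM2r ?sqr_ge0.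
have := sqr_ge0 (s - t); nra.
Qed.

End RealSums.

(** * Complex series over the digits *)

Section ComplexSums.
Variable R : realType.
Implicit Types (z : nat -> R[i]) (C : R).
Local Notation normc := (@Normc.normc R).

Lemma normc_ge0 (x : R[i]) : 0 <= normc x.
Proof. by case: x => a b; exact: sqrtr_ge0. Qed.

Lemma normcE_real (x : R[i]) : `|x| = (normc x)%:C.
Proof. by []. Qed.

Lemma normcR (a : R) : normc a%:C = `|a|.
Proof. by rewrite /= expr0n addr0 sqrtr_sqr. Qed.

Lemma normcB (x y : R[i]) : normc (x - y) = normc (y - x).
Proof. by rewrite -(normcN (x - y)) opprB. Qed.

Lemma ler_normcD (x y : R[i]) : normc (x + y) <= normc x + normc y.
Proof. exact: le_normcD. Qed.

Lemma ler_normcB (x y : R[i]) : normc (x - y) <= normc x + normc y.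
Proof. by rewrite -(normcN y); exact: le_normcD. Qed.

Lemma ler_dist_normc (x y : R[i]) : `|normc x - normc y| <= normc (x - y).
Proof.
have h1 := ler_normcD (x - y) y; have h2 := ler_normcD (y - x) x.
rewrite subrK in h1; rewrite subrK normcB in h2.
by rewrite ler_norml; lra.
Qed.

Lemma Re_le_normc (x : R[i]) : `|complex.Re x| <= normc x.
Proof.
case: x => a b /=; rewrite -sqrtr_sqr ler_sqrt ?addr_ge0 ?sqr_ge0//.
by rewrite lerDl sqr_ge0.
Qed.

Lemma Im_le_normc (x : R[i]) : `|complex.Im x| <= normc x.
Proof.
case: x => a b /=; rewrite -sqrtr_sqr ler_sqrt ?addr_ge0 ?sqr_ge0//.
by rewrite lerDr sqr_ge0.
Qed.

Lemma normc_le_ReIm (x : R[i]) : normc x <= `|complex.Re x| + `|complex.Im x|.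
Proof.
case: x => a b /=; rewrite -[leRHS]ger0_norm ?addr_ge0// -sqrtr_sqr.
rewrite ler_sqrt ?sqr_ge0// sqrrD !real_normK ?num_real//.
have : 0 <= `|a| * `|b| by rewrite mulr_ge0.
lra.
Qed.

Lemma sqr_normc_ReIm (x : R[i]) : normc x ^+ 2 = complex.Re x ^+ 2 + complex.Im x ^+ 2.
Proof. by case: x => a b /=; rewrite sqr_sqrtr// addr_ge0 ?sqr_ge0. Qed.

Lemma ltcE (x y : R[i]) : (x < y) = (complex.Im y == complex.Im x) && (complex.Re x < complex.Re y).
Proof. by case: x y => a b [c d]. Qed.

(** The norm of R[i] is itself R[i]-valued; a positive element of R[i] is real, so real radii
    suffice. *)
Lemma cvg_normcP T (F : set_system T) {FF : Filter F} (f : T -> R[i]) (l : R[i]) :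
  f x @[x --> F] --> l <->
  (forall e : R, 0 < e -> \forall x \near F, normc (l - f x) < e).
Proof.
split=> [/cvgrPdist_lt H e e0|H].
  have e0' : 0 < e%:C by rewrite ltcE/= eqxx.
  by apply: filterS (H _ e0') => x; rewrite normcE_real ltcE/= => /andP[].
apply/cvgrPdist_lt => e; rewrite ltcE/= => /andP[/eqP ei er].
apply: filterS (H _ er) => x hx.
by rewrite normcE_real ltcE/= ei eqxx.
Qed.

Lemma cvg_limC T (F : set_system T) {FF : ProperFilter F} (f : T -> R[i]) (l : R[i]) :
  f x @[x --> F] --> l -> lim (f x @[x --> F]) = l.
Proof. by apply: cvg_lim; exact: norm_hausdorff. Qed.

Lemma cvg_complex T (F : set_system T) {FF : Filter F} (f g : T -> R) (a b : R) :
  f x @[x --> F] --> a -> g x @[x --> F] --> b ->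
  (f x +i* g x) @[x --> F] --> a +i* b.
Proof.
move=> /cvgrPdist_lt fa /cvgrPdist_lt gb; apply/cvg_normcP => e e0.
have e2 : 0 < e / 2 by lra.
apply: filterS2 (fa _ e2) (gb _ e2) => x h1 h2.
by apply: le_lt_trans (normc_le_ReIm _) _ => /=; lra.
Qed.

Definition cpsum z n := \sum_(1 <= m < n) z m.
Definition csum z : R[i] := lim (cpsum z n @[n --> \oo]).
Definition cdominated C z := dominated C (fun m => normc (z m)).

Lemma Re_cpsum z n : complex.Re (cpsum z n) = psum (fun m => complex.Re (z m)) n.
Proof.
rewrite /cpsum /psum; elim/big_rec2: _ => //= i x y _ <-.
by case: (z i) y => [a b] [c d].
Qed.

Lemma Im_cpsum z n : complex.Im (cpsum z n) = psum (fun m => complex.Im (z m)) n.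
Proof.
rewrite /cpsum /psum; elim/big_rec2: _ => //= i x y _ <-.
by case: (z i) y => [a b] [c d].
Qed.

Lemma normc_cpsum z n : normc (cpsum z n) <= psum (fun m => normc (z m)) n.
Proof.
rewrite /cpsum /psum; elim/big_rec2: _ => [|i x y _ h].
  by rewrite -[0]/((0 : R)%:C) normcR normr0.
by apply: le_trans (ler_normcD _ _) _; rewrite lerD2l.
Qed.

Lemma cdominated_Re C z : cdominated C z -> dominated C (fun m => complex.Re (z m)).
Proof.
move=> D m m1; apply: le_trans (Re_le_normc _) _.
by have := D m m1; rewrite ger0_norm ?normc_ge0.
Qed.

Lemma cdominated_Im C z : cdominated C z -> dominated C (fun m => complex.Im (z m)).
Proof.
move=> D m m1; apply: le_trans (Im_le_normc _) _.
by have := D m m1; rewrite ger0_norm ?normc_ge0.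
Qed.

Lemma cvg_cpsum C z : cdominated C z -> cpsum z n @[n --> \oo] --> csum z.
Proof.
move=> D.
have h : cpsum z n @[n --> \oo] -->
    (rsum (fun m => complex.Re (z m)) +i* rsum (fun m => complex.Im (z m))).
  rewrite (_ : cpsum z = fun n => psum (fun m => complex.Re (z m)) n +i* psum (fun m => complex.Im (z m)) n).
    apply: cvg_complex.
      exact: (cvg_psum (cdominated_Re D)).
    exact: (cvg_psum (cdominated_Im D)).
  by apply/funext => n; rewrite -Re_cpsum -Im_cpsum; case: (cpsum z n).
by rewrite /csum (cvg_limC h).
Qed.

Lemma normc_csum_le C C' z b (c d : R) N : cdominated C z -> dominated C' b ->
  (forall n, (N <= n)%N -> normc (cpsum z n) <= c * psum b n + d) ->
  normc (csum z) <= c * rsum b + d.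
Proof.
move=> Dz Db H.
have h : c * psum b n + d - normc (cpsum z n) @[n --> \oo] --> c * rsum b + d - normc (csum z).
  apply: cvgB.
    apply: cvgD; last exact: cvg_cst.
    by apply: cvgM; [exact: cvg_cst|exact: cvg_psum Db].
  apply/cvgrPdist_lt => e e0.
  move/cvg_normcP : (cvg_cpsum Dz) => /(_ _ e0); apply: filterS => n.
  by apply: le_lt_trans; exact: ler_dist_normc.
rewrite -subr_ge0; apply: (cvgr_to_ge h); exists N => // n /= Nn.
by rewrite subr_ge0 H.
Qed.

Lemma csumB C C' z z' : cdominated C z -> cdominated C' z' ->
  csum (fun m => z m - z' m) = csum z - csum z'.
Proof.
move=> D D'; apply: cvg_limC.
rewrite (_ : cpsum _ = fun n => cpsum z n - cpsum z' n).
  by apply: cvgB; [exact: cvg_cpsum D|exact: cvg_cpsum D'].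
by apply/funext => n; rewrite /cpsum sumrB.
Qed.

Lemma csum_real C (a : nat -> R) : dominated C a ->
  csum (fun m => (a m)%:C) = (rsum a)%:C.
Proof.
move=> D; apply: cvg_limC.
rewrite (_ : cpsum _ = fun n => psum a n +i* 0).
  by apply: cvg_complex; [exact: cvg_psum D|exact: cvg_cst].
apply/funext => n; rewrite /cpsum /psum; elim/big_rec2: _ => //= i x y _ ->.
by rewrite [LHS]/GRing.add/= add0r.
Qed.

End ComplexSums.

(** * Transfer operators and majorants *)

Section Cis.
Variable R : realType.
Implicit Types a b : R.
Local Notation normc := (@Normc.normc R).

Definition cis a : R[i] := cos a +i* sin a.

Lemma normc_cis a : normc (cis a) = 1.
Proof. by rewrite /= cos2Dsin2 sqrtr1. Qed.

Lemma cisD a b : cis (a + b) = cis a * cis b.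
Proof. by rewrite /cis cosD sinD; congr (_ +i* _); ring. Qed.

Lemma cexpM (z w : R[i]) : cexp z * cexp w = cexp (z + w).
Proof.
case: z w => [a b] [c d].
rewrite /cexp /= -!/(cis _) cisD expRD -[in RHS]/((expR a)%:C * (expR c)%:C).
by rewrite mulrACA -rmorphM.
Qed.

Lemma cexpE (z : R[i]) : cexp z = (expR (complex.Re z))%:C * cis (complex.Im z).
Proof. by []. Qed.

Lemma cos_lip a b : `|cos a - cos b| <= `|a - b|.
Proof.
wlog ab : a b / b <= a => [H|].
  have [ba|/ltW ab] := leP b a; first exact: H.
  by rewrite distrC (distrC a); exact: H.
have [c _ ->] := @MVT_segment R cos (fun x => - sin x) b a ab
  (fun x _ => is_derive_cos x) (continuous_subspaceT (@continuous_cos R)).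
rewrite normrM ler_piMl// normrN ler_norml sin_le1 andbT.
exact: sin_geN1.
Qed.

Lemma sin_lip a b : `|sin a - sin b| <= `|a - b|.
Proof.
wlog ab : a b / b <= a => [H|].
  have [ba|/ltW ab] := leP b a; first exact: H.
  by rewrite distrC (distrC a); exact: H.
have [c _ ->] := @MVT_segment R sin cos b a ab
  (fun x _ => is_derive_sin x) (continuous_subspaceT (@continuous_sin R)).
rewrite normrM ler_piMl// ler_norml cos_le1 andbT.
exact: cos_geN1.
Qed.

Lemma cis_lip a b : normc (cis a - cis b) <= 2 * `|a - b|.
Proof.
apply: le_trans (normc_le_ReIm _) _ => /=.
have := cos_lip a b; have := sin_lip a b; lra.
Qed.

Lemma sin_ge_half a : 0 <= a <= 2^-1 -> a / 2 <= sin a.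
Proof.
move=> /andP[a0 a1].
have [c] := @MVT_segment R sin cos 0 a a0
  (fun x _ => is_derive_sin x) (continuous_subspaceT (@continuous_sin R)).
rewrite in_itv/= sin0 !subr0 => /andP[c0 ca] ->.
have := cos_lip 0 c; rewrite cos0 sub0r normrN (ger0_norm c0) ler_norml.
nra.
Qed.

Lemma cis_sub1_ge a : 0 <= `|a| <= 2^-1 -> `|a| / 2 <= normc (cis a - 1).
Proof.
move=> h; apply: le_trans (Im_le_normc _).
have -> : complex.Im (cis a - 1) = sin a by rewrite /= subr0.
have [a0|a0] := leP 0 a.
  rewrite (ger0_norm a0) in h *; apply: le_trans (ler_norm _); exact: sin_ge_half.
rewrite (ltr0_norm a0) in h *.
rewrite -[sin a]opprK normrN -sinN; apply: le_trans (ler_norm _); exact: sin_ge_half.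
Qed.

End Cis.

Section Operators.
Variables (R : realType) (V : Type) (act : nat -> V -> V).
Local Notation normc := (@Normc.normc R).
Local Notation hb := (@hb R).
Implicit Types (s t b x y U : R) (v : V) (X Y : V -> R) (u : R -> V -> R) (psi : R -> V -> R[i]).

Definition wt s X m x v : R := expR (X (act m v) - 2 * s * ln (m%:R + x)).

Definition Lr s X u x v : R := rsum (fun m => wt s X m x v * u (hb m x) (act m v)).

Definition cwt s X t Y m x v : R[i] :=
  (wt s X m x v)%:C * cis (Y (act m v) - 2 * t * ln (m%:R + x)).

Definition Lc s X t Y psi x v : R[i] :=
  csum (fun m => cwt s X t Y m x v * psi (hb m x) (act m v)).

(** The bound 7 / 8 makes 2 s and 4 s - 2, the decay exponents before and after Cauchy-Schwarz, at
    least 3 / 2; the bound 9 / 8 keeps 2 s below 3. *)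
Definition near10 s X := (7 / 8 <= s <= 9 / 8) /\ (forall v, `|X v| <= 1).

Definition loglip b u :=
  [/\ forall x v, 0 <= x <= 1 -> 0 < u x v,
      forall x y v, 0 <= x <= 1 -> 0 <= y <= 1 -> u x v <= expR (b * DD x y) * u y v &
      exists U, forall x v, 0 <= x <= 1 -> u x v <= U].

(** The shape e^{b D} - 1 is stable under products: (E - 1) F + (F - 1) = E F - 1, so the exponents
    of weights and functions simply add. *)
Definition majorized b psi u :=
  (forall x v, 0 <= x <= 1 -> normc (psi x v) <= u x v) /\
  (forall x y v, 0 <= x <= 1 -> 0 <= y <= 1 ->
     normc (psi x v - psi y v) <= (expR (b * DD x y) - 1) * u y v).

Lemma wt_gt0 s X m x v : 0 < wt s X m x v.
Proof. exact: expR_gt0. Qed.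

Lemma wt_le s X m x v : near10 s X -> (1 <= m)%N -> 0 <= x <= 1 ->
  wt s X m x v <= 12 * kap R m.
Proof.
move=> [/andP[s1 s2] hX] m1 /andP[x0 x1].
have m1R : 1 <= m%:R :> R by rewrite (ler_nat R 1).
have h := @inv_pow32_le R m%:R (2 * s) m1R ltac:(lra).
have e1 : expR (X (act m v)) <= 3.
  apply: le_trans (expR1_le3 R); rewrite ler_expR.
  exact: le_trans (ler_norm _) (hX _).
have -> : 12 * kap R m = 3 * (4 * ((Num.sqrt m%:R)^-1 - (Num.sqrt (m%:R + 1))^-1)).
  by rewrite /kap -(@natr1 _ m); ring.
rewrite /wt expRD; apply: ler_pM; rewrite ?expR_ge0//.
apply: le_trans h; rewrite ler_expR lerN2 ler_wpM2l//; first lra.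
by rewrite ler_ln ?posrE; lra.
Qed.

Lemma wt_loglip s X m x y v : near10 s X -> (1 <= m)%N -> 0 <= x <= 1 -> 0 <= y <= 1 ->
  wt s X m x v <= expR (3 * DD x y) * wt s X m y v.
Proof.
move=> [/andP[s1 s2] hX] m1 /andP[x0 x1] /andP[y0 y1].
have m1R : 1 <= m%:R :> R by rewrite (ler_nat R 1).
rewrite /wt -expRD ler_expR.
have := ln_shift m1R x0 y0; have := DD_ge0 x y; rewrite ler_norml => D0 /andP[h1 h2].
nra.
Qed.

Lemma wt_dist s X m x y v : near10 s X -> (1 <= m)%N -> 0 <= x <= 1 -> 0 <= y <= 1 ->
  `|wt s X m x v - wt s X m y v| <= (expR (3 * DD x y) - 1) * wt s X m y v.
Proof.
move=> ok m1 hx hy; have h1 := wt_loglip v ok m1 hx hy.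
have h2 := wt_loglip v ok m1 hy hx; rewrite DDC in h2.
have w0 := wt_gt0 s X m y v; have w1 := wt_gt0 s X m x v.
by rewrite ler_norml; nra.
Qed.

Lemma cwt_norm s X t Y m x v : normc (cwt s X t Y m x v) = wt s X m x v.
Proof. by rewrite /cwt Normc.normcM normc_cis mulr1 normcR gtr0_norm ?wt_gt0. Qed.

Lemma cwt_dist s X t Y m x y v : near10 s X -> (1 <= m)%N -> 0 <= x <= 1 -> 0 <= y <= 1 ->
  normc (cwt s X t Y m x v - cwt s X t Y m y v) <=
    (expR ((3 + 4 * `|t|) * DD x y) - 1) * wt s X m y v.
Proof.
move=> ok m1 hx hy; rewrite /cwt.
set cx := cis _; set cy := cis (_ - _ * ln (_ + y)).
set wx := wt _ _ _ x _; set wy := wt _ _ _ y _.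
have -> : wx%:C * cx - wy%:C * cy = (wx - wy)%:C * cx + wy%:C * (cx - cy).
  by rewrite rmorphB/=; ring.
apply: le_trans (ler_normcD _ _) _.
rewrite !Normc.normcM !normcR normc_cis mulr1 [`|wy|]gtr0_norm ?wt_gt0//.
have h1 : `|wx - wy| <= (expR (3 * DD x y) - 1) * wy by exact: wt_dist.
have h2 : normc (cx - cy) <= 4 * `|t| * DD x y.
  apply: le_trans (cis_lip _ _) _.
  have -> : Y (act m v) - 2 * t * ln (m%:R + x) - (Y (act m v) - 2 * t * ln (m%:R + y)) =
    2 * t * (ln (m%:R + y) - ln (m%:R + x)) by ring.
  rewrite !normrM (ger0_norm (ler0n _ 2)).
  have m1R : 1 <= m%:R :> R by rewrite (ler_nat R 1).
  move: hx hy => /andP[x0 _] /andP[y0 _].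
  have := ln_shift m1R y0 x0; rewrite (DDC y) => h.
  have := normr_ge0 t; nra.
have w0 : 0 < wy by exact: wt_gt0.
have D0 := DD_ge0 x y; have t0 := normr_ge0 t.
rewrite [X in expR X - 1]mulrDl expRD.
have e3 : 1 <= expR (3 * DD x y) by apply: expR_ge1; rewrite mulr_ge0.
have e4 := expR_ge1Dx (4 * `|t| * DD x y).
have p : 0 <= 4 * `|t| * DD x y by rewrite !mulr_ge0.
have : 4 * `|t| * DD x y <= expR (3 * DD x y) * (expR (4 * `|t| * DD x y) - 1).
  by nra.
nra.
Qed.

Lemma loglip_ge0 b u : loglip b u -> exists2 U, 0 <= U & forall x v, 0 <= x <= 1 -> 0 <= u x v <= U.
Proof.
move=> [u0 _ [U hU]]; exists (Num.max 0 U); first by rewrite le_max lexx.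
by move=> x v hx; rewrite ltW ?u0//= le_max hU// orbT.
Qed.

Lemma wtM_dom s X (f : R -> V -> R) U x v : near10 s X -> 0 <= x <= 1 ->
  (forall x v, 0 <= x <= 1 -> `|f x v| <= U) ->
  dominated (12 * U) (fun m => wt s X m x v * f (hb m x) (act m v)).
Proof.
move=> ok hx hf m m1; have h01 := hb01 m1 hx.
rewrite normrM gtr0_norm ?wt_gt0// mulrAC.
by apply: ler_pM; [exact: ltW (wt_gt0 _ _ _ _ _)|exact: normr_ge0|exact: wt_le|exact: hf].
Qed.

Lemma loglip_dom s X b u : near10 s X -> loglip b u ->
  exists C, forall x v, 0 <= x <= 1 ->
   dominated C (fun m => wt s X m x v * u (hb m x) (act m v)).
Proof.
move=> ok /loglip_ge0[U U0 hU]; exists (12 * U) => x v hx.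
apply: wtM_dom => // y w hy; have /andP[? ?] := hU y w hy.
by rewrite ger0_norm.
Qed.

Lemma cwtM_dom s X t Y psi U x v : near10 s X -> 0 <= x <= 1 ->
  (forall x v, 0 <= x <= 1 -> normc (psi x v) <= U) ->
  cdominated (12 * U) (fun m => cwt s X t Y m x v * psi (hb m x) (act m v)).
Proof.
move=> ok hx hf m m1; have h01 := hb01 m1 hx.
rewrite ger0_norm ?normc_ge0// Normc.normcM cwt_norm mulrAC.
by apply: ler_pM; [exact: ltW (wt_gt0 _ _ _ _ _)|exact: normc_ge0|exact: wt_le|exact: hf].
Qed.

Lemma Lr_term_le s X b u x v m : near10 s X -> loglip b u -> 0 <= x <= 1 -> (1 <= m)%N ->
  wt s X m x v * u (hb m x) (act m v) <= Lr s X u x v.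
Proof.
move=> ok hu hx m1; have [C hC] := loglip_dom ok hu.
apply: (term_le_rsum (hC x v hx)) => // k k1.
by rewrite mulr_ge0 ?ltW ?wt_gt0//; case: hu => + _ _; apply; exact: hb01.
Qed.

Lemma wtu_loglip s X b u m x y v : near10 s X -> 0 <= b -> loglip b u -> (1 <= m)%N ->
  0 <= x <= 1 -> 0 <= y <= 1 ->
  wt s X m x v * u (hb m x) (act m v) <=
    expR ((3 + b / 2) * DD x y) * (wt s X m y v * u (hb m y) (act m v)).
Proof.
move=> ok b0 [u0 hu _] m1 hx hy.
rewrite mulrDl expRD mulrACA; apply: ler_pM; [exact: ltW (wt_gt0 _ _ _ _ _)|
  by apply: ltW; apply: u0; exact: hb01|exact: wt_loglip|].
apply: le_trans (hu _ _ _ (hb01 m1 hx) (hb01 m1 hy)) _.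
rewrite ler_pM2r ?u0 ?hb01// ler_expR -mulrA ler_wpM2l//.
by have := DD_hb m1 hx hy; lra.
Qed.

(** The weights contribute 2 s <= 3 and the branches halve b. The map b -> 3 + b / 2 has fixed point
    6, the regularity that long iterates approach from any start. *)
Lemma Lr_loglip s X b u : near10 s X -> 0 <= b -> loglip b u -> loglip (3 + b / 2) (Lr s X u).
Proof.
move=> ok b0 hu; have [C hC] := loglip_dom ok hu; split.
- move=> x v hx; apply: lt_le_trans (Lr_term_le v ok hu hx (leqnn 1)).
  by rewrite mulr_gt0 ?wt_gt0//; case: hu => + _ _; apply; exact: hb01.
- move=> x y v hx hy; rewrite -(rsumZ _ (hC y v hy)).
  apply: (rsum_le (hC x v hx) (dominatedZ _ (hC y v hy))) => m m1.
  exact: wtu_loglip.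
- exists C => x v hx; apply: le_trans (ler_norm _) _; exact: (rsum_abs_le (hC x v hx)).
Qed.

Lemma maj_bounded b psi u : loglip b u -> majorized b psi u ->
  exists U, forall x v, 0 <= x <= 1 -> normc (psi x v) <= U.
Proof.
move=> [_ _ [U hU]] [h _]; exists U => x v hx; exact: le_trans (h _ _ hx) (hU _ _ hx).
Qed.

Lemma Lc_le s X t Y b psi u x v : near10 s X -> loglip b u ->
  (forall y w, 0 <= y <= 1 -> normc (psi y w) <= u y w) -> 0 <= x <= 1 ->
  normc (Lc s X t Y psi x v) <= Lr s X u x v.
Proof.
move=> ok hu hm hx; have [C hC] := loglip_dom ok hu.
have [U hU] : exists U, forall y w, 0 <= y <= 1 -> normc (psi y w) <= U.
  by have [_ _ [U hU]] := hu; exists U => y w hy; exact: le_trans (hm _ _ hy) (hU _ _ hy).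
rewrite -[leRHS]mul1r -[leRHS]addr0.
apply: (@normc_csum_le _ _ _ _ _ 1 0 0%N (cwtM_dom t Y v ok hx hU) (hC x v hx)) => n _.
rewrite mul1r addr0; apply: le_trans (normc_cpsum _ _) _.
apply: psum_le => m m1; rewrite Normc.normcM cwt_norm ler_pM2l ?wt_gt0//.
by apply: hm; exact: hb01.
Qed.

Lemma cterm_dist s X t Y b psi u m x y v : near10 s X -> 0 <= b -> loglip b u ->
  majorized b psi u -> (1 <= m)%N -> 0 <= x <= 1 -> 0 <= y <= 1 ->
  normc (cwt s X t Y m x v * psi (hb m x) (act m v) - cwt s X t Y m y v * psi (hb m y) (act m v))
  <= (expR ((3 + 4 * `|t| + b / 2) * DD x y) - 1) * (wt s X m y v * u (hb m y) (act m v)).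
Proof.
move=> ok b0 hu [hm1 hm2] m1 hx hy.
have hhx := hb01 m1 hx; have hhy := hb01 m1 hy.
set al := cwt _ _ _ _ _ x _; set be := cwt _ _ _ _ _ y _.
set px := psi (hb m x) _; set py := psi (hb m y) _.
have -> : al * px - be * py = (al - be) * px + be * (px - py) by ring.
apply: le_trans (ler_normcD _ _) _; rewrite (Normc.normcM (al - be)) (Normc.normcM be).
have -> : normc be = wt s X m y v by exact: cwt_norm.
have h1 : normc (al - be) <= (expR ((3 + 4 * `|t|) * DD x y) - 1) * wt s X m y v by exact: cwt_dist.
set uy := u (hb m y) _.
have eb : expR (b * DD (hb m x) (hb m y)) <= expR (b / 2 * DD x y).
  by rewrite ler_expR -mulrA ler_wpM2l//; have := DD_hb m1 hx hy; lra.
have uy0 : 0 < uy by case: hu => + _ _; apply.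
have h2 : normc px <= expR (b / 2 * DD x y) * uy.
  apply: le_trans (hm1 _ _ hhx) _; case: hu => _ hu2 _; apply: le_trans (hu2 _ _ _ hhx hhy) _.
  by rewrite ler_pM2r.
have h3 : normc (px - py) <= (expR (b / 2 * DD x y) - 1) * uy.
  by apply: le_trans (hm2 _ _ _ hhx hhy) _; rewrite ler_pM2r// lerB.
rewrite [X in (expR X - 1)]mulrDl expRD.
set E := expR (_ * DD x y) in h1 *; set F := expR (b / 2 * _) in h2 h3 *.
have w0 := wt_gt0 s X m y v; set w := wt _ _ _ y _ in w0 h1 *.
have : normc (al - be) * normc px <= (E - 1) * w * (F * uy).
  by apply: ler_pM; rewrite ?normc_ge0.
have : w * normc (px - py) <= w * ((F - 1) * uy) by rewrite ler_pM2l.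
have -> : (E * F - 1) * (w * uy) = (E - 1) * w * (F * uy) + w * ((F - 1) * uy) by ring.
lra.
Qed.

(** In 3 + 4 |t| + b / 2, the modulus of the weight gives 3, the phase 2 t ln (m + x) gives 4 |t|
    through the factor 2 of [cis_lip], and the contraction of the branches gives b / 2. *)
Lemma Lc_dist s X t Y b psi u x y v : near10 s X -> 0 <= b -> loglip b u -> majorized b psi u ->
  0 <= x <= 1 -> 0 <= y <= 1 ->
  normc (Lc s X t Y psi x v - Lc s X t Y psi y v) <=
    (expR ((3 + 4 * `|t| + b / 2) * DD x y) - 1) * Lr s X u y v.
Proof.
move=> ok b0 hu hm hx hy; have [C hC] := loglip_dom ok hu; have [U hU] := maj_bounded hu hm.
have Dx := cwtM_dom t Y v ok hx hU; have Dy := cwtM_dom t Y v ok hy hU.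
rewrite /Lc -(csumB Dx Dy) -[leRHS]addr0.
have Dxy : cdominated (12 * U + 12 * U)
   (fun m => cwt s X t Y m x v * psi (hb m x) (act m v) - cwt s X t Y m y v * psi (hb m y) (act m v)).
  move=> m m1; rewrite ger0_norm ?normc_ge0//; apply: le_trans (ler_normcB _ _) _.
  rewrite mulrDl; apply: lerD.
    by have := Dx m m1; rewrite ger0_norm ?normc_ge0.
  by have := Dy m m1; rewrite ger0_norm ?normc_ge0.
apply: (@normc_csum_le _ _ _ _ _ _ 0 0%N Dxy (hC y v hy)) => n _.
rewrite addr0; apply: le_trans (normc_cpsum _ _) _.
rewrite -psumZ; apply: psum_le => m m1; exact: cterm_dist.
Qed.

Lemma loglipW b b' u : b <= b' -> loglip b u -> loglip b' u.
Proof.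
move=> bb [u0 h2 h3]; split => // x y v hx hy; apply: le_trans (h2 _ _ _ hx hy) _.
by rewrite ler_pM2r ?u0// ler_expR ler_wpM2r ?DD_ge0.
Qed.

Lemma Lc_majorized s X t Y psi u : near10 s X -> 4 <= `|t| ->
  loglip (20 * `|t|) u -> majorized (20 * `|t|) psi u ->
  loglip (20 * `|t|) (Lr s X u) /\ majorized (20 * `|t|) (Lc s X t Y psi) (Lr s X u).
Proof.
move=> ok t4 hu hm; have b0 : 0 <= 20 * `|t| by lra.
split; first by apply: loglipW (Lr_loglip ok b0 hu); lra.
split=> [x v hx|x y v hx hy]; first exact: (Lc_le _ _ _ ok hu hm.1 hx).
apply: le_trans (Lc_dist t Y v ok b0 hu hm hx hy) _.
have [l0 _ _] := Lr_loglip ok b0 hu.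
by rewrite ler_pM2r ?l0// lerB// ler_expR ler_wpM2r ?DD_ge0//; lra.
Qed.

End Operators.

(** * Cancellation between two digits *)

Section UNI.
Variable R : realType.
Local Notation normc := (@Normc.normc R).
Implicit Types (a b x y m : R).

Lemma ln1D_ge (q : R) : 0 <= q <= 1 -> q / 2 <= ln (1 + q).
Proof.
move=> /andP[q0 q1].
have e : (1 + q)^-1 = 1 + - (q / (1 + q)) by field; lra.
have := @le_ln1Dx R (- (q / (1 + q))).
have i0 : 0 < (1 + q)^-1 by rewrite invr_gt0; lra.
rewrite -e lnV ?posrE; last lra.
move=> /(_ ltac:(lra)).
have : q / 2 <= q / (1 + q) by apply: ler_wpM2l => //; rewrite lef_pV2 ?posrE; lra.
lra.
Qed.

(** The four logarithms combine to ln (1 + q), with q between (y - x) / (6 m) and (y - x) / (2 m).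
    Over a distance 1 / |t| the relative phase, 2 t times this quantity, therefore turns by an angle
    between 1 / (6 m) and 1 / m, whatever t is. *)
Lemma phase_gap m x y : 1 <= m -> 0 <= x -> x <= y -> y <= 1 ->
  (y - x) / (12 * m) <= (ln (m + y) - ln (m + x)) - (ln (m + m + y) - ln (m + m + x)) <= (y - x) / (2 * m).
Proof.
move=> m1 x0 xy y1.
pose q := m * (y - x) / ((m + x) * (m + m + y)).
have -> : (ln (m + y) - ln (m + x)) - (ln (m + m + y) - ln (m + m + x)) = ln (1 + q).
  have -> : 1 + q = ((m + y) * (m + m + x)) / ((m + x) * (m + m + y)) by rewrite /q; field; lra.
  rewrite -ln_ratio; [|by rewrite mulr_gt0; lra|by rewrite mulr_gt0; lra].
  by rewrite !lnMpos; lra.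
have P0 : 0 < (m + x) * (m + m + y) by rewrite mulr_gt0; lra.
have q0 : 0 <= q by rewrite /q; apply: divr_ge0; [apply: mulr_ge0; lra|exact: ltW].
have qu : q <= (y - x) / (2 * m).
  rewrite /q ler_pdivrMr// mulrAC ler_pdivlMr; last lra.
  have : (y - x) * (2 * m * m) <= (y - x) * ((m + x) * (m + m + y)).
    by apply: ler_wpM2l; [lra|nra].
  lra.
have ql : (y - x) / (6 * m) <= q.
  rewrite /q ler_pdivlMr// mulrAC ler_pdivrMr; last lra.
  have : (y - x) * ((m + x) * (m + m + y)) <= (y - x) * (6 * m * m).
    by apply: ler_wpM2l; [lra|nra].
  lra.
have q1 : q <= 1.
  apply: le_trans qu _; rewrite ler_pdivrMr; lra.
have := ln1D_ge (introT andP (conj q0 q1)).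
have := @le_ln1Dx R q ltac:(lra) => h1 h2.
apply/andP; split; last lra.
apply: le_trans h2.
have -> : (y - x) / (12 * m) = (y - x) / (6 * m) / 2 by field; lra.
by rewrite ler_pM2r.
Qed.

Lemma parallelogram (a b : R[i]) :
  normc (a - b) ^+ 2 + normc (a + b) ^+ 2 = 2 * normc a ^+ 2 + 2 * normc b ^+ 2.
Proof.
by rewrite !sqr_normc_ReIm; case: a b => [a1 a2] [b1 b2] /=; ring.
Qed.

(** By the parallelogram identity |a - b|^2 <= 4 - |a + b|^2, and this is at most 4 w^2. *)
Lemma almost_equal (a b : R[i]) (w : R) : 0 <= w <= 1 -> normc a <= 1 -> normc b <= 1 ->
  2 - w ^+ 2 <= normc (a + b) -> normc (a - b) <= 2 * w /\ 1 - w ^+ 2 <= normc b.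
Proof.
move=> /andP[w0 w1] a1 b1 h.
have p := parallelogram a b.
have a0 := normc_ge0 a; have b0 := normc_ge0 b; have d0 := normc_ge0 (a - b).
have t := ler_normcD a b; split; last lra.
have w2 : 0 <= w ^+ 2 <= 1 by rewrite sqr_ge0 expr_le1.
rewrite -ler_sqr ?nnegrE//; last lra.
nra.
Qed.

(* If the two pairs of terms are both nearly aligned, the phase difference between
   the branches cannot change by as much as k / 6 from one point to the other. *)
Lemma uni_gap (k : R) (p1 p2 p1' p2' : R) (a1 a2 a1' a2' : R[i]) :
  0 < k <= 1 ->
  k / 12 <= `|(p1' - p1) - (p2' - p2)| / 2 ->
  `|(p1' - p1) - (p2' - p2)| <= 2^-1 ->
  normc a1 <= 1 -> normc a2 <= 1 -> normc a1' <= 1 -> normc a2' <= 1 ->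
  normc (a1' - a1) <= k / 100 -> normc (a2' - a2) <= k / 100 ->
  2 - (k / 200) ^+ 2 <= normc (cis p1 * a1 + cis p2 * a2) ->
  2 - (k / 200) ^+ 2 <= normc (cis p1' * a1' + cis p2' * a2') -> False.
Proof.
move=> /andP[k0 k1] dl du h1 h2 h1' h2' da1 da2 s s'.
set om := k / 200 in s s'.
have o1 : 0 <= om <= 1 by rewrite /om; lra.
have oms : om ^+ 2 <= 1 / 2.
  by apply: (@le_trans _ _ om); [rewrite expr2 ler_piMr|rewrite /om]; lra.
have nc p (a : R[i]) : normc (cis p * a) = normc a by rewrite Normc.normcM normc_cis mul1r.
have [l1 l2] := almost_equal o1 (eq_ind_r (fun z => z <= 1) h1 (nc p1 a1)) (eq_ind_r (fun z => z <= 1) h2 (nc p2 a2)) s.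
have [l1' l2'] := almost_equal o1 (eq_ind_r (fun z => z <= 1) h1' (nc p1' a1')) (eq_ind_r (fun z => z <= 1) h2' (nc p2' a2')) s'.
rewrite nc in l2.
set del := (p1' - p1) - (p2' - p2) in dl du.
have big : normc ((cis (p1' - p1) * cis p2 - cis p2') * a2) <= (2 * om + 2 * om) + (k / 100 + k / 100).
  have -> : (cis (p1' - p1) * cis p2 - cis p2') * a2 =
     cis (p1' - p1) * (cis p2 * a2 - cis p1 * a1) + (cis p1' * a1' - cis p2' * a2')
     + (cis p2' * (a2' - a2) - cis p1' * (a1' - a1)).
    have e : cis p1' = cis (p1' - p1) * cis p1 by rewrite -cisD subrK.
    by rewrite [in RHS]e; ring.
  apply: le_trans (ler_normcD _ _) _.
  apply: lerD.
    apply: le_trans (ler_normcD _ _) _; rewrite nc normcB; exact: lerD.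
  apply: le_trans (ler_normcB _ _) _; rewrite !nc; exact: lerD.
have ed : normc (cis (p1' - p1) * cis p2 - cis p2') = normc (cis del - 1).
  have -> : cis (p1' - p1) * cis p2 - cis p2' = cis p2' * (cis del - 1).
    by rewrite -cisD mulrBr mulr1 -cisD; congr (cis _ - _); rewrite /del; ring.
  exact: nc.
have g : k / 12 <= normc (cis del - 1).
  by apply: le_trans dl _; apply: cis_sub1_ge; rewrite normr_ge0.
rewrite Normc.normcM ed in big.
(* The product is at least k / 24, whereas [big] bounds it by 4 k / 200 + 2 k / 100 = k / 25. *)
have : k / 12 * (1 / 2) <= normc (cis del - 1) * normc a2 by apply: ler_pM => //; lra.
move=> u1; have := le_trans u1 big; rewrite /om; clear -k0; lra.
Qed.

(** Write the larger coefficient as r1 = (r1 - r2) + r2: only the common part r2 profits from the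
    cancellation between b1 and b2. *)
Lemma gain_two (r1 r2 : R) (b1 b2 : R[i]) : 0 <= r1 -> 0 <= r2 -> normc b1 <= 1 -> normc b2 <= 1 ->
  normc (r1%:C * b1 + r2%:C * b2) <= r1 + r2 - Num.min r1 r2 * (2 - normc (b1 + b2)).
Proof.
wlog r21 : r1 r2 b1 b2 / r2 <= r1 => [H h1 h2 n1 n2|r10 r20 n1 n2].
  have /orP[h|h] := le_total r2 r1; first exact: H.
  have := H r2 r1 b2 b1 h h2 h1 n2 n1.
  by rewrite addrC minC (addrC r2) (addrC b2).
rewrite (min_idPr r21).
have -> : r1%:C * b1 + r2%:C * b2 = (r1 - r2)%:C * b1 + r2%:C * (b1 + b2).
  by rewrite rmorphB/=; ring.
apply: le_trans (ler_normcD _ _) _; rewrite !Normc.normcM !normcR !ger0_norm ?subr_ge0//.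
have : (r1 - r2) * normc b1 <= r1 - r2 by rewrite ler_piMr ?subr_ge0.
lra.
Qed.

Lemma quot_dist (p q : R[i]) (u v E : R) : 0 < u -> 0 < v -> 1 <= E ->
  normc p <= u -> normc (p - q) <= (E - 1) * v -> u <= E * v -> v <= E * u ->
  normc (p / u%:C - q / v%:C) <= 2 * (E - 1).
Proof.
move=> u0 v0 E1 pu pq uv vu.
have uC : u%:C != 0 by rewrite -[0]/((0:R)%:C) (inj_eq (@complexI R)) gt_eqF.
have vC : v%:C != 0 by rewrite -[0]/((0:R)%:C) (inj_eq (@complexI R)) gt_eqF.
have -> : p / u%:C - q / v%:C = (p - q) / v%:C + p / u%:C * ((v - u) / v)%:C.
  by rewrite rmorphM rmorphB/= fmorphV; field; rewrite uC vC.
apply: le_trans (ler_normcD _ _) _.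
have nV (z : R) : 0 < z -> normc (z%:C)^-1 = z^-1.
  by move=> z0; rewrite Normc.normcV normcR gtr0_norm.
rewrite !Normc.normcM normcR !nV//.
have h1 : normc (p - q) / v <= E - 1 by rewrite ler_pdivrMr.
have h2 : normc p / u <= 1 by rewrite ler_pdivrMr// mul1r.
have h3 : `|(v - u) / v| <= E - 1.
  rewrite normrM [`|v^-1|]gtr0_norm ?invr_gt0// ler_pdivrMr// ler_norml; nra.
have : normc p / u * `|(v - u) / v| <= 1 * (E - 1).
  by apply: ler_pM => //; rewrite divr_ge0 ?normc_ge0// ltW.
lra.
Qed.

(** As r1 + r2 - g min = max + (1 - g) min, it is enough that max, min and 1 - g each change by a
    controlled factor; no negative term is left to compare. *)
Lemma min_gain_le (r1 r2 r1' r2' g g' E F G : R) :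
  0 <= r1' -> 0 <= r2' -> 0 <= r1 -> 0 <= r2 -> 0 <= F -> 1 <= G -> F * G <= E ->
  r1 <= F * r1' -> r2 <= F * r2' -> 0 <= g <= 1 -> 0 <= g' <= 1 -> 1 - g <= G * (1 - g') ->
  r1 + r2 - g * Num.min r1 r2 <= E * (r1' + r2' - g' * Num.min r1' r2').
Proof.
move=> p1 p2 p3 p4 F0 G1 FG h1 h2 /andP[g0 g1] /andP[g0' g1'] gl.
have mE (a c : R) : a + c = Num.max a c + Num.min a c by rewrite addr_max_min.
rewrite (mE r1) (mE r1').
have m0 : 0 <= Num.min r1 r2 by rewrite le_min p3.
have m0' : 0 <= Num.min r1' r2' by rewrite le_min p1.
have M0' : 0 <= Num.max r1' r2' by rewrite le_max p1.
have hmin : Num.min r1 r2 <= F * Num.min r1' r2'.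
  rewrite minr_pMr// le_min; apply/andP; split.
    by apply: le_trans h1; rewrite ge_min lexx.
  by apply: le_trans h2; rewrite ge_min lexx orbT.
have hmax : Num.max r1 r2 <= F * Num.max r1' r2'.
  rewrite ge_max; apply/andP; split.
    by apply: le_trans h1 _; rewrite ler_wpM2l// le_max lexx.
  by apply: le_trans h2 _; rewrite ler_wpM2l// le_max lexx orbT.
set a := Num.max r1 r2 in hmax *; set c := Num.min r1 r2 in m0 hmin *.
set a' := Num.max r1' r2' in M0' hmax *; set c' := Num.min r1' r2' in m0' hmin *.
have k1 : c * (1 - g) <= F * c' * (G * (1 - g')) by apply: ler_pM => //; lra.
have FE : F <= E by apply: le_trans FG; rewrite ler_peMr.
have k2 : F * G * (c' * (1 - g')) <= E * (c' * (1 - g')).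
  by rewrite ler_wpM2r// mulr_ge0//; lra.
have k3 : F * a' <= E * a' by rewrite ler_wpM2r.
lra.
Qed.

End UNI.

(** * The lowered majorant *)

Section Dolgopyat.
Variables (R : realType) (V : Type) (act : nat -> V -> V).
Variables (s t : R) (X Y : V -> R) (psi : R -> V -> R[i]) (u : R -> V -> R) (M : nat).
Local Notation normc := (@Normc.normc R).
Local Notation hb := (@hb R).
Hypotheses (ok : near10 s X) (t4 : 4 <= `|t|).
Hypotheses (hu : loglip (20 * `|t|) u) (hm : majorized (20 * `|t|) psi u).
Hypothesis hM : 80 * 100 <= M%:R :> R.
Implicit Types (x y : R) (v : V).

Lemma digit_ge1 : (1 <= M)%N.
Proof.
have hhM := hM; have h : 1 <= M%:R :> R by lra.
by rewrite (ler_nat R 1) in h.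
Qed.

Lemma double_digit_ge1 : (1 <= M + M)%N. Proof. by rewrite addn_gt0 digit_ge1. Qed.

#[local] Hint Resolve digit_ge1 double_digit_ge1 : core.

Definition branch_weight j x v : R := wt act s X j x v * u (hb j x) (act j v).
Definition branch_ratio j x v : R[i] := psi (hb j x) (act j v) / (u (hb j x) (act j v))%:C.
Definition branch_phase j x v : R := Y (act j v) - 2 * t * ln (j%:R + x).
Definition branch_dir j x v : R[i] := cis (branch_phase j x v) * branch_ratio j x v.

(* The relative loss in the triangle inequality between the branches M and 2M. *)
Definition gain x v : R := (2 - normc (branch_dir M x v + branch_dir (M + M) x v)) / 8.
(** Only the smaller of the two weights is reduced. The denominator 8 in [gain] keeps it below 1 /
    4, so that at least 3 / 4 of [Lr act s X u] remains. *)
Definition dolgopyat x v : R := Lr act s X u x v - gain x v * Num.min (branch_weight M x v) (branch_weight (M + M) x v).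

Lemma majorant_gt0 x v : 0 <= x <= 1 -> 0 < u x v. Proof. by case: hu => + _ _; apply. Qed.

Lemma branch_weight_gt0 j x v : (1 <= j)%N -> 0 <= x <= 1 -> 0 < branch_weight j x v.
Proof. by move=> j1 hx; rewrite mulr_gt0 ?wt_gt0// majorant_gt0// hb01. Qed.

Lemma normc_majorantV x v : 0 <= x <= 1 -> normc ((u x v)%:C^-1) = (u x v)^-1.
Proof. by move=> hx; rewrite Normc.normcV normcR gtr0_norm// majorant_gt0. Qed.

Lemma branch_ratio_le1 j x v : (1 <= j)%N -> 0 <= x <= 1 -> normc (branch_ratio j x v) <= 1.
Proof.
move=> j1 hx; have h := hb01 j1 hx.
by rewrite Normc.normcM normc_majorantV// ler_pdivrMr ?majorant_gt0// mul1r; case: hm => + _; apply.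
Qed.

Lemma branch_dir_le1 j x v : (1 <= j)%N -> 0 <= x <= 1 -> normc (branch_dir j x v) <= 1.
Proof. by move=> j1 hx; rewrite Normc.normcM normc_cis mul1r branch_ratio_le1. Qed.

Lemma branch_termE j x v : (1 <= j)%N -> 0 <= x <= 1 ->
  cwt act s X t Y j x v * psi (hb j x) (act j v) = (branch_weight j x v)%:C * branch_dir j x v.
Proof.
move=> j1 hx; have u0 := majorant_gt0 (act j v) (hb01 j1 hx).
have uC : (u (hb j x) (act j v))%:C != 0 by rewrite -[0]/((0:R)%:C) (inj_eq (@complexI R)) gt_eqF.
by rewrite /cwt /branch_weight /branch_dir /branch_ratio /branch_phase rmorphM/=; field.
Qed.

Lemma gain_bound x v : 0 <= x <= 1 -> 0 <= gain x v <= 1 / 4.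
Proof.
move=> hx; have h1 := branch_dir_le1 v digit_ge1 hx; have h2 := branch_dir_le1 v double_digit_ge1 hx.
have := ler_normcD (branch_dir M x v) (branch_dir (M + M) x v); have := normc_ge0 (branch_dir M x v + branch_dir (M + M) x v).
by rewrite /gain; lra.
Qed.

Lemma lip_ge0 : 0 <= 20 * `|t|. Proof. have ht4 := t4; lra. Qed.

Lemma branch_ratio_dist j x y v : (M <= j)%N -> 0 <= x <= 1 -> 0 <= y <= 1 ->
  normc (branch_ratio j x v - branch_ratio j y v) <= 2 * (expR (20 * `|t| * (`|x - y| / M%:R ^+ 2)) - 1).
Proof.
move=> Mj hx hy; have j1 : (1 <= j)%N by apply: leq_trans Mj.
have hhx := hb01 j1 hx; have hhy := hb01 j1 hy.
have D1 : DD (hb j x) (hb j y) <= `|x - y| / M%:R ^+ 2.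
  apply: le_trans (DD_hb_big j1 hx hy) _; apply: ler_wpM2l => //.
  have m0 : 0 < M%:R :> R by rewrite ltr0n.
  by rewrite lef_pV2 ?posrE ?exprn_gt0 ?ltr0n// ler_sqr ?nnegrE ?ler0n// ler_nat.
set E := expR _.
have E2 : expR (20 * `|t| * DD (hb j x) (hb j y)) <= E by rewrite ler_expR ler_wpM2l.
apply: quot_dist; rewrite ?majorant_gt0//.
- by apply: expR_ge1; rewrite mulr_ge0// divr_ge0// sqr_ge0.
- by case: hm => + _; apply.
- case: hm => _ h; apply: le_trans (h _ _ _ hhx hhy) _.
  by rewrite ler_pM2r ?majorant_gt0// lerB.
- case: hu => _ h _; apply: le_trans (h _ _ _ hhx hhy) _.
  by rewrite ler_pM2r ?majorant_gt0.
- case: hu => _ h _; apply: le_trans (h _ _ _ hhy hhx) _.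
  by rewrite ler_pM2r ?majorant_gt0// DDC.
Qed.

Lemma digit_sqr_small : 40 / M%:R ^+ 2 <= 1 :> R.
Proof.
have hhM := hM.
rewrite ler_pdivrMr ?exprn_gt0 ?ltr0n// mul1r expr2.
by apply: (@le_trans _ _ M%:R); [lra|rewrite ler_peMr; lra].
Qed.

Lemma branch_dir_dist j x y v : (M <= j)%N -> 0 <= x <= 1 -> 0 <= y <= 1 ->
  normc (branch_dir j x v - branch_dir j y v) <= 4 * `|t| * DD x y + 2 * (expR (`|t| * DD x y) - 1).
Proof.
move=> Mj hx hy; have j1 : (1 <= j)%N by apply: leq_trans Mj.
rewrite /branch_dir.
have -> : cis (branch_phase j x v) * branch_ratio j x v - cis (branch_phase j y v) * branch_ratio j y v =
  (cis (branch_phase j x v) - cis (branch_phase j y v)) * branch_ratio j x v + cis (branch_phase j y v) * (branch_ratio j x v - branch_ratio j y v) by ring.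
have D0 := DD_ge0 x y.
apply: le_trans (ler_normcD _ _) _; rewrite !Normc.normcM normc_cis mul1r; apply: lerD.
  apply: (@le_trans _ _ (normc (cis (branch_phase j x v) - cis (branch_phase j y v)))).
    rewrite ler_piMr ?normc_ge0//; have := branch_ratio_le1 v j1 hx; rewrite /branch_ratio Normc.normcM; exact.
  apply: le_trans (cis_lip _ _) _.
  have -> : branch_phase j x v - branch_phase j y v = 2 * t * (ln (j%:R + y) - ln (j%:R + x)) by rewrite /branch_phase; ring.
  rewrite !normrM (ger0_norm (ler0n _ 2)).
  have j1R : 1 <= j%:R :> R by rewrite (ler_nat R 1).
  move: hx hy => /andP[x0 _] /andP[y0 _].
  have := ln_shift j1R y0 x0; rewrite (DDC y) => h.
  have : `|t| * `|ln (j%:R + y) - ln (j%:R + x)| <= `|t| * DD x y by rewrite ler_wpM2l.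
  lra.
apply: le_trans (branch_ratio_dist v Mj hx hy) _.
rewrite ler_pM2l// lerB// ler_expR.
(* The factor 1 / M^2 brings the exponent 20 |t| |x - y| down to |t| D, since |x - y| <= 2 D and 40
   <= M^2. *)
have -> : 20 * `|t| * (`|x - y| / M%:R ^+ 2) = `|t| * (`|x - y| * (20 / M%:R ^+ 2)) by ring.
rewrite ler_wpM2l//.
have := DD_ge hx hy.
move=> h; apply: (@le_trans _ _ (2 * DD x y * (20 / M%:R ^+ 2))); first by rewrite ler_wpM2r.
have -> : 2 * DD x y * (20 / M%:R ^+ 2) = DD x y * (40 / M%:R ^+ 2) by ring.
by rewrite ler_piMr//; exact: digit_sqr_small.
Qed.

(** With q = |t| D, the gain moves by at most q + (e^q - 1) / 2, and 1 - gain >= 3 / 4 turns this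
    additive error into the factor e^{3 q}. *)
Lemma gain_loglip x y v : 0 <= x <= 1 -> 0 <= y <= 1 ->
  1 - gain x v <= expR (3 * `|t| * DD x y) * (1 - gain y v).
Proof.
move=> hx hy; have D0 := DD_ge0 x y.
have h1 := branch_dir_dist v (leqnn M) hx hy; have h2 := branch_dir_dist v (leq_addr M M) hx hy.
have g := gain_bound v hy.
have h3 : normc (branch_dir M x v + branch_dir (M + M) x v) <= normc (branch_dir M y v + branch_dir (M + M) y v)
   + (normc (branch_dir M x v - branch_dir M y v) + normc (branch_dir (M + M) x v - branch_dir (M + M) y v)).
  rewrite [leRHS]addrC -lerBlDr; apply: le_trans (ler_norm _) _.
  apply: le_trans (ler_dist_normc _ _) _.
  have -> : branch_dir M x v + branch_dir (M + M) x v - (branch_dir M y v + branch_dir (M + M) y v) =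
    (branch_dir M x v - branch_dir M y v) + (branch_dir (M + M) x v - branch_dir (M + M) y v) by ring.
  exact: ler_normcD.
set q := `|t| * DD x y in h1 h2 *.
have q0 : 0 <= q by rewrite mulr_ge0.
have -> : 3 * `|t| * DD x y = q + 2 * q by rewrite /q; ring.
have h1' : normc (branch_dir M x v - branch_dir M y v) <= 4 * q + 2 * (expR q - 1) by rewrite /q mulrA.
have h2' : normc (branch_dir (M + M) x v - branch_dir (M + M) y v) <= 4 * q + 2 * (expR q - 1) by rewrite /q mulrA.
have e1 := expR_ge1 q0; have e2 := expR_ge1Dx (2 * q).
have key : 1 - gain x v <= (1 - gain y v) + (q + (expR q - 1) / 2) by rewrite /gain in g *; lra.
rewrite expRD; apply: le_trans key _.
have k2 : expR q + 2 * q <= expR q * expR (2 * q) by nra.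
have : (1 - gain y v) * (expR q + 2 * q) <= expR q * expR (2 * q) * (1 - gain y v).
  by rewrite mulrC ler_wpM2r//; lra.
nra.
Qed.

Lemma sum_split_digits (A : nmodType) (f : nat -> A) n : (M + M < n)%N ->
  \sum_(1 <= m < n) f m = f M + f (M + M)%N + \sum_(1 <= m < n | (m != M) && (m != M + M)%N) f m.
Proof.
move=> hn; have neq : (M + M)%N != M by rewrite -[X in _ != X]addn0 eqn_add2l -lt0n.
rewrite (bigD1_seq M) ?mem_index_iota ?iota_uniq ?digit_ge1//=; last first.
  by apply: leq_trans hn; rewrite ltnS leq_addr.
rewrite -addrA; congr (_ + _).
rewrite (big_rem (M + M)%N) ?mem_index_iota ?double_digit_ge1//= neq; congr (_ + _).
rewrite [RHS](big_rem (M + M)%N) ?mem_index_iota ?double_digit_ge1//= eqxx andbF add0r.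
rewrite big_seq_cond [RHS]big_seq_cond; apply: eq_bigl => i.
rewrite rem_filter ?iota_uniq// mem_filter /=.
by case: (i == (M + M)%N); rewrite ?andbF ?andbT//= ?andbF.
Qed.

Definition min_weight x v := Num.min (branch_weight M x v) (branch_weight (M + M) x v).

Lemma min_weight_gt0 x v : 0 <= x <= 1 -> 0 < min_weight x v.
Proof. by move=> hx; rewrite lt_min !branch_weight_gt0. Qed.

Lemma min_weight_le x v : 0 <= x <= 1 -> min_weight x v <= Lr act s X u x v.
Proof.
move=> hx; apply: (@le_trans _ _ (branch_weight M x v)); first by rewrite ge_min lexx.
have h := @Lr_term_le R V act s X _ u x v M ok hu hx digit_ge1; exact: h.
Qed.

Lemma dolgopyat_le x v : 0 <= x <= 1 -> dolgopyat x v <= Lr act s X u x v.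
Proof.
move=> hx; rewrite /dolgopyat gerBl mulr_ge0//; last exact: ltW (min_weight_gt0 v hx).
by have /andP[] := gain_bound v hx.
Qed.

Lemma dolgopyat_ge x v : 0 <= x <= 1 -> 3 / 4 * Lr act s X u x v <= dolgopyat x v.
Proof.
move=> hx; have /andP[g0 g1] := gain_bound v hx.
have m0 := min_weight_gt0 v hx; have m1 := min_weight_le v hx.
have : gain x v * min_weight x v <= 1 / 4 * Lr act s X u x v by apply: ler_pM => //; exact: ltW.
by rewrite /dolgopyat -/(min_weight x v); lra.
Qed.

Lemma branch_weight_loglip j x y v : (1 <= j)%N -> 0 <= x <= 1 -> 0 <= y <= 1 ->
  branch_weight j x v <= expR (11 * `|t| * DD x y) * branch_weight j y v.
Proof.
have ht4 := t4.
move=> j1 hx hy; apply: le_trans (wtu_loglip act v ok lip_ge0 hu j1 hx hy) _.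
rewrite ler_pM2r ?branch_weight_gt0// ler_expR ler_wpM2r ?DD_ge0//; lra.
Qed.

Lemma dolgopyat_loglip : loglip (20 * `|t|) dolgopyat.
Proof.
have ht4 := t4.
have [l0 l1 [L l2]] := Lr_loglip act ok lip_ge0 hu.
split.
- by move=> x v hx; apply: lt_le_trans (dolgopyat_ge v hx); rewrite mulr_gt0 ?l0//; lra.
- move=> x y v hx hy; have D0 := DD_ge0 x y.
  have [C hC] := loglip_dom act ok hu.
  set E := expR _.
  (* The subtracted minima are collected on one side so that the inequality can be checked on
     partial sums; those beyond 2M contain both distinguished digits. *)
  suff : 1 * Lr act s X u x v + (E * (gain y v * min_weight y v) - gain x v * min_weight x v) <= E * Lr act s X u y v.
    by rewrite /dolgopyat -/(min_weight _ _) -/(min_weight _ _); lra.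
  rewrite -(rsumZ _ (hC y v hy)).
  apply: (rsum_psum_le (N := (M + M).+1) (hC x v hx) (dominatedZ _ (hC y v hy))) => n hn.
  rewrite mul1r psumZ.
  pose Sz z := \sum_(1 <= m < n | (m != M) && (m != M + M)%N) branch_weight m z v.
  have eS z : psum (fun m => wt act s X m z v * u (hb m z) (act m v)) n =
    branch_weight M z v + branch_weight (M + M) z v + Sz z := sum_split_digits (fun m => branch_weight m z v) hn.
  rewrite !eS.
  have S12 : Sz x <= E * Sz y.
    rewrite /Sz mulr_sumr big_nat_cond [X in _ <= X]big_nat_cond.
    apply: ler_sum => i /andP[/andP[i1 _] _]; apply: le_trans (branch_weight_loglip v i1 hx hy) _.
    by rewrite ler_pM2r ?branch_weight_gt0// ler_expR ler_wpM2r//; lra.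
  have /andP[gx gx'] := gain_bound v hx; have /andP[gy gy'] := gain_bound v hy.
  (* The weights use 11 |t| and the gain 3 |t| of the available 20 |t|. *)
  have := @min_gain_le _ (branch_weight M x v) (branch_weight (M + M) x v) (branch_weight M y v) (branch_weight (M + M) y v)
    (gain x v) (gain y v) E (expR (11 * `|t| * DD x y)) (expR (3 * `|t| * DD x y))
    (ltW (branch_weight_gt0 v digit_ge1 hy)) (ltW (branch_weight_gt0 v double_digit_ge1 hy)) (ltW (branch_weight_gt0 v digit_ge1 hx)) (ltW (branch_weight_gt0 v double_digit_ge1 hx))
    (expR_ge0 _).
  rewrite -/(min_weight x v) -/(min_weight y v) => H.
  have : branch_weight M x v + branch_weight (M + M) x v - gain x v * min_weight x v <=
       E * (branch_weight M y v + branch_weight (M + M) y v - gain y v * min_weight y v).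
    apply: H.
    - by apply: expR_ge1; rewrite !mulr_ge0.
    - by rewrite -expRD ler_expR -mulrDl ler_wpM2r//; lra.
    - exact: branch_weight_loglip.
    - exact: branch_weight_loglip.
    - lra.
    - lra.
    - exact: gain_loglip.
  move=> {H}; set p := branch_weight M x v; set p' := branch_weight (M + M) x v; set q := branch_weight M y v; set q' := branch_weight (M + M) y v.
  set a := gain x v * _; set a' := gain y v * _; set S1 := Sz x in S12 *; set S2 := Sz y in S12 *.
  by move=> H; nra.
- by exists L => x v hx; apply: le_trans (dolgopyat_le v hx) (l2 _ _ hx).
Qed.

Lemma Lc_le_dolgopyat x v : 0 <= x <= 1 -> normc (Lc act s X t Y psi x v) <= dolgopyat x v.
Proof.
move=> hx; have [C hC] := loglip_dom act ok hu; have [U hU] := maj_bounded hu hm.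
rewrite /dolgopyat -/(min_weight x v) -[Lr _ _ _ _ _ _]mul1r.
apply: (normc_csum_le (N := (M + M).+1) (cwtM_dom act t Y v ok hx hU) (hC x v hx)) => n hn.
rewrite mul1r /cpsum /psum !sum_split_digits// -!/(branch_weight _ _ _).
set S := \sum_(_ <= _ < _ | _) _; set T := \sum_(_ <= _ < _ | _) _.
have ST : normc S <= T.
  rewrite /S /T big_nat_cond [X in _ <= X]big_nat_cond.
  elim/big_rec2: _ => [|i a b /andP[/andP[i1 _] _] h].
    by rewrite -[0]/((0 : R)%:C) normcR normr0.
  apply: le_trans (ler_normcD _ _) _; apply: lerD => //.
  rewrite Normc.normcM cwt_norm ler_pM2l ?wt_gt0//.
  by case: hm => + _; apply; exact: hb01.
apply: le_trans (ler_normcD _ _) _.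
rewrite !branch_termE//.
have := gain_two (ltW (branch_weight_gt0 v digit_ge1 hx)) (ltW (branch_weight_gt0 v double_digit_ge1 hx)) (branch_dir_le1 v digit_ge1 hx) (branch_dir_le1 v double_digit_ge1 hx).
have -> : 2 - normc (branch_dir M x v + branch_dir (M + M) x v) = 8 * gain x v by rewrite /gain; field.
rewrite -/(min_weight x v).
have gx := gain_bound v hx; have m0 := min_weight_gt0 v hx.
have : 0 <= min_weight x v * gain x v by apply: mulr_ge0; [exact: ltW|lra].
lra.
Qed.

(** This is where 20 comes from. Lowering the majorant to no less than 3 / 4 costs a factor 4 / 3,
    which the exponent absorbs: 4 / 3 (3 + 4 |t| + 10 |t|) <= 20 |t| for |t| >= 4. *)
Lemma dolgopyat_majorized : majorized (20 * `|t|) (Lc act s X t Y psi) dolgopyat.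
Proof.
have ht4 := t4.
split=> [x v hx|x y v hx hy]; first exact: Lc_le_dolgopyat.
apply: le_trans (Lc_dist act t Y v ok lip_ge0 hu hm hx hy) _.
have D0 := DD_ge0 x y.
have [l0 _ _] := Lr_loglip act ok lip_ge0 hu.
set a := (3 + _ + _) * DD x y.
have a0 : 0 <= a by rewrite mulr_ge0//; lra.
have h : (4 / 3) * (expR a - 1) <= expR (20 * `|t| * DD x y) - 1.
  apply: le_trans (expR_sub1_scale _ a0) _; first lra.
  rewrite lerB// ler_expR /a mulrA ler_wpM2r//; lra.
have e1 := expR_ge1 a0.
apply: (@le_trans _ _ (4 / 3 * (expR a - 1) * (3 / 4 * Lr act s X u y v))); first lra.
apply: ler_pM => //; [by rewrite mulr_ge0; lra|by rewrite mulr_ge0 ?ltW ?l0; lra|exact: dolgopyat_ge].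
Qed.

(** If both gains were small, the two branches would be nearly aligned at both points. This
    contradicts [uni_gap] with k = 1 / M, since by [phase_gap] the relative phase turns by between k
    / 6 and k. *)
Lemma gain_pair x y v : 0 <= x -> y = x + `|t|^-1 -> y <= 1 ->
  (M%:R^-1 / 200) ^+ 2 / 8 <= gain x v + gain y v.
Proof.
have hhM := hM; have ht4 := t4.
move=> x0 yE y1; have t0 : 0 < `|t|^-1 by rewrite invr_gt0; lra.
have hx : 0 <= x <= 1 by lra.
have hy : 0 <= y <= 1 by lra.
have /andP[gx _] := gain_bound v hx; have /andP[gy _] := gain_bound v hy.
have m1 : 1 <= M%:R :> R by rewrite (ler_nat R 1).
set k := M%:R^-1 : R.
have k0 : 0 < k by rewrite invr_gt0; lra.
have k1 : k <= 1 by rewrite invf_le1; lra.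
rewrite leNgt; apply/negP => h.
have hgx : gain x v < (k / 200) ^+ 2 / 8 by lra.
have hgy : gain y v < (k / 200) ^+ 2 / 8 by lra.
have aad j : (M <= j)%N -> normc (branch_ratio j y v - branch_ratio j x v) <= k / 100.
  move=> Mj; apply: le_trans (branch_ratio_dist v Mj hy hx) _.
  have -> : 20 * `|t| * (`|y - x| / M%:R ^+ 2) = 20 * k ^+ 2.
    have -> : `|y - x| = `|t|^-1 by rewrite yE addrC addKr; apply: ger0_norm; exact: ltW.
    by rewrite /k exprVn; field; lra.
  (* The ratios vary by at most 2 (e^{20 k^2} - 1) <= 80 k^2, which is below k / 100 once M >= 80 *
     100. *)
  have kk : 80 * 100 * k <= 1 by rewrite /k ler_pdivrMr; lra.
  have k2 : k ^+ 2 <= k / (80 * 100) by rewrite expr2 ler_pM2l//; lra.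
  have k20 := sqr_ge0 k.
  have := @expR_small R (20 * k ^+ 2); rewrite mulr_ge0//= => /(_ ltac:(lra)).
  lra.
have xy : x <= y by lra.
have gap := phase_gap m1 x0 xy y1.
have yx : y - x = `|t|^-1 by lra.
rewrite yx in gap.
set L := (_ - _) - (_ - _) in gap.
have dE : (branch_phase M y v - branch_phase M x v) - (branch_phase (M + M) y v - branch_phase (M + M) x v) = - (2 * t) * L.
  by rewrite /branch_phase /L natrD; ring.
have k6 : k / 6 <= `|(branch_phase M y v - branch_phase M x v) - (branch_phase (M + M) y v - branch_phase (M + M) x v)| <= k.
  have tL : `|t|^-1 * k / 12 <= L <= `|t|^-1 * k / 2.
    have -> : `|t|^-1 * k / 12 = `|t|^-1 / (12 * M%:R) by rewrite /k; field; lra.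
    by have -> : `|t|^-1 * k / 2 = `|t|^-1 / (2 * M%:R) by rewrite /k; field; lra.
  move: tL => /andP[L1 L2].
  have L0 : 0 <= L by apply: le_trans L1; rewrite !mulr_ge0 ?ltW//; lra.
  rewrite dE normrM normrN normrM (ger0_norm (ler0n _ 2)) (ger0_norm L0).
  have tt : 0 < `|t| by lra.
  have : `|t| * (`|t|^-1 * k / 12) <= `|t| * L by rewrite ler_pM2l.
  have : `|t| * L <= `|t| * (`|t|^-1 * k / 2) by rewrite ler_pM2l.
  have -> : `|t| * (`|t|^-1 * k / 2) = k / 2 by field; lra.
  have -> : `|t| * (`|t|^-1 * k / 12) = k / 12 by field; lra.
  by move=> ? ?; apply/andP; split; lra.
move: k6 => /andP[k6 k6'].
apply: (@uni_gap _ k (branch_phase M x v) (branch_phase (M + M) x v) (branch_phase M y v) (branch_phase (M + M) y v)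
   (branch_ratio M x v) (branch_ratio (M + M) x v) (branch_ratio M y v) (branch_ratio (M + M) y v)).
- by rewrite k0.
- lra.
- have kk : 80 * 100 * k <= 1 by rewrite /k ler_pdivrMr; lra.
  by lra.
- exact: branch_ratio_le1.
- exact: branch_ratio_le1.
- exact: branch_ratio_le1.
- exact: branch_ratio_le1.
- exact: aad.
- by apply: aad; exact: leq_addr.
- by rewrite -!/(branch_dir _ _ _); rewrite /gain in hgx; lra.
- by rewrite -!/(branch_dir _ _ _); rewrite /gain in hgy; lra.
Qed.

(* The Cauchy-Schwarz weight for which the sum of cs_weight * u^2 is the operator
   with parameter 1, the Gauss transfer operator, applied to (1 + x) u^2. *)
Definition cs_weight m x v : R := wt act 1 (fun=> 0) m x v * (1 + hb m x).

(** A lower bound for wt^2 / cs_weight at the digits up to 2M, from X >= -1, 2 s <= 3, x <= 1 and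
    cs_weight <= 2. *)
Definition weight_floor : R := expR (- 1 - 3 * ln (M%:R + M%:R + 1)) ^+ 2 / 2.

Lemma cs_weight_gt0 m x v : (1 <= m)%N -> 0 <= x <= 1 -> 0 < cs_weight m x v.
Proof.
by move=> m1 hx; have /andP[h _] := hb01 m1 hx; rewrite mulr_gt0 ?wt_gt0//; lra.
Qed.

Lemma cs_weight_le2 m x v : (1 <= m)%N -> 0 <= x <= 1 -> cs_weight m x v <= 2.
Proof.
move=> m1 /andP[x0 x1]; have m1R : 1 <= m%:R :> R by rewrite (ler_nat R 1).
rewrite -[2]mul1r; apply: ler_pM.
- exact: ltW (wt_gt0 _ _ _ _ _ _).
- by have := hb_ge0 m x0; lra.
- rewrite /wt -[leRHS]expR0 ler_expR.
  have : 0 <= ln (m%:R + x) by apply: ln_ge0; lra.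
  lra.
- have := @hb01 R m x m1; rewrite x0 x1 => /(_ isT) /andP[_]; lra.
Qed.

Lemma wt_ge j x v : (1 <= j)%N -> (j <= M + M)%N -> 0 <= x <= 1 ->
  expR (- 1 - 3 * ln (M%:R + M%:R + 1)) <= wt act s X j x v.
Proof.
move=> j1 jM /andP[x0 x1]; case: ok => /andP[s1 s2] hX; rewrite ler_expR.
have j1R : 1 <= j%:R :> R by rewrite (ler_nat R 1).
have jR : j%:R <= M%:R + M%:R :> R by rewrite -natrD ler_nat.
have l0 : 0 <= ln (j%:R + x) by apply: ln_ge0; lra.
have l1 : ln (j%:R + x) <= ln (M%:R + M%:R + 1) by rewrite ler_ln ?posrE; lra.
have := hX (act j v); rewrite ler_norml => /andP[h _]; nra.
Qed.

Lemma weight_floor_gt0 : 0 < weight_floor. Proof. by rewrite divr_gt0// exprn_gt0// expR_gt0. Qed.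

(** The quotient is of the order of (m + x)^{-(4 s - 2)}; 36 is 3^2, from e^{2 X}, times the 4 of
    [inv_pow32_le]. *)
Lemma wt_sqr_dom x v : 0 <= x <= 1 ->
  dominated 36 (fun m => wt act s X m x v ^+ 2 / cs_weight m x v).
Proof.
move=> hx m m1; have m1R : 1 <= m%:R :> R by rewrite (ler_nat R 1).
have q0 := cs_weight_gt0 v m1 hx.
rewrite ger0_norm; last by rewrite divr_ge0 ?sqr_ge0 ?ltW.
case: ok => /andP[s1 s2] hX; move: hx => /andP[x0 x1].
have h := @inv_pow32_le R m%:R (4 * s - 2) m1R ltac:(lra).
apply: (@le_trans _ _ (wt act s X m x v ^+ 2 / wt act 1 (fun=> 0) m x v)).
  rewrite ler_wpM2l ?sqr_ge0// lef_pV2 ?posrE ?wt_gt0// /cs_weight ler_peMr//; first exact: ltW (wt_gt0 _ _ _ _ _ _).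
  by have := hb_ge0 m x0; lra.
have -> : wt act s X m x v ^+ 2 / wt act 1 (fun=> 0) m x v =
  expR (X (act m v)) ^+ 2 * expR (- ((4 * s - 2) * ln (m%:R + x))).
  rewrite /wt -!expRM_natl -expRN -!expRD; congr expR; ring.
have -> : 36 * kap R m = 3 ^+ 2 * (4 * ((Num.sqrt m%:R)^-1 - (Num.sqrt (m%:R + 1))^-1)).
  by rewrite /kap -(@natr1 _ m); ring.
apply: ler_pM; rewrite ?sqr_ge0 ?expR_ge0//.
  apply: lerXn2r; rewrite ?nnegrE ?expR_ge0//.
  apply: le_trans (expR1_le3 R); rewrite ler_expR.
  exact: le_trans (ler_norm _) (hX _).
apply: le_trans h; rewrite ler_expR lerN2 ler_wpM2l//; first lra.
by rewrite ler_ln ?posrE; lra.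
Qed.

Definition min_digit x v := if branch_weight M x v <= branch_weight (M + M) x v then M else (M + M)%N.

Lemma min_digit_ge1 x v : (1 <= min_digit x v)%N. Proof. by rewrite /min_digit; case: ifP. Qed.
Lemma min_digit_le x v : (min_digit x v <= M + M)%N.
Proof. by rewrite /min_digit; case: ifP => //; rewrite leq_addr. Qed.

Lemma min_weightE x v : min_weight x v = branch_weight (min_digit x v) x v.
Proof. by rewrite /min_weight /min_digit minEle; case: ifP. Qed.

Lemma psum_upd (f : nat -> R) j (d : R) n : (1 <= j)%N -> (j < n)%N ->
  psum (fun m => if m == j then f m - d else f m) n = psum f n - d.
Proof.
move=> j1 jn; rewrite /psum (bigD1_seq j) ?mem_index_iota ?iota_uniq ?j1//= eqxx.
rewrite [in RHS](bigD1_seq j) ?mem_index_iota ?iota_uniq ?j1//= addrAC; congr (_ + _ - _).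
by apply: eq_bigr => i /negbTE ->.
Qed.

Lemma sqr_loglip b w : loglip b w -> loglip (1 + 2 * b) (fun x v => (1 + x) * w x v ^+ 2).
Proof.
move=> [w0 w1 [U w2]]; split.
- by move=> x v hx; rewrite mulr_gt0 ?exprn_gt0 ?w0//; lra.
- move=> x y v hx hy.
  have -> : (1 + 2 * b) * DD x y = DD x y + 2%:R * (b * DD x y) by ring.
  rewrite expRD expRM_natl mulrACA -exprMn; apply: ler_pM; rewrite ?sqr_ge0//; first lra.
    move: hx hy => /andP[x0 x1] /andP[y0 y1].
    rewrite -{1}[1 + x]lnK ?posrE; last lra.
    rewrite -{1}[1 + y]lnK ?posrE; last lra.
    rewrite -expRD ler_expR; have := ler_norm (ln (1 + x) - ln (1 + y)); rewrite -/(DD x y); lra.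
  by apply: lerXn2r; rewrite ?nnegrE ?mulr_ge0 ?expR_ge0//; [exact: ltW (w0 _ _ hx)|exact: ltW (w0 _ _ hy)|exact: w1].
- exists (2 * U ^+ 2) => x v hx; apply: ler_pM; rewrite ?sqr_ge0//; [lra|lra|].
  have h := w2 _ v hx; have h0 := w0 _ v hx.
  by apply: lerXn2r; rewrite ?nnegrE//; lra.
Qed.

Lemma near10_one : near10 (1 : R) (fun=> 0 : R) (V := V).
Proof. by split; [lra|move=> v; rewrite normr0]. Qed.

Lemma Lr_gauss_sqr_ge0 b w x v : loglip b w -> 0 <= x <= 1 ->
  0 <= Lr act 1 (fun=> 0) (fun x v => (1 + x) * w x v ^+ 2) x v.
Proof.
move=> hw hx; have [C hC] := loglip_dom act near10_one (sqr_loglip hw).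
apply: rsum_ge0 (hC x v hx) _ => m m1; rewrite mulr_ge0//; first exact: ltW (wt_gt0 _ _ _ _ _ _).
by rewrite mulr_ge0 ?sqr_ge0//; have := hb01 m1 hx; lra.
Qed.

Lemma psum_weighted_sqr b w (a : nat -> R) x v n : loglip b w -> 0 <= x <= 1 ->
  psum (fun m => a m * w (hb m x) (act m v)) n ^+ 2 <=
  psum (fun m => a m ^+ 2 / cs_weight m x v) n *
  Lr act 1 (fun=> 0) (fun x v => (1 + x) * w x v ^+ 2) x v.
Proof.
move=> hw hx; have [C hC] := loglip_dom act near10_one (sqr_loglip hw).
have qp m : (1 <= m)%N -> 0 < cs_weight m x v by move=> m1; exact: cs_weight_gt0.
apply: le_trans (@cauchy_schwarz_sum _ _ _ (cs_weight ^~ x ^~ v) n qp) _.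
apply: ler_wpM2l.
  by rewrite /psum big_nat; apply: sumr_ge0 => i /andP[i1 _]; rewrite divr_ge0 ?sqr_ge0// ltW// qp.
have -> : (fun m => cs_weight m x v * w (hb m x) (act m v) ^+ 2) =
  (fun m => wt act 1 (fun=> 0) m x v * ((1 + hb m x) * w (hb m x) (act m v) ^+ 2)).
  by apply/funext => m; rewrite /cs_weight mulrA.
apply: (psum_le_rsum _ (hC x v hx)) => m m1; have hh := hb01 m1 hx.
rewrite mulr_ge0//; first exact: ltW (wt_gt0 _ _ _ _ _ _).
by rewrite mulr_ge0 ?sqr_ge0//; lra.
Qed.

(** The lowering is read as a coefficient 1 - g on the one digit of smaller weight. The first factor
    of Cauchy-Schwarz then drops by (1 - (1 - g)^2) wt^2 / cs_weight at that digit, and 1 - (1 -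
    g)^2 >= g. *)
Lemma dolgopyat_sqr (A : R) x v :
  (forall y w, 0 <= y <= 1 -> (1 + y) * rsum (fun m => wt act s X m y w ^+ 2 / cs_weight m y w) <= A) ->
  0 <= x <= 1 ->
  (1 + x) * dolgopyat x v ^+ 2 <=
    (A - weight_floor * gain x v) * Lr act 1 (fun=> 0) (fun x v => (1 + x) * u x v ^+ 2) x v.
Proof.
move=> HA hx; have [C hC] := loglip_dom act ok hu.
set j := min_digit x v; have j1 : (1 <= j)%N := min_digit_ge1 x v; have jM : (j <= M + M)%N := min_digit_le x v.
have gx := gain_bound v hx; set g := gain x v in gx *.
pose be m : R := if m == j then 1 - g else 1.
pose P := rsum (fun m => wt act s X m x v ^+ 2 / cs_weight m x v) - (1 - (1 - g) ^+ 2) * (wt act s X j x v ^+ 2 / cs_weight j x v).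
pose Q := Lr act 1 (fun=> 0) (fun x v => (1 + x) * u x v ^+ 2) x v.
have Q0 : 0 <= Q by exact: Lr_gauss_sqr_ge0 hu hx.
have key : dolgopyat x v ^+ 2 <= P * Q.
  have cv : psum (branch_weight^~ x ^~ v) n - g * min_weight x v @[n --> \oo] --> dolgopyat x v.
    by apply: cvgB; [exact: cvg_psum (hC x v hx)|exact: cvg_cst].
  have cv2 : (psum (branch_weight^~ x ^~ v) n - g * min_weight x v) ^+ 2 @[n --> \oo] --> dolgopyat x v ^+ 2.
    by rewrite expr2; under eq_fun do rewrite expr2; exact: cvgM.
  apply: (cvgr_to_le cv2); exists (M + M).+1 => // n /= hn.
  have jn : (j < n)%N by apply: leq_ltn_trans hn.
  have -> : psum (branch_weight^~ x ^~ v) n - g * min_weight x v =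
    psum (fun m => (wt act s X m x v * be m) * u (hb m x) (act m v)) n.
    rewrite min_weightE -(@psum_upd _ j)//; congr psum; apply/funext => m; rewrite /be /branch_weight.
    by case: eqP => [->|_]; rewrite ?mulr1//; ring.
  apply: le_trans (psum_weighted_sqr _ _ _ hu hx) _; apply: ler_wpM2r => //.
  have -> : (fun m => (wt act s X m x v * be m) ^+ 2 / cs_weight m x v) =
    (fun m => if m == j then wt act s X m x v ^+ 2 / cs_weight m x v - (1 - (1 - g) ^+ 2) * (wt act s X j x v ^+ 2 / cs_weight j x v)
               else wt act s X m x v ^+ 2 / cs_weight m x v).
    by apply/funext => m; rewrite /be; case: eqP => [->|_]; rewrite ?mulr1//; ring.
  rewrite psum_upd// /P lerB//.
  apply: (psum_le_rsum _ (wt_sqr_dom v hx)) => m m1; rewrite divr_ge0 ?sqr_ge0//.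
  by rewrite ltW// cs_weight_gt0.
have hP : (1 + x) * P <= A - weight_floor * g.
  rewrite /P mulrBr; apply: lerB; first exact: HA.
  have W : weight_floor <= wt act s X j x v ^+ 2 / cs_weight j x v.
    apply: ler_pM; rewrite ?sqr_ge0 ?invr_ge0//.
      apply: lerXn2r; [by rewrite nnegrE expR_ge0|by rewrite nnegrE; exact: ltW (wt_gt0 _ _ _ _ _ _)|].
      exact: wt_ge.
    by rewrite lef_pV2 ?posrE ?cs_weight_gt0// cs_weight_le2.
  set z := _ / _ in W *.
  have c00 := weight_floor_gt0.
  have gg : g <= 1 - (1 - g) ^+ 2 by nra.
  have : weight_floor * g <= z * (1 - (1 - g) ^+ 2) by apply: ler_pM => //; lra.
  have : 0 <= z * (1 - (1 - g) ^+ 2) by rewrite mulr_ge0; lra.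
  nra.
apply: (@le_trans _ _ ((1 + x) * (P * Q))); first by rewrite ler_wpM2l//; lra.
by rewrite mulrA ler_wpM2r.
Qed.

End Dolgopyat.

(** * Averages over the unit interval *)

Section Primitive.
Variable R : realType.
Implicit Types (f g F G : R -> R) (x y a b c : R).

Definition clamp01 x : R := Num.max 0 (Num.min x 1).

Lemma clamp01_id x : 0 <= x <= 1 -> clamp01 x = x.
Proof. by move=> /andP[x0 x1]; rewrite /clamp01 (min_idPl x1) (max_idPr x0). Qed.

Lemma clamp01_in x : 0 <= clamp01 x <= 1.
Proof.
rewrite /clamp01 le_max lexx/= ge_max ler01/=.
by rewrite ge_min lexx orbT.
Qed.

Lemma clamp01_lip x y : `|clamp01 x - clamp01 y| <= `|x - y|.
Proof.
have cE a : (a <= 0 /\ clamp01 a = 0) \/ (0 <= a <= 1 /\ clamp01 a = a) \/ (1 <= a /\ clamp01 a = 1).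
  have [a0|a0] := leP a 0.
    by left; split=> //; rewrite /clamp01 max_l// ge_min a0.
  have [a1|a1] := leP a 1; right; [left|right]; split; rewrite ?ltW//.
    by apply: clamp01_id; rewrite ltW.
  by rewrite /clamp01 (min_idPr (ltW a1)) (max_idPr ler01).
have := ler_norm (x - y); have := ler_norm (y - x); rewrite distrC ler_norml.
by case: (cE x) => [[? ->]|[[? ->]|[? ->]]]; case: (cE y) => [[? ->]|[[? ->]|[? ->]]]; lra.
Qed.

Definition lip01 f := exists C, forall x y, 0 <= x <= 1 -> 0 <= y <= 1 ->
  `|f x - f y| <= C * `|x - y|.

(* Integrating f \o clamp01 from -1 makes prim f differentiable on both sides at 0 and 1. *)
Definition prim f x : R := (\int[lebesgue_measure]_(t in `[(- 1)%R, x]) f (clamp01 t))%R.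
Definition I01 f : R := prim f 1 - prim f 0.

Lemma lip01_continuous f : lip01 f -> continuous (f \o clamp01).
Proof.
move=> [C hC] x; apply/cvgrPdist_lt => e e0.
near=> y.
have xy : `|x - y| < e / (`|C| + 1).
  by near: y; apply: cvgr_dist_lt; [exact: cvg_id|rewrite divr_gt0].
apply: le_lt_trans (hC _ _ (clamp01_in x) (clamp01_in y)) _.
apply: (@le_lt_trans _ _ ((`|C| + 1) * `|x - y|)); last by rewrite mulrC -ltr_pdivlMr.
apply: ler_pM => //.
    have h1 : 0 <= (1 : R) <= 1 by lra.
    have h0 : 0 <= (0 : R) <= 1 by lra.
    by have := hC 1 0 h1 h0; rewrite subr0 normr1 mulr1; apply: le_trans; exact: normr_ge0.
  by rewrite (le_trans (ler_norm C))// lerDl.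
exact: clamp01_lip.
Unshelve. all: by end_near. Qed.

Lemma prim_is_derive f x : lip01 f -> 0 <= x <= 1 -> is_derive x 1 (prim f) (f x).
Proof.
move=> lf hx; have cf := lip01_continuous lf.
have intf : lebesgue_measure.-integrable `[(- 1)%R, (2 : R)] (EFin \o (f \o clamp01)).
  apply: continuous_compact_integrable; first exact: segment_compact.
  exact: continuous_subspaceT.
have [d1 d2] := @continuous_FTC1_closed R (f \o clamp01) (- 1) x 2 ltac:(lra) intf ltac:(lra) (cf x).
apply: DeriveDef; first exact: d1.
by rewrite -derive1E; move: d2; rewrite /= (clamp01_id hx).
Qed.

(** Every comparison of integrals below is this monotonicity, applied to a combination of
    primitives. *)
Lemma is_derive_mono G g a b : a <= b -> (forall x, a <= x <= b -> is_derive x 1 G (g x)) ->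
  (forall x, a <= x <= b -> 0 <= g x) -> G a <= G b.
Proof.
move=> ab dG g0.
have [||c cab] := @MVT_segment R G g a b ab.
- by move=> x; rewrite in_itv/= => /andP[h1 h2]; apply: dG; rewrite !ltW.
- apply: derivable_within_continuous => x; rewrite in_itv/= => h.
  by have [] := dG x h.
- rewrite in_itv/= in cab => e.
  by rewrite -subr_ge0 e mulr_ge0 ?g0 ?subr_ge0.
Qed.

Lemma I01_lin_le f g h a b : lip01 f -> lip01 g -> lip01 h ->
  (forall x, 0 <= x <= 1 -> h x <= a * f x + b * g x) -> I01 h <= a * I01 f + b * I01 g.
Proof.
move=> lf lg lh H.
have := @is_derive_mono (fun x => a * prim f x + b * prim g x - prim h x)
  (fun x => a * f x + b * g x - h x) 0 1 ler01.
rewrite /I01 => K; suff : a * prim f 0 + b * prim g 0 - prim h 0 <= a * prim f 1 + b * prim g 1 - prim h 1 by lra.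
apply: K => x hx; last by rewrite subr_ge0 H.
have df := prim_is_derive lf hx; have dg := prim_is_derive lg hx; have dh := prim_is_derive lh hx.
by apply: is_deriveB; apply: is_deriveD; apply: is_deriveZ.
Qed.

Lemma I01_lin f g h a b : lip01 f -> lip01 g -> lip01 h ->
  (forall x, 0 <= x <= 1 -> h x = a * f x + b * g x) -> I01 h = a * I01 f + b * I01 g.
Proof.
move=> lf lg lh H; apply/eqP; rewrite eq_le; apply/andP; split.
  by apply: I01_lin_le => // x hx; rewrite H.
have := @is_derive_mono (fun x => prim h x - (a * prim f x + b * prim g x))
  (fun x => h x - (a * f x + b * g x)) 0 1 ler01.
rewrite /I01 => K; suff : prim h 0 - (a * prim f 0 + b * prim g 0) <= prim h 1 - (a * prim f 1 + b * prim g 1) by lra.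
apply: K => x hx; last by rewrite H// subrr.
have df := prim_is_derive lf hx; have dg := prim_is_derive lg hx; have dh := prim_is_derive lh hx.
by apply: is_deriveB; apply: is_deriveD; apply: is_deriveZ.
Qed.

Lemma lip01_cst c : lip01 (fun=> c).
Proof. by exists 0 => x y _ _; rewrite subrr normr0 mul0r. Qed.

Lemma is_derive_mul c x : is_derive x 1 (fun y : R => c * y) c.
Proof. by apply: is_derive_eq (is_deriveZ c (is_derive_id x (1 : R))) _; exact: mulr1. Qed.

Lemma I01_cst c : I01 (fun=> c) = c.
Proof.
have d := is_derive_mul c.
have P x : 0 <= x <= 1 -> is_derive x 1 (prim (fun=> c)) c by exact: prim_is_derive (lip01_cst c).
have h1 := @is_derive_mono (fun x => prim (fun=> c) x - c * x) (fun=> c - c) 0 1 ler01.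
have h2 := @is_derive_mono (fun x => c * x - prim (fun=> c) x) (fun=> c - c) 0 1 ler01.
rewrite !mulr1 !mulr0 in h1 h2.
have k1 := h1 (fun x hx => is_deriveB (P x hx) (d x)) (fun x _ => ltac:(by rewrite subrr)).
have k2 := h2 (fun x hx => is_deriveB (d x) (P x hx)) (fun x _ => ltac:(by rewrite subrr)).
by rewrite /I01; lra.
Qed.

Lemma lip01D f g : lip01 f -> lip01 g -> lip01 (fun x => f x + g x).
Proof.
move=> [C hC] [C' hC']; exists (C + C') => x y hx hy.
have -> : f x + g x - (f y + g y) = (f x - f y) + (g x - g y) by ring.
by apply: le_trans (ler_normD _ _) _; rewrite mulrDl lerD ?hC ?hC'.
Qed.

Lemma lip01_sum (T : Type) (s : seq T) (f : T -> R -> R) :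
  (forall v, lip01 (f v)) -> lip01 (fun x => \sum_(v <- s) f v x).
Proof.
move=> lf; elim: s => [|v s IH].
  rewrite (_ : (fun x => _) = fun=> 0); first exact: lip01_cst.
  by apply/funext => x; rewrite big_nil.
rewrite (_ : (fun x => _) = (fun x => f v x + \sum_(v <- s) f v x)); first exact: lip01D.
by apply/funext => x; rewrite big_cons.
Qed.

Lemma I01_sum (T : Type) (s : seq T) (f : T -> R -> R) :
  (forall v, lip01 (f v)) -> \sum_(v <- s) I01 (f v) = I01 (fun x => \sum_(v <- s) f v x).
Proof.
move=> lf; elim: s => [|v s IH].
  rewrite big_nil (_ : (fun x => _) = fun=> 0); first by rewrite I01_cst.
  by apply/funext => x; rewrite big_nil.
rewrite big_cons IH -[I01 (f v)]mul1r -[X in _ + X]mul1r; apply/esym.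
apply: I01_lin => //; [exact: lip01_sum|exact: lip01_sum|].
by move=> x hx; rewrite big_cons !mul1r.
Qed.

Lemma is_derive_shift f (k x : R) : lip01 f -> 0 <= x + k <= 1 ->
  is_derive x 1 (fun y => prim f (y + k)) (f (x + k)).
Proof.
move=> lf h; have d := prim_is_derive lf h.
have := @is_derive1_comp R (prim f) (fun y => y + k) x (f (x + k)) 1 d.
rewrite mulr1; apply.
have := is_deriveD (is_derive_id x (1 : R)) (is_derive_cst k x (1 : R)).
by rewrite addr0.
Qed.

(* The shift by tau costs a factor 2 on each half of [0, 1]. *)
Lemma I01_pair w z (A c tau : R) : lip01 w -> lip01 z -> 0 < tau <= 1 / 2 -> 0 <= c ->
  (forall x, 0 <= x <= 1 -> w x <= A * z x) ->
  (forall x, 0 <= x -> x + tau <= 1 ->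
     c * z x <= (A * z x - w x) + (A * z (x + tau) - w (x + tau)) /\
     c * z (x + tau) <= (A * z x - w x) + (A * z (x + tau) - w (x + tau))) ->
  I01 w <= (A - c / 4) * I01 z.
Proof.
move=> lw lz /andP[t0 t1] c0 H1 H2.
pose P x := A * prim z x - prim w x.
have dP k x : 0 <= x + k <= 1 -> is_derive x 1 (fun y => P (y + k)) (A * z (x + k) - w (x + k)).
  move=> h; have d1 := is_derive_shift lz h; have d2 := is_derive_shift lw h.
  by apply: is_deriveB; apply: is_deriveZ.
have dZ x : 0 <= x <= 1 -> is_derive x 1 (prim z) (z x) by exact: prim_is_derive.
have Pm a b : 0 <= a -> a <= b -> b <= 1 -> P a <= P b.
  move=> a0 ab b1; have := @is_derive_mono (fun y => P (y + 0)) (fun x => A * z (x + 0) - w (x + 0)) a b ab.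
  rewrite !addr0; apply => x hx; first by apply: dP; lra.
  by rewrite addr0 subr_ge0; apply: H1; lra.
have p1 : P 0 <= P (1 / 2) by apply: Pm; clear -t0 t1; lra.
have p2 : P (1 / 2) <= P 1 by apply: Pm; clear -t0 t1; lra.
have p3 : P 0 <= P tau by apply: Pm; clear -t0 t1; lra.
have p4 : P (1 / 2 + tau) <= P 1 by apply: Pm; clear -t0 t1; lra.
have p5 : P 0 <= P (1 / 2 - tau) by apply: Pm; clear -t0 t1; lra.
have p6 : P (1 - tau) <= P 1 by apply: Pm; clear -t0 t1; lra.
(* On the left half x is paired with x + tau, on the right half with x - tau, so that both points
   stay in [0, 1]. *)
have L : P (0 + 0) + P (0 + tau) - c * prim z 0 <= P (1 / 2 + 0) + P (1 / 2 + tau) - c * prim z (1 / 2).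
  clear p1 p2 p3 p4 p5 p6.
  apply: (@is_derive_mono (fun x => P (x + 0) + P (x + tau) - c * prim z x)
  (fun x => (A * z (x + 0) - w (x + 0)) + (A * z (x + tau) - w (x + tau)) - c * z x)); first lra.
    move=> x hx; apply: is_deriveB; last by apply: is_deriveZ; apply: dZ; lra.
    by apply: is_deriveD; apply: dP; lra.
  move=> x hx; have x0 : 0 <= x by lra.
  have x1 : x + tau <= 1 by lra.
  by rewrite addr0; have [h _] := H2 x x0 x1; rewrite subr_ge0.
have Rr : P (1 / 2 + 0) + P (1 / 2 + - tau) - c * prim z (1 / 2) <= P (1 + 0) + P (1 + - tau) - c * prim z 1.
  clear p1 p2 p3 p4 p5 p6 L.
  apply: (@is_derive_mono (fun x => P (x + 0) + P (x + - tau) - c * prim z x)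
  (fun x => (A * z (x + 0) - w (x + 0)) + (A * z (x + - tau) - w (x + - tau)) - c * z x)); first lra.
    move=> x hx; apply: is_deriveB; last by apply: is_deriveZ; apply: dZ; lra.
    by apply: is_deriveD; apply: dP; lra.
  move=> x hx; have x0 : 0 <= x - tau by lra.
  have x1 : x - tau + tau <= 1 by lra.
  have [_] := H2 (x - tau) x0 x1.
  by rewrite addr0 subrK [X in _ <= X -> _]addrC subr_ge0.
rewrite !addr0 add0r in L Rr.
(* Since P is nondecreasing, each of the four increments of P in [L] and [Rr] is at most P 1 - P
   0. *)
suff : c * (prim z 1 - prim z 0) <= 4 * (P 1 - P 0).
  rewrite /I01 /P; move: (prim z 0) (prim z 1) (prim w 0) (prim w 1); clear=> z0 z1 w0 w1 h.
  by lra.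
move: L Rr p1 p2 p3 p4 p5 p6; move: (P 0) (P tau) (P (1 / 2)) (P (1 / 2 + tau)) (P 1) (P (1 / 2 - tau)) (P (1 - tau)).
move: (prim z 0) (prim z 1) (prim z (1 / 2)); clear; move=> z0 z1 z2 q0 q1 q2 q3 q4 q5 q6.
lra.
Qed.

Lemma is_derive_hb f m x : lip01 f -> (1 <= m)%N -> 0 <= x <= 1 ->
  is_derive x 1 (fun y => - prim f (hb m y)) ((m%:R + x) ^- 2 * f (hb m x)).
Proof.
move=> lf m1 hx; have m1R : 1 <= m%:R :> R by rewrite (ler_nat R 1).
have d := prim_is_derive lf (hb01 m1 hx).
have dh : is_derive x 1 (@hb R m) (- (m%:R + x) ^- 2).
  have mx : m%:R + x != 0 by lra.
  have di : is_derive x 1 (fun y : R => m%:R + y) 1.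
    by apply: is_derive_eq (is_deriveD (is_derive_cst (m%:R : R) x 1) (is_derive_id x (1 : R))) _; rewrite add0r.
  by apply: is_derive_eq (is_deriveV mx di) _; exact: mulr1.
have := is_deriveN (@is_derive1_comp R (prim f) (@hb R m) x _ _ d dh).
by rewrite mulrN opprK mulrC.
Qed.

(* The substitution y = 1 / (m + x) maps the terms to adjacent intervals [1 / (m + 1), 1 / m]. *)
Lemma I01_gauss f S (C : R) : lip01 f -> lip01 S -> (forall x, 0 <= x <= 1 -> 0 <= f x) ->
  (forall n x, (1 <= n)%N -> 0 <= x <= 1 ->
     S x <= \sum_(1 <= m < n) (m%:R + x) ^- 2 * f (hb m x) + C * (Num.sqrt n%:R)^-1) ->
  I01 S <= I01 f.
Proof.
move=> lf lS f0 H.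
have mono a b : 0 <= a -> a <= b -> b <= 1 -> prim f a <= prim f b.
  move=> a0 ab b1; apply: (@is_derive_mono (prim f) f) => // x hx; last by apply: f0; lra.
  by apply: prim_is_derive => //; lra.
have key n : (1 <= n)%N -> I01 S <= I01 f + C * (Num.sqrt n%:R)^-1.
  move=> n1; set e := C * _.
  pose T x := \sum_(1 <= m < n) - prim f (hb m x).
  have dT x : 0 <= x <= 1 -> is_derive x 1 T (\sum_(1 <= m < n) (m%:R + x) ^- 2 * f (hb m x)).
    move=> hx; rewrite /T; elim: n n1 {e H T} => // -[_ _|n IH _].
      rewrite big_geq// (_ : (fun x => _) = fun=> 0); first exact: is_derive_cst.
      by apply/funext => y; rewrite big_geq.
    rewrite big_nat_recr//= (_ : (fun x => _) = (fun x => \sum_(1 <= m < n.+1) - prim f (hb m x)) + (fun x => - prim f (hb n.+1 x))).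
      by apply: is_deriveD; [exact: IH|exact: is_derive_hb].
    by apply/funext => y; rewrite big_nat_recr.
  have de := is_derive_mul e.
  have := @is_derive_mono (fun x => T x + e * x - prim S x)
     (fun x => \sum_(1 <= m < n) (m%:R + x) ^- 2 * f (hb m x) + e - S x) 0 1 ler01.
  move=> K; have {}K : T 0 + e * 0 - prim S 0 <= T 1 + e * 1 - prim S 1.
    apply: K => x hx; last by rewrite subr_ge0; exact: H.
    have dS := prim_is_derive lS hx; have dT' := dT x hx; have de' := de x.
    by apply: is_deriveB; apply: is_deriveD.
  have TT : T 1 - T 0 = prim f 1 - prim f (n%:R^-1).
    rewrite /T -sumrB.
    under eq_bigr do rewrite opprK /hb addr0 addrC natr1.
    have -> : \sum_(1 <= i < n) (prim f (i%:R)^-1 - prim f (i.+1%:R)^-1) =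
       - \sum_(1 <= i < n) (prim f (i.+1%:R)^-1 - prim f (i%:R)^-1).
      by rewrite -sumrN; apply: eq_bigr => i _; rewrite opprB.
    by rewrite (telescope_sumr (fun i => prim f (i%:R)^-1) n1) opprB invr1.
  have nR : 1 <= n%:R :> R by rewrite (ler_nat R 1).
  (* The images of the digits below n cover [1 / n, 1]; the nonnegative integral over [0, 1 / n] is
     dropped. *)
  have : prim f 0 <= prim f (n%:R^-1).
    by apply: mono; rewrite ?invr_ge0 ?invf_le1//; lra.
  rewrite /I01; lra.
have cv : C * (Num.sqrt n%:R)^-1 @[n --> \oo] --> (0 : R).
  apply/cvgrPdist_lt => e e0; have [N N1 HN] := inv_sqrt_small `|C| e0.
  exists N => // n /= Nn; rewrite sub0r normrN normrM [`|_^-1|]ger0_norm ?invr_ge0 ?sqrtr_ge0//.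
  exact: HN.
have cv2 : I01 f + C * (Num.sqrt n%:R)^-1 @[n --> \oo] --> I01 f.
  by rewrite -[X in _ --> X]addr0; apply: cvgD => //; exact: cvg_cst.
by apply: (cvgr_to_ge cv2); exists 1%N => // n /= n1; exact: key.
Qed.

End Primitive.

Section Averages.
Variables (R : realType) (V : eqType) (act : nat -> V -> V) (vs : seq V).
Local Notation hb := (@hb R).
Hypotheses (vs_uniq : uniq vs) (vs_all : forall v, v \in vs).
Hypothesis act_inj : forall m, injective (act m).
Implicit Types (x y : R) (v : V) (w : R -> V -> R).

Definition Javg w : R := \sum_(v <- vs) I01 (w ^~ v).

Lemma act_perm m : perm_eq [seq act m v | v <- vs] vs.
Proof.
apply: uniq_perm => //; first by rewrite map_inj_uniq.
have sub : {subset [seq act m v | v <- vs] <= vs} by move=> v _; exact: vs_all.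
have [_ h] := uniq_min_size (s1 := [seq act m v | v <- vs]) ltac:(by rewrite map_inj_uniq) sub ltac:(by rewrite size_map).
exact: h.
Qed.

Lemma sum_act m (F : V -> R) : \sum_(v <- vs) F (act m v) = \sum_(v <- vs) F v.
Proof.
transitivity (\sum_(v <- [seq act m v | v <- vs]) F v); first by rewrite big_map.
exact: perm_big (act_perm m).
Qed.

Lemma loglip_lip01 b w v : 0 <= b -> loglip b w -> lip01 (w ^~ v).
Proof.
move=> b0 hw; have [U U0 hU] := loglip_ge0 hw; case: hw => w0 w1 _.
exists (b * expR b * U) => x y hx hy.
have D0 := DD_ge0 x y; have D1 := DD_le1 hx hy.
have Dd : DD x y <= `|x - y| by move: hx hy => /andP[x0 _] /andP[y0 _]; exact: DD_le.
have e1 : expR (b * DD x y) - 1 <= b * expR b * `|x - y|.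
  apply: le_trans (expR_sub1_le _) _.
  rewrite -!mulrA ler_wpM2l// mulrC; apply: ler_pM => //.
  by rewrite ler_expR ler_piMr.
have e0 : 1 <= expR (b * DD x y) by apply: expR_ge1; rewrite mulr_ge0.
have hxy := w1 x y v hx hy; have hyx := w1 y x v hy hx; rewrite DDC in hyx.
have ux := hU x v hx; have uy := hU y v hy.
have k1 : `|w x v - w y v| <= (expR (b * DD x y) - 1) * U.
  by rewrite ler_norml; nra.
apply: le_trans k1 _; rewrite mulrAC ler_wpM2r//; lra.
Qed.

(** For s = 1 and X = 0 this is the Gauss transfer operator, dual to composition with the Gauss map
    for Lebesgue measure. Each digit permutes the cosets, so summing over them leaves a function of
    x alone. *)
Lemma Javg_Lr1 b w : 0 <= b -> loglip b w -> Javg (Lr act 1 (fun=> 0) w) <= Javg w.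
Proof.
move=> b0 hw; have ok := @near10_one R V.
have hL := Lr_loglip act ok b0 hw.
have lw v := loglip_lip01 v b0 hw.
have lL v : lip01 (Lr act 1 (fun=> 0) w ^~ v) by apply: loglip_lip01 hL; lra.
rewrite /Javg !I01_sum//.
have [C hC] := loglip_dom act ok hw.
apply: (I01_gauss (C := \sum_(v <- vs) C)).
- exact: lip01_sum.
- exact: lip01_sum.
- by move=> x hx; apply: sumr_ge0 => v _; case: hw => h _ _; exact: ltW (h _ _ hx).
- move=> n x n1 hx.
  have -> : \sum_(1 <= m < n) (m%:R + x) ^- 2 * (\sum_(v <- vs) w (hb m x) v) =
     \sum_(v <- vs) psum (fun m => wt act 1 (fun=> 0) m x v * w (hb m x) (act m v)) n.
    rewrite /psum exchange_big/=; apply: eq_big_nat => m /andP[m1 _].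
    have m1R : 1 <= m%:R :> R by rewrite (ler_nat R 1).
    rewrite -(sum_act m) mulr_sumr; apply: eq_bigr => v _; congr (_ * _).
    rewrite /wt sub0r mulr1 expRN expRM_natl lnK// posrE.
    by move/andP : hx => [x0 _]; lra.
  rewrite mulr_suml -big_split/=; apply: ler_sum => v _.
  have := rsum_tail (hC x v hx) n1; rewrite /Lr => h.
  have := ler_norm (rsum (fun m => wt act 1 (fun=> 0) m x v * w (hb m x) (act m v)) -
    psum (fun m => wt act 1 (fun=> 0) m x v * w (hb m x) (act m v)) n); lra.
Qed.

Lemma Javg_sup b w x v : 0 <= b -> loglip b w -> 0 <= x <= 1 -> w x v <= expR b * Javg w.
Proof.
move=> b0 hw hx; have lw v' := loglip_lip01 v' b0 hw.
have [w0 w1 _] := hw.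
have I0 v' : 0 <= I01 (w ^~ v').
  have l0 := @lip01_cst R 0; have h := @I01_lin_le R (w ^~ v') (fun=> 0) (fun=> 0) 1 0 (lw v') l0 l0.
  rewrite I01_cst mul1r mul0r addr0 in h; apply: h => y hy.
  by rewrite mul1r addr0 ltW// w0.
have h1 : w x v <= expR b * I01 (w ^~ v).
  have := @I01_lin_le R (w ^~ v) (fun=> 0) (fun=> w x v) (expR b) 0 (lw v) (lip01_cst _) (lip01_cst _).
  rewrite !I01_cst mul0r addr0; apply => y hy.
  rewrite addr0; apply: le_trans (w1 x y v hx hy) _.
  rewrite ler_pM2r ?w0// ler_expR ler_piMr//; exact: DD_le1.
apply: le_trans h1 _; rewrite ler_pM2l ?expR_gt0//.
by rewrite /Javg (bigD1_seq v) ?vs_all//= lerDl; apply: sumr_ge0.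
Qed.

End Averages.

(** * Contraction of the averages *)

Section Iteration.
Variables (R : realType) (V : eqType) (act : nat -> V -> V) (vs : seq V).
Local Notation hb := (@hb R).
Local Notation normc := (@Normc.normc R).
Implicit Types (x y s t b A : R) (v : V) (w u : R -> V -> R) (X Y : V -> R).
Local Notation L1 := (Lr act 1 (fun=> 0)).

Definition square_bound s X A := forall x v, 0 <= x <= 1 ->
  (1 + x) * rsum (fun m => wt act s X m x v ^+ 2 / cs_weight act m x v) <= A.

(** The saving of one step: the weight available at the digits M and 2M, times the gain of a pair of
    points, times a comparison factor e^{-21} between the values of L1 ((1 + x) u^2) at distance 1 /
    |t|. *)
Definition cgap (M : nat) : R := weight_floor R M * ((M%:R^-1 / 200) ^+ 2 / 8) * expR (- (4 * 4 + 5)).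

Lemma cgap_gt0 M : (1 <= M)%N -> 0 < cgap M.
Proof.
move=> M1; have m0 : 0 < M%:R^-1 :> R by rewrite invr_gt0 ltr0n.
have a0 : 0 < M%:R^-1 / 200 :> R by apply: divr_gt0 => //; lra.
have b0 : 0 < (M%:R^-1 / 200) ^+ 2 / 8 :> R by have := exprn_gt0 2 a0; lra.
apply: mulr_gt0 (expR_gt0 _); exact: mulr_gt0 (weight_floor_gt0 _ _) b0.
Qed.

Lemma cgap_le1 M : (1 <= M)%N -> cgap M <= 1.
Proof.
move=> M1; have m1 : 1 <= M%:R :> R by rewrite (ler_nat R 1).
have c1 : weight_floor R M <= 1.
  rewrite /weight_floor ler_pdivrMr// mul1r.
  apply: (@le_trans _ _ 1); last lra.
  rewrite expr_le1 ?expR_ge0// -[leRHS]expR0 ler_expR.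
  have : 0 <= ln (M%:R + M%:R + 1 : R) by apply: ln_ge0; lra.
  lra.
have k1 : (M%:R^-1 / 200) ^+ 2 / 8 <= 1 :> R.
  have i1 : M%:R^-1 <= 1 :> R by rewrite invf_le1; lra.
  have i0 : 0 <= M%:R^-1 :> R by rewrite invr_ge0.
  have : (M%:R^-1 / 200) ^+ 2 <= 1 :> R.
    by rewrite -(expr1n _ 2); apply: lerXn2r; rewrite ?nnegrE; lra.
  lra.
have k0 : 0 <= (M%:R^-1 / 200) ^+ 2 / 8 :> R by have := sqr_ge0 (M%:R^-1 / 200 : R); lra.
have e0 := expR_ge0 (- (4 * 4 + 5) : R).
have e1 : expR (- (4 * 4 + 5)) <= 1 :> R by rewrite -[leRHS]expR0 ler_expR; lra.
rewrite /cgap; move: c1 k1 k0 e0 e1 (weight_floor_gt0 R M).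
move: (weight_floor R M) (_ / 8) (expR _) => c k e ? ? ? ? ? /ltW ?.
by apply: mulr_ile1 => //; [exact: mulr_ge0|exact: mulr_ile1].
Qed.

Lemma Lr_sqr s X A b u x v : near10 s X -> square_bound s X A -> loglip b u -> 0 <= x <= 1 ->
  (1 + x) * Lr act s X u x v ^+ 2 <= A * L1 (fun x v => (1 + x) * u x v ^+ 2) x v.
Proof.
move=> ok HA hu hx; have [C hC] := loglip_dom act ok hu.
have Q0 := @Lr_gauss_sqr_ge0 _ _ act _ _ x v hu hx.
set P := rsum (fun m => wt act s X m x v ^+ 2 / cs_weight act m x v).
have key : Lr act s X u x v ^+ 2 <= P * L1 (fun x v => (1 + x) * u x v ^+ 2) x v.
  have cv := cvg_psum (hC x v hx).
  have cv2 : (psum (fun m => wt act s X m x v * u (hb m x) (act m v)) n) ^+ 2 @[n --> \oo] --> Lr act s X u x v ^+ 2.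
    by rewrite expr2; under eq_fun do rewrite expr2; exact: cvgM.
  apply: (cvgr_to_le cv2); exists 0%N => // n /= _.
  apply: le_trans (psum_weighted_sqr act _ _ _ hu hx) _; apply: ler_wpM2r => //.
  apply: (psum_le_rsum _ (wt_sqr_dom act ok v hx)) => m m1; rewrite divr_ge0 ?sqr_ge0//.
  by rewrite ltW// cs_weight_gt0.
apply: (@le_trans _ _ ((1 + x) * (P * L1 (fun x v => (1 + x) * u x v ^+ 2) x v))).
  by rewrite ler_wpM2l//; lra.
by rewrite mulrA ler_wpM2r//; exact: HA.
Qed.

Hypotheses (vs_uniq : uniq vs) (vs_all : forall v, v \in vs).
Hypothesis act_inj : forall m, injective (act m).

(** The gain may vanish at a single point, but not at both x and x + 1 / |t|, so [I01_pair] extracts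
    a definite saving. It is measured against z = L1 ((1 + x) u^2), whose average does not exceed
    that of (1 + x) u^2. *)
Lemma dolgopyat_contract s t X Y psi u A (M : nat) : near10 s X -> 4 <= `|t| -> 1 <= A ->
  80 * 100 <= M%:R :> R -> square_bound s X A ->
  loglip (20 * `|t|) u -> majorized (20 * `|t|) psi u ->
  exists u', [/\ loglip (20 * `|t|) u', majorized (20 * `|t|) (Lc act s X t Y psi) u' &
    Javg vs (fun x v => (1 + x) * u' x v ^+ 2) <=
      (A - cgap M / 4) * Javg vs (fun x v => (1 + x) * u x v ^+ 2)].
Proof.
move=> ok t4 A1 hM HA hu hm; set b := 20 * `|t| in hu hm *.
have b0 : 0 <= b by rewrite /b; lra.
have M1 : (1 <= M)%N.
  have h : 1 <= M%:R :> R by lra.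
  by rewrite (ler_nat R 1) in h.
pose u' := dolgopyat act s t X Y psi u M; exists u'.
have hu' : loglip b u' by exact: dolgopyat_loglip.
split=> //; first exact: dolgopyat_majorized.
set w0 := fun x v => (1 + x) * u x v ^+ 2; set w1 := fun x v => (1 + x) * u' x v ^+ 2.
have lw0 : loglip (1 + 2 * b) w0 by exact: sqr_loglip.
have lw1 : loglip (1 + 2 * b) w1 by exact: sqr_loglip.
have b1 : 0 <= 1 + 2 * b by lra.
pose z := L1 w0.
have lz : loglip (21 * `|t|) z.
  (* Here 3 + (1 + 40 |t|) / 2 <= 21 |t| because |t| >= 4. *)
  by apply: loglipW (Lr_loglip act (near10_one R V) b1 lw0); rewrite /b; lra.
have C0 := cgap_gt0 M1; have C1 := cgap_le1 M1.
apply: (@le_trans _ _ ((A - cgap M / 4) * Javg vs z)); last first.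
  by apply: ler_wpM2l; [lra|exact: (Javg_Lr1 vs_uniq vs_all act_inj b1 lw0)].
rewrite /Javg mulr_sumr; apply: ler_sum => v _.
have t0 : 0 < `|t|^-1 by rewrite invr_gt0; lra.
have gb x : 0 <= x <= 1 -> 0 <= gain act t Y psi u M x v <= 1 / 4.
  by move=> hx; exact: (gain_bound act Y hu hm hM v hx).
have weight_floor0 := weight_floor_gt0 R M.
have z0 x : 0 <= x <= 1 -> 0 < z x v by move=> hx; case: lz => + _ _; apply.
have main x : 0 <= x <= 1 -> w1 x v <= (A - weight_floor R M * gain act t Y psi u M x v) * z x v.
  by move=> hx; exact: (dolgopyat_sqr Y ok hu hm hM v HA hx).
apply: (@I01_pair _ _ _ A (cgap M) `|t|^-1).
- exact: (loglip_lip01 v b1 lw1).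
- by apply: (loglip_lip01 v _ lz); lra.
- have : `|t|^-1 <= 4^-1 by rewrite lef_pV2 ?posrE; lra.
  by rewrite t0/=; lra.
- exact: ltW.
- move=> x hx; apply: le_trans (main x hx) _; apply: ler_wpM2r; first exact: ltW (z0 _ hx).
  by rewrite gerBl mulr_ge0// ?(ltW weight_floor0)//; have := gb x hx; lra.
- move=> x x0 xt; set y := x + `|t|^-1 in xt *.
  have hx : 0 <= x <= 1 by rewrite /y in xt; lra.
  have hy : 0 <= y <= 1 by rewrite /y in xt *; lra.
  have gp : (M%:R^-1 / 200) ^+ 2 / 8 <= gain act t Y psi u M x v + gain act t Y psi u M y v.
    exact: (gain_pair act Y t4 hu hm hM v x0 erefl xt).
  have Dxy : 21 * `|t| * DD x y <= 21.
    have : DD x y <= `|t|^-1.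
      apply: le_trans (DD_le x0 _) _; first by lra.
      by rewrite /y opprD addrA subrr sub0r normrN ger0_norm// ltW.
    move=> h; apply: (@le_trans _ _ (21 * `|t| * `|t|^-1)); first by rewrite ler_wpM2l//; lra.
    by rewrite -mulrA divff ?mulr1//; lra.
  have E21 : expR (4 * 4 + 5) = (expR (- (4 * 4 + 5)))^-1 :> R by rewrite expRN invrK.
  have key p q : 0 <= p <= 1 -> 0 <= q <= 1 -> 21 * `|t| * DD p q <= 21 -> expR (- (4 * 4 + 5)) * z p v <= z q v.
    move=> hp hq hpq; case: lz => _ lz _.
    have h1 := lz p q v hp hq.
    have h2 : z p v <= expR (4 * 4 + 5) * z q v.
      apply: le_trans h1 _; rewrite ler_pM2r ?z0// ler_expR; lra.
    by rewrite mulrC -ler_pdivlMr ?expR_gt0// mulrC -E21.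
  have kxy := key x y hx hy Dxy.
  have kyx : expR (- (4 * 4 + 5)) * z y v <= z x v by apply: key => //; rewrite DDC.
  have kxx : expR (- (4 * 4 + 5)) * z x v <= z x v by apply: key => //; rewrite DDxx mulr0; lra.
  have kyy : expR (- (4 * 4 + 5)) * z y v <= z y v by apply: key => //; rewrite DDxx mulr0; lra.
  have mx := main x hx; have my := main y hy.
  have /andP[gx _] := gb x hx; have /andP[gy _] := gb y hy.
  have fin p : expR (- (4 * 4 + 5)) * p <= z x v -> expR (- (4 * 4 + 5)) * p <= z y v -> 0 < p ->
     cgap M * p <= (A * z x v - w1 x v) + (A * z y v - w1 y v).
    move=> h1 h2 p0; rewrite /cgap.
    move: gp gx gy mx my h1 h2 (z0 x hx) (z0 y hy) weight_floor0 (expR_gt0 (- (4 * 4 + 5) : R)).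
    set g0 := _ / 8; set g1 := gain _ _ _ _ _ _ x v; set g2 := gain _ _ _ _ _ _ y v.
    set e := expR _; set c := weight_floor R M; set zx := z x v; set zy := z y v.
    set ax := w1 x v; set ay := w1 y v.
    clear -p0 => gp g10 g20 mx my h1 h2 zx0 zy0 weight_floor e0.
    have k1 : c * g1 * (e * p) <= c * g1 * zx by rewrite ler_wpM2l// mulr_ge0// ltW.
    have k2 : c * g2 * (e * p) <= c * g2 * zy by rewrite ler_wpM2l// mulr_ge0// ltW.
    have k3 : c * (e * p) * g0 <= c * (e * p) * (g1 + g2).
      by rewrite ler_wpM2l// mulr_ge0 ?mulr_ge0// ltW.
    lra.
  by split; apply: fin => //; exact: z0.
Qed.

Lemma dolgopyat_iter s t X Y psi u A (M k : nat) : near10 s X -> 4 <= `|t| -> 1 <= A ->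
  80 * 100 <= M%:R :> R -> square_bound s X A ->
  loglip (20 * `|t|) u -> majorized (20 * `|t|) psi u ->
  exists u', [/\ loglip (20 * `|t|) u', majorized (20 * `|t|) (iter k (Lc act s X t Y) psi) u' &
    Javg vs (fun x v => (1 + x) * u' x v ^+ 2) <=
      (A - cgap M / 4) ^+ k * Javg vs (fun x v => (1 + x) * u x v ^+ 2)].
Proof.
move=> ok t4 A1 hM HA hu hm; elim: k => [|k [u1 [h1 h2 h3]]].
  by exists u; split=> //; rewrite expr0 mul1r.
have [u2 [h4 h5 h6]] := dolgopyat_contract Y ok t4 A1 hM HA h1 h2.
exists u2; split=> //; apply: le_trans h6 _.
rewrite exprS -mulrA ler_wpM2l//.
have M1 : (1 <= M)%N.
  have h : 1 <= M%:R :> R by lra.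
  by rewrite (ler_nat R 1) in h.
by have := cgap_le1 M1; lra.
Qed.

Lemma Lr_mono s X b b' u w x v : near10 s X -> loglip b u -> loglip b' w -> 0 <= x <= 1 ->
  (forall y v, 0 <= y <= 1 -> u y v <= w y v) -> Lr act s X u x v <= Lr act s X w x v.
Proof.
move=> ok hu hw hx H; have [C hC] := loglip_dom act ok hu; have [C' hC'] := loglip_dom act ok hw.
apply: (rsum_le (hC x v hx) (hC' x v hx)) => m m1.
by rewrite ler_pM2l ?wt_gt0//; apply: H; exact: hb01.
Qed.

Lemma Lr_scale s X b u x v (k : R) : near10 s X -> loglip b u -> 0 <= x <= 1 ->
  Lr act s X (fun y v => k * u y v) x v = k * Lr act s X u x v.
Proof.
move=> ok hu hx; have [C hC] := loglip_dom act ok hu.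
by rewrite /Lr -(rsumZ _ (hC x v hx)); congr rsum; apply/funext => m; rewrite mulrCA.
Qed.

Lemma loglip_scale b u (k : R) : 0 < k -> loglip b u -> loglip b (fun y v => k * u y v).
Proof.
move=> k0 [h1 h2 [U h3]]; split.
- by move=> x v hx; rewrite mulr_gt0// h1.
- by move=> x y v hx hy; rewrite mulrCA ler_pM2l// h2.
- by exists (k * U) => x v hx; rewrite ler_pM2l// h3.
Qed.

(** The square of an iterate is controlled by an iterate of the operator at parameter 1, whose
    logarithmic Lipschitz constant relaxes towards 6 by halving while its average does not grow. *)
Lemma smooth_iter s X b u A n : near10 s X -> 0 < A -> square_bound s X A -> 0 <= b -> loglip b u ->
  let z := iter n L1 (fun x v => (1 + x) * u x v ^+ 2) in
  [/\ loglip (6 + b) (iter n (Lr act s X) u),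
      loglip (6 + (1 + 2 * b) / 2 ^+ n) z,
      forall x v, 0 <= x <= 1 -> (1 + x) * iter n (Lr act s X) u x v ^+ 2 <= A ^+ n * z x v &
      Javg vs z <= Javg vs (fun x v => (1 + x) * u x v ^+ 2)].
Proof.
move=> ok A0 HA b0 hu /=; set w := fun x v => _ * _.
have lw : loglip (1 + 2 * b) w by exact: sqr_loglip.
elim: n => [|n [h1 h2 h3 h4]] /=.
  split=> //; [by apply: loglipW hu; lra|by apply: loglipW lw; rewrite expr0; lra|].
  by move=> x v hx; rewrite expr0 mul1r.
set un := iter n _ u in h1 h3 *; set zn := iter n _ w in h2 h3 h4 *.
have i0 : 0 <= (1 + 2 * b) / 2 ^+ n by rewrite divr_ge0 ?exprn_ge0//; lra.
split.
- by apply: loglipW (Lr_loglip act ok _ h1); lra.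
- apply: loglipW (Lr_loglip act (near10_one R V) _ h2); last lra.
  have -> : (1 + 2 * b) / 2 ^+ n.+1 = (1 + 2 * b) / 2 ^+ n / 2 by rewrite exprS invfM; ring.
  lra.
- move=> x v hx; apply: le_trans (Lr_sqr v ok HA h1 hx) _.
  rewrite exprS -mulrA ler_pM2l//.
  rewrite -(Lr_scale v (A ^+ n) (near10_one R V) h2 hx).
  apply: (Lr_mono v (near10_one R V) (sqr_loglip h1) (loglip_scale (exprn_gt0 n A0) h2) hx).
  by move=> y v' hy; exact: h3.
- apply: le_trans h4; apply: (Javg_Lr1 vs_uniq vs_all act_inj _ h2); lra.
Qed.

Lemma plain_iter s t X Y psi u n : near10 s X -> 4 <= `|t| ->
  loglip (20 * `|t|) u -> majorized (20 * `|t|) psi u ->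
  loglip (20 * `|t|) (iter n (Lr act s X) u) /\
  majorized (20 * `|t|) (iter n (Lc act s X t Y) psi) (iter n (Lr act s X) u).
Proof.
move=> ok t4 hu hm; elim: n => [//|n [h1 h2]] /=; exact: Lc_majorized.
Qed.

Lemma loglip_cst b (K : R) : 0 <= b -> 0 < K -> loglip b (fun _ _ => K : R) (V := V).
Proof.
move=> b0 K0; split=> //; last by exists K.
move=> x y v _ _; apply: ler_peMl; first exact: ltW.
by apply: expR_ge1; rewrite mulr_ge0 ?DD_ge0.
Qed.

Lemma Javg_le w (K : R) b : 0 <= b -> loglip b w -> (forall x v, 0 <= x <= 1 -> w x v <= K) ->
  Javg vs w <= (size vs)%:R * K.
Proof.
move=> b0 hw H; apply: (@le_trans _ _ (\sum_(v <- vs) K)); last first.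
  by rewrite big_const_seq count_predT iter_addr_0 mulr_natl.
apply: ler_sum => v _.
have := @I01_lin_le R (fun=> K) (fun=> 0) (w ^~ v) 1 0 (lip01_cst _) (lip01_cst _) (loglip_lip01 v b0 hw).
rewrite !I01_cst mul0r addr0 mul1r; apply => x hx.
exact: H.
Qed.

(** The k steps with cancellation come first, then n smoothing steps. As 2^n >= |t|, the logarithmic
    constant becomes at most 6 + 1 + 40 = 47, and the supremum is at most e^47 times the average. *)
Lemma dolgopyat_long s t X Y psi A (K : R) (M n k : nat) : near10 s X -> 4 <= `|t| -> 1 <= A ->
  80 * 100 <= M%:R :> R -> square_bound s X A -> 0 < K -> `|t| <= 2 ^+ n ->
  majorized (20 * `|t|) psi (fun _ _ => K) ->
  exists u, [/\ loglip (20 * `|t|) u, majorized (20 * `|t|) (iter (n + k) (Lc act s X t Y) psi) u &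
    forall x v, 0 <= x <= 1 ->
      u x v ^+ 2 <= A ^+ n * (A - cgap M / 4) ^+ k * (expR (40 + 7) * ((size vs)%:R * (2 * K ^+ 2)))].
Proof.
move=> ok t4 A1 hM HA K0 tn hm; have b0 : 0 <= 20 * `|t| by lra.
have hK : loglip (20 * `|t|) (fun _ _ => K : R) (V := V) by exact: loglip_cst.
have [u1 [h1 h2 h3]] := dolgopyat_iter Y k ok t4 A1 hM HA hK hm.
have [g1 g2] := plain_iter Y n ok t4 h1 h2.
have A0 : 0 < A by lra.
have [_ s2 s3 s4] := smooth_iter n ok A0 HA b0 h1.
exists (iter n (Lr act s X) u1); split=> //; first by rewrite iterD.
move=> x v hx; set z := iter n _ _ in s2 s3 s4.
have M1 : (1 <= M)%N.
  have h : 1 <= M%:R :> R by lra.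
  by rewrite (ler_nat R 1) in h.
have th0 : 0 <= A - cgap M / 4 by have := cgap_le1 M1; lra.
have lz : loglip (40 + 7) z.
  apply: loglipW s2; have -> : (1 + 2 * (20 * `|t|)) / 2 ^+ n = 1 / 2 ^+ n + 40 * (`|t| / 2 ^+ n) by ring.
  have q1 : `|t| / 2 ^+ n <= 1 by rewrite ler_pdivrMr ?mul1r.
  have q2 : 1 / 2 ^+ n <= 1 :> R by rewrite ler_pdivrMr ?mul1r// exprn_ege1//; lra.
  lra.
have zb : z x v <= expR (40 + 7) * ((A - cgap M / 4) ^+ k * ((size vs)%:R * (2 * K ^+ 2))).
  have e47 : 0 <= 40 + 7 :> R by lra.
  apply: le_trans (Javg_sup vs_uniq vs_all v e47 lz hx) _.
  rewrite ler_pM2l ?expR_gt0//; apply: le_trans s4 _; apply: le_trans h3 _.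
  rewrite ler_wpM2l ?exprn_ge0//.
  apply: (Javg_le (b := 1 + 2 * (20 * `|t|))); [lra|exact: sqr_loglip|].
  by move=> y _ hy; rewrite ler_wpM2r ?sqr_ge0//; lra.
have := s3 x v hx; set U := iter n _ u1 x v => hU.
have U2 : U ^+ 2 <= (1 + x) * U ^+ 2 by rewrite ler_peMl ?sqr_ge0//; lra.
apply: le_trans U2 _; apply: le_trans hU _.
have -> : A ^+ n * (A - cgap M / 4) ^+ k * (expR (40 + 7) * ((size vs)%:R * (2 * K ^+ 2))) =
  A ^+ n * (expR (40 + 7) * ((A - cgap M / 4) ^+ k * ((size vs)%:R * (2 * K ^+ 2)))) by ring.
by rewrite ler_wpM2l// exprn_ge0// ltW.
Qed.

End Iteration.

(** * The cone generated by the kernels *)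

Section KernelCone.
Variables (R : realType) (V : eqType) (act : nat -> V -> V) (vs : seq V).
Local Notation hb := (@hb R).
Implicit Types (x y s a b th : R) (v : V) (X : V -> R) (l : seq (R * R)).

Definition kern a th x : R := expR (- (a * ln (1 + th * x))).

(** The list stands for a finitely supported signed measure on [0, 1], as pairs of a coefficient and
    a point. With finite lists each condition involves finitely many values of u, hence is closed
    under pointwise limits. *)
Definition kcone s (u : R -> R) := forall l,
  (forall p, p \in l -> 0 <= p.2 <= 1) ->
  (forall th, 0 <= th <= 1 -> 0 <= \sum_(p <- l) p.1 * kern (2 * s) th p.2) ->
  0 <= \sum_(p <- l) p.1 * u p.2.

Lemma ln1D_ge0 th x : 0 <= th -> 0 <= x -> 0 <= ln (1 + th * x).
Proof. by move=> h1 h2; apply: ln_ge0; rewrite lerDl mulr_ge0. Qed.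

Lemma kern_lip a th x y : 0 <= a -> 0 <= th <= 1 -> 0 <= x <= 1 -> 0 <= y <= 1 ->
  `|kern a th x - kern a th y| <= a * `|x - y|.
Proof.
move=> a0 /andP[t0 t1]; wlog xy : x y / x <= y => [H hx hy|/andP[x0 x1] /andP[y0 y1]].
  have /orP[xy|yx] := le_total x y; first exact: H.
  by rewrite distrC (distrC x); exact: H.
have tx := ln1D_ge0 t0 x0; have txy : th * x <= th * y by rewrite ler_wpM2l.
have p0 : 0 <= th * x by rewrite mulr_ge0.
have lxy : ln (1 + th * x) <= ln (1 + th * y) by rewrite ler_ln ?posrE; lra.
have ldiff : ln (1 + th * y) - ln (1 + th * x) <= y - x.
  rewrite ln_ratio; [|lra|lra].
  have -> : (1 + th * y) / (1 + th * x) = 1 + (th * (y - x)) / (1 + th * x) by field; lra.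
  have q0 : 0 <= th * (y - x) / (1 + th * x) by rewrite divr_ge0 ?mulr_ge0//; lra.
  apply: le_trans (le_ln1Dx _) _; first lra.
  rewrite ler_pdivrMr; last lra.
  have : th * (y - x) <= 1 * (y - x) by rewrite ler_wpM2r//; lra.
  have : 0 <= (y - x) * (th * x) by rewrite mulr_ge0//; lra.
  lra.
have e1 : kern a th y = kern a th x * expR (- (a * (ln (1 + th * y) - ln (1 + th * x)))).
  by rewrite /kern -expRD; congr expR; ring.
have k1 : kern a th x <= 1 by rewrite -[leRHS]expR0 ler_expR oppr_le0 mulr_ge0.
have k0 : 0 < kern a th x by exact: expR_gt0.
have h := expR_ge1Dx (- (a * (ln (1 + th * y) - ln (1 + th * x)))).
have E1 : expR (- (a * (ln (1 + th * y) - ln (1 + th * x)))) <= 1.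
  by rewrite -[leRHS]expR0 ler_expR oppr_le0 mulr_ge0//; lra.
set E := expR (- _) in e1 h E1.
have yx : kern a th y <= kern a th x by rewrite e1 ler_piMr// ltW.
rewrite ger0_norm ?subr_ge0// (distrC x) ger0_norm ?subr_ge0//.
have h2 : a * (ln (1 + th * y) - ln (1 + th * x)) <= a * (y - x) by rewrite ler_wpM2l.
have : kern a th x * (1 - E) <= 1 * (a * (y - x)) by apply: ler_pM => //; [exact: ltW|lra|lra].
rewrite e1; lra.
Qed.

Lemma kern_is_derive a th x : 0 <= th -> 0 <= x ->
  is_derive x 1 (kern a th) (- (a * th) * kern (a + 1) th x).
Proof.
move=> t0 x0; have p0 : 0 <= th * x by rewrite mulr_ge0.
have p1 : 0 < 1 + th * x by lra.
have d1 : is_derive x 1 (fun y : R => 1 + th * y) th.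
  apply: is_derive_eq (is_deriveD (is_derive_cst (1 : R) x 1) (is_derive_mul th x)) _.
  by rewrite add0r.
have d2 : is_derive x 1 (fun y : R => ln (1 + th * y)) ((1 + th * x)^-1 * th).
  exact: (@is_derive1_comp R (@ln R) (fun y => 1 + th * y) x _ _ (is_derive1_ln p1) d1).
have d3 : is_derive x 1 (fun y : R => - (a * ln (1 + th * y))) (- (a * ((1 + th * x)^-1 * th))).
  by apply: is_deriveN; apply: is_deriveZ.
apply: is_derive_eq (@is_derive1_comp R (@expR R) (fun y => - (a * ln (1 + th * y))) x _ _ (is_derive_expR _) d3) _.
have -> : kern (a + 1) th x = kern a th x * (1 + th * x)^-1.
  rewrite /kern mulrDl mul1r opprD expRD; congr (_ * _).
  by rewrite expRN lnK// posrE.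
by rewrite /kern; ring.
Qed.

Lemma kern_slope a th x y : 0 <= a -> 0 <= th <= 1 -> 0 <= x <= 1 -> 0 <= y <= 1 -> x != y ->
  exists c, [/\ 0 <= c <= 1, `|c - x| <= `|y - x| &
    (kern a th y - kern a th x) / (y - x) = - (a * th) * kern (a + 1) th c].
Proof.
move=> a0 ht hx hy xy.
have t0 : 0 <= th by lra.
have MV p q : 0 <= p -> p <= q -> exists2 c, p <= c <= q &
   kern a th q - kern a th p = - (a * th) * kern (a + 1) th c * (q - p).
  move=> p0 pq; have [||c cpq e] := @MVT_segment R (kern a th) (fun x => - (a * th) * kern (a + 1) th x) p q pq.
  - by move=> z; rewrite in_itv/= => /andP[h1 h2]; apply: kern_is_derive => //; lra.
  - apply: derivable_within_continuous => z; rewrite in_itv/= => /andP[h1 h2].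
    by have [] := @kern_is_derive a th z t0 ltac:(lra).
  - by exists c => //; rewrite in_itv/= in cpq.
have [h|h] := leP x y.
  have [c /andP[c1 c2] e] := MV x y ltac:(lra) h.
  exists c; split; [lra|by rewrite !ger0_norm ?subr_ge0//; lra|].
  by rewrite e mulfK// subr_eq0 eq_sym.
have [c /andP[c1 c2] e] := MV y x ltac:(lra) (ltW h).
exists c; split; [lra|by rewrite !ler0_norm ?subr_le0//; [lra|exact: ltW]|].
have -> : kern a th y - kern a th x = - (kern a th x - kern a th y) by ring.
rewrite e; have -> : y - x = - (x - y) by ring.
by rewrite invrN mulrNN mulfK// subr_eq0.
Qed.

(** Both quotients are derivatives at intermediate points, and [kern (a + 1) th] is 4-Lipschitz; 12
    = 3 * 4. This encodes a Lipschitz derivative through values at three points, a form that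
    [kcone_three] can transfer to the cone. *)
Lemma kern_three a th x y z : 0 <= a <= 3 -> 0 <= th <= 1 ->
  0 <= x <= 1 -> 0 <= y <= 1 -> 0 <= z <= 1 -> x != y -> x != z ->
  `|(kern a th y - kern a th x) / (y - x) - (kern a th z - kern a th x) / (z - x)|
   <= 12 * (`|y - x| + `|z - x|).
Proof.
move=> /andP[a0 a3] ht hx hy hz xy xz.
have [c [hc cx ->]] := kern_slope a0 ht hx hy xy.
have [d [hd dx ->]] := kern_slope a0 ht hx hz xz.
rewrite -mulrBr normrM normrN.
have a1 : 0 <= a + 1 by lra.
have k := kern_lip a1 ht hc hd.
have cd : `|c - d| <= `|y - x| + `|z - x|.
  have -> : c - d = (c - x) - (d - x) by ring.
  by apply: le_trans (ler_normB _ _) _; exact: lerD.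
have at3 : `|a * th| <= 3.
  move: ht => /andP[t0 t1]; rewrite ger0_norm ?mulr_ge0//.
  by apply: (@le_trans _ _ (3 * 1)); [apply: ler_pM|lra].
have k4 : `|kern (a + 1) th c - kern (a + 1) th d| <= 4 * (`|y - x| + `|z - x|).
  by apply: le_trans k _; apply: ler_pM => //; lra.
have -> : 12 * (`|y - x| + `|z - x|) = 3 * (4 * (`|y - x| + `|z - x|)) by ring.
exact: ler_pM.
Qed.

Lemma kern_ge8 a th x : 0 <= a <= 3 -> 0 <= th <= 1 -> 0 <= x <= 1 -> 1 <= 8 * kern a th x.
Proof.
move=> /andP[a0 a3] /andP[t0 t1] /andP[x0 x1].
have h0 := ln1D_ge0 t0 x0.
have tx : th * x <= 1 by apply: mulr_ile1.
have p0 : 0 <= th * x by rewrite mulr_ge0.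
have h2 : ln (1 + th * x) <= ln 2 by rewrite ler_ln ?posrE; lra.
have : expR (- (ln 2 * 3)) <= kern a th x.
  rewrite ler_expR lerN2; apply: (@le_trans _ _ (3 * ln (1 + th * x))); first by rewrite ler_wpM2r.
  by rewrite mulrC ler_wpM2r.
have -> : expR (- (ln 2 * 3)) = 8^-1 :> R.
  by rewrite expRN mulrC expRM_natl lnK ?posrE//; congr (_^-1); ring.
by move=> h; have := ler_wpM2l (ler0n R 8) h; rewrite divff//; lra.
Qed.

Lemma kern_gt0 a th x : 0 < kern a th x. Proof. exact: expR_gt0. Qed.

Lemma kern_loglip a th x y : 0 <= a <= 3 -> 0 <= th <= 1 -> 0 <= x <= 1 -> 0 <= y <= 1 ->
  kern a th x <= expR (3 * DD x y) * kern a th y.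
Proof.
move=> /andP[a0 a3] /andP[t0 t1] /andP[x0 x1] /andP[y0 y1].
rewrite /kern -expRD ler_expR.
suff : `|ln (1 + th * x) - ln (1 + th * y)| <= DD x y.
  by rewrite ler_norml => /andP[h1 h2]; have := DD_ge0 x y; nra.
have [->|tn] := eqVneq th 0; first by rewrite !mul0r subrr normr0 DD_ge0.
have tp : 0 < th by rewrite lt_def tn.
have e z : 0 <= z -> ln (1 + th * z) = ln th + ln (th^-1 + z).
  move=> z0; rewrite -lnMpos//; first by rewrite mulrDr mulfV.
  by rewrite ltr_wpDr// invr_gt0.
rewrite !e//; have -> : ln th + ln (th^-1 + x) - (ln th + ln (th^-1 + y)) = ln (th^-1 + x) - ln (th^-1 + y) by ring.
by apply: ln_shift => //; rewrite invf_ge1.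
Qed.

Section Consequences.
Variables (s : R) (u : R -> R).
Hypotheses (hs : 7 / 8 <= s <= 9 / 8) (hu : kcone s u).

Lemma kc_a : 0 <= 2 * s <= 3. Proof. have h := hs; lra. Qed.

Lemma kcone_ge0 x : 0 <= x <= 1 -> 0 <= u x.
Proof.
move=> hx; have := hu (l := [:: (1, x)]); rewrite !big_seq1 mul1r; apply.
  by move=> p; rewrite inE => /eqP ->.
by move=> th _; rewrite big_seq1 mul1r ltW// kern_gt0.
Qed.

Lemma kcone_two (c : R) x y : 0 <= x <= 1 -> 0 <= y <= 1 ->
  (forall th, 0 <= th <= 1 -> kern (2 * s) th x <= c * kern (2 * s) th y) -> u x <= c * u y.
Proof.
move=> hx hy H; have := hu (l := [:: (c, y); (-1, x)]).
rewrite !big_cons big_nil /= addr0 mulN1r subr_ge0; apply.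
  by move=> p; rewrite !inE => /orP[] /eqP ->.
by move=> th ht; rewrite !big_cons big_nil /= addr0 mulN1r subr_ge0; exact: H.
Qed.

Lemma kcone_le0 x : 0 <= x <= 1 -> u x <= u 0.
Proof.
move=> hx; rewrite -[u 0]mul1r; apply: kcone_two => //; first by rewrite lexx ler01.
move=> th /andP[t0 t1]; rewrite mul1r /kern ler_expR lerN2 mulr0 addr0 ln1 mulr0 mulr_ge0//.
  by have := kc_a => /andP[].
by apply: ln1D_ge0 => //; case/andP: hx.
Qed.

Lemma kcone_ge8 x : 0 <= x <= 1 -> u 0 <= 8 * u x.
Proof.
move=> hx; apply: kcone_two => //; first by rewrite lexx ler01.
move=> th ht; apply: le_trans (kern_ge8 kc_a ht hx).
have a0 := kc_a; rewrite /kern -[leRHS]expR0 ler_expR mulr0 addr0 ln1 mulr0; lra.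
Qed.

Lemma kcone_loglip x y : 0 <= x <= 1 -> 0 <= y <= 1 -> u x <= expR (3 * DD x y) * u y.
Proof. by move=> hx hy; apply: kcone_two => // th ht; exact: kern_loglip kc_a ht hx hy. Qed.

Lemma kcone_three x y z : 0 <= x <= 1 -> 0 <= y <= 1 -> 0 <= z <= 1 -> x != y -> x != z ->
  `|(u y - u x) / (y - x) - (u z - u x) / (z - x)| <= 12 * (`|y - x| + `|z - x|) * 8 * u x.
Proof.
move=> hx hy hz xy xz; set C := 12 * _.
have C0 : 0 <= C by rewrite mulr_ge0 ?addr_ge0//; lra.
have key (e : R) : `|e| <= 1 ->
    e * ((u y - u x) / (y - x) - (u z - u x) / (z - x)) <= C * 8 * u x.
  (* For e = 1 and e = -1 these are the two linear inequalities behind the absolute value; the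
     coefficient [C * 8] at x is paid for by [kern_ge8]. *)
  move=> e1; have := hu (l := [:: (- e / (y - x), y); (e / (z - x), z); (C * 8 + e / (y - x) - e / (z - x), x)]).
  rewrite !big_cons big_nil /= addr0 => H.
  rewrite -subr_ge0.
  have -> : C * 8 * u x - e * ((u y - u x) / (y - x) - (u z - u x) / (z - x)) =
    - e / (y - x) * u y + (e / (z - x) * u z + (C * 8 + e / (y - x) - e / (z - x)) * u x).
    by move: (y - x)^-1 (z - x)^-1 => p q; ring.
  apply: H; first by move=> p; rewrite !inE => /or3P[] /eqP ->.
  move=> th ht; rewrite !big_cons big_nil /= addr0.
  have -> : - e / (y - x) * kern (2 * s) th y + (e / (z - x) * kern (2 * s) th z + (C * 8 + e / (y - x) - e / (z - x)) * kern (2 * s) th x) =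
    C * (8 * kern (2 * s) th x) - e * ((kern (2 * s) th y - kern (2 * s) th x) / (y - x) - (kern (2 * s) th z - kern (2 * s) th x) / (z - x)).
    by move: (y - x)^-1 (z - x)^-1 => p q; ring.
  rewrite subr_ge0; apply: le_trans (ler_norm _) _; rewrite normrM.
  have k3 := kern_three kc_a ht hx hy hz xy xz.
  have k8 := kern_ge8 kc_a ht hx.
  apply: (@le_trans _ _ (1 * C)); first exact: ler_pM.
  by rewrite mul1r ler_peMr.
rewrite ler_norml; apply/andP; split.
  by have := key (-1); rewrite normrN normr1 lexx => /(_ isT); rewrite mulN1r; lra.
by have := key 1; rewrite normr1 lexx => /(_ isT); rewrite mul1r.
Qed.

End Consequences.

(** The constant 1 is the kernel with th = 0. *)
Lemma kcone_cst s : 7 / 8 <= s <= 9 / 8 -> kcone s (fun=> 1).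
Proof.
move=> hs l _ H; have := H 0; rewrite lexx ler01 => /(_ isT).
rewrite (_ : \sum_(p <- l) p.1 * kern (2 * s) 0 p.2 = \sum_(p <- l) p.1 * 1)//.
by apply: eq_bigr => p _; rewrite /kern mul0r addr0 ln1 mulr0 oppr0 expR0.
Qed.

Lemma kcone_scale s (k : R) (u : R -> R) : 0 <= k -> kcone s u -> kcone s (fun x => k * u x).
Proof.
move=> k0 hu l hl H; rewrite (_ : \sum_(p <- l) _ = k * \sum_(p <- l) p.1 * u p.2).
  by rewrite mulr_ge0// hu.
by rewrite mulr_sumr; apply: eq_bigr => p _; rewrite mulrCA.
Qed.

Lemma kcone_sum s n (f : nat -> R -> R) : (forall j, kcone s (f j)) ->
  kcone s (fun x => \sum_(0 <= j < n) f j x).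
Proof.
move=> hf l hl H; under eq_bigr do rewrite mulr_sumr.
by rewrite exchange_big/=; apply: sumr_ge0 => j _; exact: hf.
Qed.

Lemma rsum_sum (T : Type) (l : seq T) (c : T -> R) (a : T -> nat -> R) (C : T -> R) :
  (forall p, dominated (C p) (a p)) ->
  rsum (fun m => \sum_(p <- l) c p * a p m) = \sum_(p <- l) c p * rsum (a p).
Proof.
move=> D; suff [C' [DC ->]] : exists C', dominated C' (fun m => \sum_(p <- l) c p * a p m) /\
   rsum (fun m => \sum_(p <- l) c p * a p m) = \sum_(p <- l) c p * rsum (a p) by [].
elim: l => [|p l [C' [DC e]]].
  exists 0; split; first by move=> m m1; rewrite big_nil normr0 mul0r.
  rewrite big_nil (_ : (fun m => _) = fun=> 0) ?rsum0//.
  by apply/funext => m; rewrite big_nil.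
exists (`|c p| * C p + C'); have E : (fun m => \sum_(q <- p :: l) c q * a q m) =
   (fun m => c p * a p m + \sum_(q <- l) c q * a q m) by apply/funext => m; rewrite big_cons.
rewrite E; split; first by apply: dominatedD => //; exact: dominatedZ.
by rewrite (rsumD (dominatedZ (c p) (D p)) DC) (rsumZ _ (D p)) e big_cons.
Qed.

(* (m + y)^{-2 s} (1 + th / (m + y))^{-2 s} = (m + th)^{-2 s} (1 + y / (m + th))^{-2 s}:
   the branches map kernels to multiples of kernels. *)
Lemma kcone_Lr s X (u : R -> V -> R) (U : R) v : near10 s X ->
  (forall x v, 0 <= x <= 1 -> `|u x v| <= U) -> (forall v, kcone s (u ^~ v)) ->
  kcone s (Lr act s X u ^~ v).
Proof.
move=> ok hU hu l hl H.
(* The points of l lie in [0, 1], but [rsum_sum] asks for domination at every pair; clamping secures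
   it and changes nothing on l. *)
pose cl (x : R) : R := clamp01 x.
have hcl p : 0 <= cl p <= 1 := clamp01_in p.
have e1 : \sum_(p <- l) p.1 * Lr act s X u p.2 v = \sum_(p <- l) p.1 * Lr act s X u (cl p.2) v.
  rewrite big_seq [RHS]big_seq; apply: eq_bigr => p pl.
  by rewrite /cl clamp01_id ?hl.
rewrite e1 /Lr -(@rsum_sum _ _ (fun p : R * R => p.1) (fun p m => wt act s X m (cl p.2) v * u (hb m (cl p.2)) (act m v)) (fun=> 12 * U)); last first.
  by move=> p; exact: wtM_dom.
have D : exists C', dominated C' (fun m => \sum_(p <- l) p.1 * (wt act s X m (cl p.2) v * u (hb m (cl p.2)) (act m v))).
  elim: l {hl H e1} => [|p l [C' DC]].
    by exists 0 => m m1; rewrite big_nil normr0 mul0r.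
  exists (`|p.1| * (12 * U) + C') => m m1; rewrite big_cons.
  have Dp : dominated (12 * U) (fun m => wt act s X m (cl p.2) v * u (hb m (cl p.2)) (act m v)) by exact: wtM_dom.
  exact: (dominatedD (dominatedZ p.1 Dp) DC m1).
case: D => C' DC; apply: (rsum_ge0 DC) => m m1.
have m1R : 1 <= m%:R :> R by rewrite (ler_nat R 1).
have := hu (act m v) [seq (p.1 * expR (- (2 * s * ln (m%:R + cl p.2))), hb m (cl p.2)) | p <- l].
rewrite !big_map /= => K.
have -> : \sum_(p <- l) p.1 * (wt act s X m (cl p.2) v * u (hb m (cl p.2)) (act m v)) =
  expR (X (act m v)) * \sum_(p <- l) p.1 * expR (- (2 * s * ln (m%:R + cl p.2))) * u (hb m (cl p.2)) (act m v).
  by rewrite mulr_sumr; apply: eq_bigr => p _; rewrite /wt expRD; ring.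
apply: mulr_ge0; first exact: expR_ge0.
apply: K; first by move=> q /mapP[p _ ->] /=; apply: hb01.
move=> th ht; rewrite big_map /=.
have mt : 0 < m%:R + th by lra.
have -> : \sum_(p <- l) p.1 * expR (- (2 * s * ln (m%:R + cl p.2))) * kern (2 * s) th (hb m (cl p.2)) =
  expR (- (2 * s * ln (m%:R + th))) * \sum_(p <- l) p.1 * kern (2 * s) (m%:R + th)^-1 p.2.
  rewrite mulr_sumr big_seq [RHS]big_seq; apply: eq_bigr => p pl.
  have hp := hl p pl; rewrite /cl clamp01_id//.
  rewrite -mulrA [RHS]mulrCA; congr (_ * _); rewrite /kern -!expRD -!opprD -!mulrDr.
  move: hp => /andP[p0 p1].
  have i0 : 0 < (m%:R + p.2)^-1 by rewrite invr_gt0; lra.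
  have q0 : 0 <= th * (m%:R + p.2)^-1 by apply: mulr_ge0; [lra|exact: ltW].
  have q1 : 0 <= (m%:R + th)^-1 * p.2 by rewrite mulr_ge0 ?invr_ge0//; exact: ltW.
  rewrite /hb -!lnMpos; [|lra..].
  congr (expR (- (_ * ln _))); field; lra.
apply: mulr_ge0; first exact: expR_ge0.
(* The branch sends the kernel parameter th to 1 / (m + th), which is again in [0, 1]. *)
apply: H; rewrite invr_ge0 ltW//= invf_le1//; lra.
Qed.

End KernelCone.

(** * The positive eigenfunction *)

Section Fekete.
Variable R : realType.
Implicit Types (a b : nat -> R).

Lemma bernoulli (h : R) n : 0 <= h -> 1 + n%:R * h <= (1 + h) ^+ n.
Proof.
move=> h0; elim: n => [|n IH]; first by rewrite mul0r addr0 expr0.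
rewrite exprS -natr1; have n0 : 0 <= n%:R :> R by [].
have : (1 + h) * (1 + n%:R * h) <= (1 + h) * (1 + h) ^+ n by rewrite ler_wpM2l//; lra.
have : 0 <= n%:R * h * h by rewrite !mulr_ge0.
lra.
Qed.

(* With b n = e^{-n l} a n >= 1: were b n always larger than e times the sum of the
   previous ones, b would grow exponentially, against the definition of l. *)
Lemma fekete_growth a (c : R) : 0 < c -> (forall n, c ^+ n <= a n) ->
  (forall n m, a (n + m)%N <= a n * a m) ->
  exists l : R, (forall n, expR (n%:R * l) <= a n) /\
    forall e : R, 0 < e -> exists2 n, (1 <= n)%N &
      expR (- (n%:R * l)) * a n <= e * \sum_(0 <= j < n) expR (- (j%:R * l)) * a j.
Proof.
move=> c0 ca sub; have a0 n : 0 < a n by apply: lt_le_trans (ca n); rewrite exprn_gt0.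
pose A := [set ln (a n) / n%:R | n in [set n | (1 <= n)%N]].
have Alb : lbound A (ln c).
  move=> _ [n /= n1 <-]; have n0 : 0 < n%:R :> R by rewrite ltr0n.
  rewrite ler_pdivlMr//; have -> : ln c * n%:R = ln (c ^+ n) by rewrite lnXn// mulr_natr.
  by rewrite ler_ln ?posrE ?exprn_gt0.
have Ane : A !=set0 by exists (ln (a 1%N) / 1%:R); exists 1%N.
pose l := inf A; exists l.
have lb n : expR (n%:R * l) <= a n.
  case: n => [|n]; first by rewrite mul0r expR0 -(expr0 c).
  rewrite -[leRHS]lnK ?posrE// ler_expR mulrC -ler_pdivlMr ?ltr0n//.
  by apply: ge_inf; [exists (ln c)|exists n.+1].
split=> // e e0; apply: contrapT => H.
pose b n := expR (- (n%:R * l)) * a n; pose S n := \sum_(0 <= j < n) b j.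
have b0 n : 0 < b n by rewrite mulr_gt0 ?expR_gt0.
have b1 n : 1 <= b n.
  rewrite /b expRN mulrC ler_pdivlMr ?expR_gt0// mul1r; exact: lb.
have Hb n : (1 <= n)%N -> e * S n < b n.
  by move=> n1; rewrite ltNge; apply/negP => h; apply: H; exists n.
have S1 n : (1 + e) ^+ n <= S n.+1.
  elim: n => [|n IH]; first by rewrite /S big_nat1 expr0.
  have -> : S n.+2 = S n.+1 + b n.+1 by rewrite /S big_nat_recr.
  have := Hb n.+1 isT; rewrite exprS.
  have : (1 + e) * (1 + e) ^+ n <= (1 + e) * S n.+1 by rewrite ler_wpM2l//; lra.
  lra.
have gb n : e * (1 + e) ^+ n <= b n.+1.
  by apply: le_trans (ltW (Hb n.+1 isT)); rewrite ler_pM2l.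
have e1 : 1 < 1 + e by lra.
(* Half the growth rate forced by [gb]: some b N stays below e^{N d}, and submultiplicativity along
   the multiples of N contradicts the full rate. *)
pose d := ln (1 + e) / 2.
have d0 : 0 < d by rewrite divr_gt0// ln_gt0.
have [_ [N /= N1 <-] HN] := inf_adherent d0 (conj Ane (ex_intro _ (ln c) Alb)).
have N0 : 0 < N%:R :> R by rewrite ltr0n.
rewrite -/l ltr_pdivrMr// in HN.
have bN : b N < expR (N%:R * d).
  have aN : a N < expR ((l + d) * N%:R) by rewrite -[ltLHS]lnK ?posrE// ltr_expR.
  have -> : N%:R * d = - (N%:R * l) + (l + d) * N%:R by ring.
  by rewrite expRD /b ltr_pM2l ?expR_gt0.
have bsub n m : b (n + m)%N <= b n * b m.
  rewrite /b mulrACA -expRD natrD mulrDl -opprD; apply: ler_wpM2l; [exact: expR_ge0|exact: sub].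
have bk k : b (N * k.+1)%N <= expR (N%:R * d) ^+ k.+1.
  elim: k => [|k IH]; first by rewrite muln1 expr1 ltW.
  rewrite mulnS exprS; apply: le_trans (bsub _ _) _.
  by apply: ler_pM => //; exact: ltW.
pose y := expR (N%:R * d).
have y1 : 1 < y by rewrite /y -[ltLHS]expR0 ltr_expR mulr_gt0.
have key k : e * y ^+ k.+1 <= 1 + e.
  have pos : (0 < N * k.+1)%N by rewrite muln_gt0 N1.
  have h1 := gb (N * k.+1).-1; rewrite prednK// in h1.
  have h2 := le_trans h1 (bk k).
  have e2 : (1 + e) ^+ (N * k.+1) = y ^+ k.+1 * y ^+ k.+1.
    rewrite -exprMn exprM; congr (_ ^+ _).
    rewrite /y -expRD; have -> : N%:R * d + N%:R * d = N%:R * ln (1 + e) by rewrite /d; field.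
    by rewrite expRM_natl lnK// posrE; lra.
  have yk0 : 0 < y ^+ k.+1 by rewrite exprn_gt0//; lra.
  have h3 : e * (1 + e) ^+ (N * k.+1) <= (1 + e) * y ^+ k.+1.
    rewrite -{1}(prednK pos) exprS mulrCA ler_pM2l//; lra.
  by move: h3; rewrite e2 mulrA ler_pM2r.
pose K := Num.bound ((1 + e) / e / (y - 1)).
have ye : 0 < y - 1 by lra.
have q0 : 0 <= (1 + e) / e / (y - 1) by apply: divr_ge0; [apply: divr_ge0|]; lra.
have := archi_boundP q0; rewrite -/K ltr_pdivrMr// ltr_pdivrMr// => hK.
have := @bernoulli (y - 1) K.+1 (ltW ye); rewrite -natr1.
have -> : 1 + (y - 1) = y by ring.
move=> hB; have := key K.
have : e * (1 + (K%:R + 1) * (y - 1)) <= e * y ^+ K.+1 by rewrite ler_pM2l.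
move: (mulr_gt0 e0 ye) hK; move: (y ^+ K.+1) (K%:R : R) => Y k; clear -e0.
move=> h1 h2 h3 h4; have : e * (1 + (k + 1) * (y - 1)) = e + k * (y - 1) * e + e * (y - 1) by ring.
by move: (k * (y-1) * e) (e * (y-1)) h1 h2 h3 h4 => *; lra.
Qed.

End Fekete.

Section UltraLimit.
Variable R : realType.

(** By compactness there is a cluster point, and an ultrafilter converges to its cluster points. One
    ultrafilter serves all x and v at once, with no extraction of subsequences. *)
Lemma bounded_ultra_cvg (U : set_system nat) (UU : UltraFilter U) (a : nat -> R) :
  (forall j, 0 <= a j <= 1) -> cvg (a j @[j --> U]).
Proof.
move=> ha; have PF : ProperFilter U by exact: ultra_proper.
have PFa : ProperFilter (a j @[j --> U]) by exact: fmap_proper_filter.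
have h01 : (a j @[j --> U]) [set` `[(0:R), 1]].
  by apply: (@filterE _ U) => j /=; rewrite in_itv/=; exact: ha.
have [p [_ clp]] := @segment_compact R 0 1 _ PFa h01.
apply/cvg_ex; exists p; move=> B nB.
have [//|UC] := in_ultra_setVsetC (a @^-1` B) UU.
have [q [/= q1 q2]] := clp (~` B) B UC nB.
by case: q1.
Qed.

End UltraLimit.

Section Eigen.
Variables (R : realType) (V : eqType) (act : nat -> V -> V) (vs : seq V).
Local Notation hb := (@hb R).
Implicit Types (x y s : R) (v : V) (X : V -> R) (u : R -> V -> R).
Hypotheses (vs_all : forall v, v \in vs) (v0 : V).

Definition iter_one s X n := iter n (Lr act s X) (fun _ _ => 1).

Lemma iter_one_loglip s X n : near10 s X -> loglip 6 (iter_one s X n).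
Proof.
move=> ok; have p6 : 0 <= 6 :> R by lra.
elim: n => [|n IH]; first exact: loglip_cst.
by apply: loglipW (Lr_loglip act ok p6 IH); lra.
Qed.

Lemma iter_one_kcone s X n v : near10 s X -> kcone s (iter_one s X n ^~ v).
Proof.
move=> ok; elim: n v => [|n IH] v; first by apply: kcone_cst; case: ok.
have [U U0 hU] := loglip_ge0 (iter_one_loglip n ok).
have hU' x w : 0 <= x <= 1 -> `|iter_one s X n x w| <= U.
  by move=> hx; have /andP[h1 h2] := hU x w hx; rewrite ger0_norm.
exact: (kcone_Lr act v ok hU' IH).
Qed.

(** Functions of the cone are largest at 0, so this sum bounds the supremum of the iterate, which
    makes it submultiplicative in n. *)
Definition growth s X n : R := \sum_(v <- vs) iter_one s X n 0 v.

Let z01 : 0 <= (0 : R) <= 1. Proof. by rewrite lexx ler01. Qed.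

Lemma iter_one0_gt0 s X n v : near10 s X -> 0 < iter_one s X n 0 v.
Proof. by move=> ok; case: (iter_one_loglip n ok) => h _ _; apply: h; exact: z01. Qed.

Lemma iter_one0_le_growth s X n v : near10 s X -> iter_one s X n 0 v <= growth s X n.
Proof.
move=> ok; rewrite /growth (big_rem v) ?vs_all//= lerDl.
by apply: sumr_ge0 => w _; exact: ltW (iter_one0_gt0 _ _ ok).
Qed.

Lemma iter_one_le_growth s X n x v : near10 s X -> 0 <= x <= 1 -> iter_one s X n x v <= growth s X n.
Proof.
move=> ok hx; apply: le_trans (iter_one0_le_growth n v ok).
by apply: (kcone_le0 (s := s) _ (iter_one_kcone n v ok) hx); case: ok.
Qed.

Lemma growth_gt0 s X n : near10 s X -> 0 < growth s X n.
Proof. by move=> ok; apply: lt_le_trans (iter_one0_gt0 n v0 ok) (iter_one0_le_growth n v0 ok). Qed.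

Lemma iter_one_submul s X n m x v : near10 s X -> 0 <= x <= 1 ->
  iter_one s X (n + m)%N x v <= growth s X n * iter_one s X m x v.
Proof.
move=> ok; elim: m x v => [|m IH] x v hx.
  by rewrite addn0 mulr1; exact: iter_one_le_growth.
rewrite addnS -(Lr_scale act v _ ok (iter_one_loglip m ok) hx).
apply: (Lr_mono act v ok (iter_one_loglip _ ok) (loglip_scale (growth_gt0 n ok) (iter_one_loglip m ok)) hx).
by move=> y w hy; exact: IH.
Qed.

Lemma growth_submul s X n m : near10 s X -> growth s X (n + m)%N <= growth s X n * growth s X m.
Proof.
by move=> ok; rewrite /growth mulr_sumr; apply: ler_sum => v _; exact: iter_one_submul.
Qed.

Definition wlow (m : nat) : R := expR (- 1 - 3 * ln (m%:R + 1)).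

Lemma wt_low s X m x v : near10 s X -> (1 <= m)%N -> 0 <= x <= 1 -> wlow m <= wt act s X m x v.
Proof.
move=> [/andP[s1 s2] hX] m1 /andP[x0 x1]; rewrite ler_expR.
have m1R : 1 <= m%:R :> R by rewrite (ler_nat R 1).
have l0 : 0 <= ln (m%:R + x) by apply: ln_ge0; lra.
have l1 : ln (m%:R + x) <= ln (m%:R + 1) by rewrite ler_ln ?posrE; lra.
have := hX (act m v); rewrite ler_norml => /andP[h _]; nra.
Qed.

Lemma iter_one_low s X n x v : near10 s X -> 0 <= x <= 1 -> wlow 1 ^+ n <= iter_one s X n x v.
Proof.
move=> ok; elim: n x v => [|n IH] x v hx; first by rewrite expr0.
apply: le_trans (Lr_term_le act v ok (iter_one_loglip n ok) hx (leqnn 1)).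
rewrite exprS; apply: ler_pM; [exact: expR_ge0|by rewrite exprn_ge0// expR_ge0|exact: wt_low|].
by apply: IH; exact: hb01.
Qed.

Lemma growth_low s X n : near10 s X -> wlow 1 ^+ n <= growth s X n.
Proof. by move=> ok; apply: le_trans (iter_one_low n v0 ok z01) (iter_one0_le_growth n v0 ok). Qed.

Lemma growth_one s X : near10 s X -> growth s X 1 <= (size vs)%:R * 12.
Proof.
move=> ok; apply: (@le_trans _ _ (\sum_(v <- vs) 12)); last first.
  by rewrite big_const_seq count_predT iter_addr_0 mulr_natl.
apply: ler_sum => v _; apply: le_trans (ler_norm _) _.
have D : dominated (12 * 1) (fun m => wt act s X m 0 v * (fun _ _ => 1 : R) (hb m 0) (act m v)).
  by apply: (@wtM_dom R V act s X (fun _ _ => 1) 1) => // y w _; rewrite normr1.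
by have := rsum_abs_le D; rewrite mulr1.
Qed.

Lemma Lr_sum s X b n (c : nat -> R) (f : nat -> R -> V -> R) x v : near10 s X ->
  (forall j, loglip b (f j)) -> 0 <= x <= 1 ->
  Lr act s X (fun y w => \sum_(0 <= j < n) c j * f j y w) x v =
  \sum_(0 <= j < n) c j * Lr act s X (f j) x v.
Proof.
move=> ok hf hx.
have [C hC] := choice (fun j => loglip_dom act ok (hf j)).
rewrite /Lr -(rsum_sum _ _ (fun j => hC j x v hx)); congr rsum; apply/funext => m.
by rewrite mulr_sumr; apply: eq_bigr => j _; rewrite mulrCA.
Qed.

(* On the sum of the e^{-j l} L^j 1 for j < n, L - e^l telescopes to the first and last terms. *)
Lemma approx_eigen s X : near10 s X -> exists2 l : R, expR l <= (size vs)%:R * 12 &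
  forall e : R, 0 < e -> exists u, [/\ forall v, kcone s (u ^~ v),
    \sum_(v <- vs) u 0 v = 1 &
    forall x v, 0 <= x <= 1 ->
      (exists C, dominated C (fun m => wt act s X m x v * u (hb m x) (act m v))) /\
      `|Lr act s X u x v - expR l * u x v| <= e].
Proof.
move=> ok; have hs : 7 / 8 <= s <= 9 / 8 by case: ok.
have [l [l1 l2]] := fekete_growth (expR_gt0 _ : 0 < wlow 1) (fun n => growth_low n ok) (fun n m => growth_submul n m ok).
exists l; first by apply: le_trans (growth_one ok); have := l1 1%N; rewrite mul1r.
move=> e e0; have el0 := expR_gt0 l.
have [n n1 hn] := l2 _ (divr_gt0 e0 el0).
pose c j := expR (- (j%:R * l)).
pose S := \sum_(0 <= j < n) c j * growth s X j.
rewrite -/S -/(c n) in hn.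
have c0 j : 0 < c j by exact: expR_gt0.
have S0 : 0 < S.
  rewrite /S -(prednK n1) big_nat_recl//; apply: ltr_wpDr.
    by apply: sumr_ge0 => j _; apply: mulr_ge0; apply: ltW => //; exact: growth_gt0.
  by rewrite mulr_gt0// growth_gt0.
pose u x v := \sum_(0 <= j < n) (S^-1 * c j) * iter_one s X j x v.
exists u; split.
- move=> v; apply: kcone_sum => j; apply: kcone_scale; last exact: iter_one_kcone.
  by rewrite mulr_ge0 ?invr_ge0 ?ltW.
- rewrite exchange_big/= -(mulVf (lt0r_neq0 S0)) {3}/S mulr_sumr.
  by apply: eq_bigr => j _; rewrite -mulr_sumr mulrA.
- move=> x v hx; split.
    have [C hC] := choice (fun j => loglip_dom act ok (iter_one_loglip j ok)).
    have -> : (fun m => wt act s X m x v * u (hb m x) (act m v)) =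
       (fun m => \sum_(0 <= j < n) (S^-1 * c j) * (wt act s X m x v * iter_one s X j (hb m x) (act m v))).
      by apply/funext => m; rewrite /u mulr_sumr; apply: eq_bigr => j _; rewrite mulrCA.
    elim: (n) => [|k [C' DC]].
      by exists 0 => m m1; rewrite big_geq// normr0 mul0r.
    exists (C' + `|S^-1 * c k| * C k) => m m1; rewrite big_nat_recr//=.
    exact: (dominatedD DC (dominatedZ _ (hC k x v hx)) m1).
  rewrite (Lr_sum n (fun j => S^-1 * c j) v ok (fun j => iter_one_loglip j ok) hx).
  have -> : \sum_(0 <= j < n) S^-1 * c j * Lr act s X (iter_one s X j) x v - expR l * u x v =
    expR l * S^-1 * (c n * iter_one s X n x v - c 0%N * iter_one s X 0 x v).
    rewrite -(telescope_sumr (fun j => c j * iter_one s X j x v) (leq0n n)) mulr_sumr /u mulr_sumr -sumrB.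
    apply: eq_bigr => j _; have -> : Lr act s X (iter_one s X j) x v = iter_one s X j.+1 x v by [].
    have -> : c j = expR l * c j.+1.
      by rewrite /c -expRD -[j.+1%:R]natr1; congr expR; ring.
    ring.
  have Si : 0 < S^-1 by rewrite invr_gt0.
  rewrite normrM normrM (gtr0_norm el0) (gtr0_norm Si).
  (* Both end terms of the telescoping sum lie between 0 and [c n * growth s X n], the first term
     being 1. *)
  have bn1 : 1 <= c n * growth s X n.
    have := l1 n => h; rewrite /c expRN mulrC ler_pdivlMr ?expR_gt0// mul1r//.
  have f0 : 0 < iter_one s X n x v by case: (iter_one_loglip n ok) => + _ _; apply.
  have cf : 0 <= c n * iter_one s X n x v <= c n * growth s X n.
    by rewrite mulr_ge0 ?(ltW f0) ?(ltW (c0 n))//= ler_pM2l// iter_one_le_growth.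
  have -> : c 0%N * iter_one s X 0 x v = 1 by rewrite /c mul0r oppr0 expR0 mul1r.
  have h : `|c n * iter_one s X n x v - 1| <= c n * growth s X n by rewrite ler_norml; lra.
  have : expR l * S^-1 * `|c n * iter_one s X n x v - 1| <= expR l * S^-1 * (e / expR l * S).
    by apply: ler_wpM2l; [rewrite mulr_ge0 ?invr_ge0 ?ltW|exact: le_trans h hn].
  by have -> : expR l * S^-1 * (e / expR l * S) = e by field; rewrite !gt_eqF.
Qed.

(** The tails of all the series are at most 12 / sqrt n, uniformly in j, while for fixed n the
    partial sums are finite and pass to the limit. Thus the limit along U commutes with the infinite
    sum. *)
Lemma exact_eigen s X : near10 s X -> exists l : R, expR l <= (size vs)%:R * 12 /\
  exists G, [/\ forall v, kcone s (G ^~ v), \sum_(v <- vs) G 0 v = 1,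
    forall x v, 0 <= x <= 1 -> 0 <= G x v <= 1 &
    forall x v, 0 <= x <= 1 -> Lr act s X G x v = expR l * G x v].
Proof.
move=> ok; have hs : 7 / 8 <= s <= 9 / 8 by case: ok.
have [l lb ap] := approx_eigen ok; exists l; split=> //.
have [u hu] := choice (fun j : nat => ap (j.+1%:R^-1) ltac:(by rewrite invr_gt0 ltr0n)).
have u01 j x v : 0 <= x <= 1 -> 0 <= u j x v <= 1.
  move=> hx; have [k1 k2 _] := hu j.
  rewrite (kcone_ge0 (k1 v) hx)/=; apply: le_trans (kcone_le0 hs (k1 v) hx) _.
  rewrite -k2 (big_rem v) ?vs_all//= lerDl; apply: sumr_ge0 => w _.
  exact: (kcone_ge0 (k1 w) z01).
have [U [UU sU]] := @ultraFilterLemma nat (\oo) _.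
have PU : ProperFilter U by exact: ultra_proper.
pose G x v := lim (u j x v @[j --> U]).
have cG x v : 0 <= x <= 1 -> u j x v @[j --> U] --> G x v.
  by move=> hx; apply: bounded_ultra_cvg => // j; exact: u01.
have csum (T : Type) (L : seq T) (c : T -> R) (f : T -> R) (w : T -> V) :
    (forall p, 0 <= f p <= 1) ->
    \sum_(p <- L) c p * u j (f p) (w p) @[j --> U] --> \sum_(p <- L) c p * G (f p) (w p).
  move=> hf; elim: L => [|p L IH].
    rewrite big_nil; under eq_fun do rewrite big_nil; exact: cvg_cst.
  rewrite big_cons; under eq_fun do rewrite big_cons.
  by apply: cvgD => //; apply: cvgM; [exact: cvg_cst|exact: cG].
exists G; split.
- move=> v L hL HL.
  have e (g : R -> R) : \sum_(p <- L) p.1 * g p.2 = \sum_(p <- L) p.1 * g (clamp01 p.2).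
    by rewrite big_seq [RHS]big_seq; apply: eq_bigr => p pL; rewrite clamp01_id ?hL.
  rewrite (e (G ^~ v)); apply: (cvgr_to_ge (csum _ L (fun p => p.1) (fun p => clamp01 p.2) (fun=> v) _)).
    by move=> p; exact: clamp01_in.
  apply: filterE => j; rewrite -(e (u j ^~ v)); have [k1 _ _] := hu j; exact: k1.
- have := csum _ vs (fun=> 1) (fun=> 0) id (fun=> z01).
  under eq_fun => j do (under eq_bigr do rewrite mul1r; have [_ -> _] := hu j).
  rewrite (eq_bigr (fun v => G 0 v)); last by move=> v _; rewrite mul1r.
  move=> h; apply/esym; apply: (cvg_unique (@Rhausdorff R) _ h); exact: cvg_cst.
- move=> x v hx; apply/andP; split.
    by apply: (cvgr_to_ge (cG x v hx)); apply: filterE => j; have /andP[] := u01 j x v hx.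
  by apply: (cvgr_to_le (cG x v hx)); apply: filterE => j; have /andP[] := u01 j x v hx.
- move=> x v hx.
  have [] // := @rsum_eq R 12 (fun m => wt act s X m x v * G (hb m x) (act m v)) (expR l * G x v).
  move=> n n1.
  have c1 : `|expR l * u j x v - psum (fun m => wt act s X m x v * u j (hb m x) (act m v)) n| @[j --> U] -->
      `|expR l * G x v - psum (fun m => wt act s X m x v * G (hb m x) (act m v)) n|.
    apply: cvg_norm; apply: cvgB; first by apply: cvgM; [exact: cvg_cst|exact: cG].
    have := csum _ (index_iota 1 n) (fun m => wt act s X m x v) (fun m => clamp01 (hb m x)) (fun m => act m v) (fun m => clamp01_in _).
    have E (g : R -> V -> R) : \sum_(m <- index_iota 1 n) wt act s X m x v * g (clamp01 (hb m x)) (act m v) =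
        psum (fun m => wt act s X m x v * g (hb m x) (act m v)) n.
      by rewrite /psum; apply: eq_big_nat => m /andP[m1 _]; rewrite clamp01_id// hb01.
    by rewrite (E G); under eq_fun => j do rewrite (E (u j)).
  have c2 : j.+1%:R^-1 + 12 * (Num.sqrt n%:R)^-1 @[j --> U] --> (0 + 12 * (Num.sqrt n%:R)^-1 : R).
    apply: cvgD; last exact: cvg_cst.
    exact: (cvg_trans (cvg_app _ sU) (@cvg_harmonic R)).
  have c3 := cvgB c2 c1; rewrite add0r in c3.
  rewrite -subr_ge0; apply: (cvgr_to_ge (c3 _)); apply: filterE => j.
  rewrite subr_ge0; have [k1 k2 k3] := hu j; have [[C hC] kd] := k3 x v hx.
  have D12 : dominated 12 (fun m => wt act s X m x v * u j (hb m x) (act m v)).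
    rewrite -[12]mulr1; apply: wtM_dom => // y w hy.
    by have /andP[h1 h2] := u01 j y w hy; rewrite ger0_norm.
  have := rsum_tail D12 n1; rewrite -/(Lr act s X (u j) x v) => t1.
  have -> : expR l * u j x v - psum (fun m => wt act s X m x v * u j (hb m x) (act m v)) n =
     - (Lr act s X (u j) x v - expR l * u j x v) + (Lr act s X (u j) x v - psum (fun m => wt act s X m x v * u j (hb m x) (act m v)) n) by ring.
  by apply: le_trans (ler_normD _ _) _; rewrite normrN; exact: lerD.
Qed.

Hypothesis act_trans : forall v w, exists l : seq nat,
  all (fun m => 1 <= m)%N l /\ foldl (fun v m => act m v) v l = w.

Definition stepc (m : nat) : R := 8 * ((size vs)%:R * 12) / wlow m.

(** The eigenvalue equation at (0, v) contains the term of digit m, with the value of G at 1 / m in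
    the next coset; [kcone_ge8] moves that value back to 0. *)
Lemma step_bound s X l G v m : near10 s X -> expR l <= (size vs)%:R * 12 ->
  (forall v, kcone s (G ^~ v)) -> (forall x v, 0 <= x <= 1 -> 0 <= G x v <= 1) ->
  (forall x v, 0 <= x <= 1 -> Lr act s X G x v = expR l * G x v) -> (1 <= m)%N ->
  G 0 (act m v) <= stepc m * G 0 v.
Proof.
move=> ok lb hk h01 heq m1; have hs : 7 / 8 <= s <= 9 / 8 by case: ok.
have hh := hb01 m1 z01.
have g8 := kcone_ge8 hs (hk (act m v)) hh.
have D : dominated (12 * 1) (fun m => wt act s X m 0 v * G (hb m 0) (act m v)).
  by apply: wtM_dom => // y w hy; have /andP[? ?] := h01 y w hy; rewrite ger0_norm.
have t : wt act s X m 0 v * G (hb m 0) (act m v) <= expR l * G 0 v.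
  rewrite -(heq 0 v z01); apply: (term_le_rsum D) => // k k1.
  apply: mulr_ge0; first exact: ltW (wt_gt0 _ _ _ _ _ _).
  by have /andP[] := h01 (hb k 0) (act k v) (hb01 k1 z01).
have wl := wt_low v ok m1 z01.
have w0 : 0 < wlow m by exact: expR_gt0.
have /andP[g0 _] := h01 0 v z01; have /andP[gm0 _] := h01 (hb m 0) (act m v) hh.
have t2 : wlow m * G (hb m 0) (act m v) <= (size vs)%:R * 12 * G 0 v.
  by apply: le_trans (ler_wpM2r gm0 wl) _; apply: le_trans t _; exact: ler_wpM2r.
apply: le_trans g8 _; rewrite /stepc mulrAC ler_pdivlMr//; lra.
Qed.

Lemma chain_bound (l : seq nat) : exists C : R, forall s X (r : R) G v, near10 s X -> expR r <= (size vs)%:R * 12 ->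
  (forall v, kcone s (G ^~ v)) -> (forall x v, 0 <= x <= 1 -> 0 <= G x v <= 1) ->
  (forall x v, 0 <= x <= 1 -> Lr act s X G x v = expR r * G x v) -> all (fun m => 1 <= m)%N l ->
  G 0 (foldl (fun v m => act m v) v l) <= C * G 0 v.
Proof.
elim: l => [|m l [C hC]].
  by exists 1 => s X r G v *; rewrite mul1r.
exists (`|C| * stepc m) => s X r G v ok lb hk h01 heq /= /andP[m1 al].
apply: le_trans (hC s X r G (act m v) ok lb hk h01 heq al) _.
have /andP[g0 _] := h01 0 (act m v) z01.
apply: (@le_trans _ _ (`|C| * G 0 (act m v))); first by rewrite ler_wpM2r// ler_norm.
by rewrite -mulrA ler_wpM2l//; exact: (step_bound v ok lb hk h01 heq m1).
Qed.

(** The digit words joining the finitely many pairs of cosets are fixed before s and X, so one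
    constant serves all parameters. *)
Lemma uniform_harnack : exists2 C : R, 0 < C & forall s X (r : R) G v w, near10 s X -> expR r <= (size vs)%:R * 12 ->
  (forall v, kcone s (G ^~ v)) -> (forall x v, 0 <= x <= 1 -> 0 <= G x v <= 1) ->
  (forall x v, 0 <= x <= 1 -> Lr act s X G x v = expR r * G x v) -> G 0 w <= C * G 0 v.
Proof.
have /choice[c hc] : forall p : V * V, exists c : R, forall s X (r : R) G, near10 s X -> expR r <= (size vs)%:R * 12 ->
  (forall v, kcone s (G ^~ v)) -> (forall x v, 0 <= x <= 1 -> 0 <= G x v <= 1) ->
  (forall x v, 0 <= x <= 1 -> Lr act s X G x v = expR r * G x v) -> G 0 p.2 <= c * G 0 p.1.
  move=> [v w].
  have [l [al <-]] := act_trans v w; have [C hC] := chain_bound l.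
  by exists C => s X r G ok lb hk h01 heq; exact: hC ok lb hk h01 heq al.
pose C := 1 + \sum_(v <- vs) \sum_(w <- vs) `|c (v, w)|.
have pos : 0 <= \sum_(v <- vs) \sum_(w <- vs) `|c (v, w)|.
  by apply: sumr_ge0 => v _; apply: sumr_ge0.
exists C; first by rewrite /C; lra.
move=> s X r G v w ok lb hk h01 heq; have /= h := hc (v, w) s X r G ok lb hk h01 heq.
apply: le_trans h _; have /andP[g0 _] := h01 0 v z01.
rewrite ler_wpM2r//; apply: le_trans (ler_norm _) _.
apply: (@le_trans _ _ (\sum_(v <- vs) \sum_(w <- vs) `|c (v, w)|)); last by rewrite /C; lra.
rewrite (big_rem v) ?vs_all//= (big_rem w) ?vs_all//= -addrA lerDl.
by apply: addr_ge0; apply: sumr_ge0 => ? _ //; apply: sumr_ge0.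
Qed.

Theorem eigenfunction : exists2 C : R, 0 < C & forall s X, near10 s X ->
  exists r G, [/\ 0 < r, forall v, kcone s (G ^~ v),
    forall x v, 0 <= x <= 1 -> C <= G x v <= 1 &
    forall x v, 0 <= x <= 1 -> Lr act s X G x v = r * G x v].
Proof.
have [H H0 hH] := uniform_harnack.
have n0 : 0 < (size vs)%:R :> R.
  by rewrite ltr0n lt0n size_eq0; apply/negP => /eqP e; have := vs_all v0; rewrite e.
exists ((8 * (H * (size vs)%:R))^-1); first by rewrite invr_gt0 !mulr_gt0.
move=> s X ok; have hs : 7 / 8 <= s <= 9 / 8 by case: ok.
have [r [rb [G [k1 k2 k3 k4]]]] := exact_eigen ok.
exists (expR r), G; split; [exact: expR_gt0|exact: k1| |exact: k4] => x v hx.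
have /andP[_ ->] := k3 x v hx; rewrite andbT.
(* The values at 0 add up to 1, and each of them is at most [H * G 0 v]. *)
have g0 : 1 <= H * (size vs)%:R * G 0 v.
  rewrite -[leLHS]k2; apply: (@le_trans _ _ (\sum_(w <- vs) H * G 0 v)).
    by apply: ler_sum => w _; exact: hH ok rb k1 k3 k4.
  by rewrite big_const_seq count_predT iter_addr_0 -[X in X <= _]mulr_natr mulrAC.
have g8 := kcone_ge8 hs (k1 v) hx.
have : 1 <= G x v * (8 * (H * (size vs)%:R)).
  apply: le_trans g0 _.
  have : H * (size vs)%:R * G 0 v <= H * (size vs)%:R * (8 * G x v) by rewrite ler_wpM2l// mulr_ge0 ?ltW.
  lra.
rewrite -div1r ler_pdivrMr// !mulr_gt0//.
Qed.

End Eigen.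

(** * Parameters near (1, 0) *)

Section Pressure.
Variables (R : realType) (V : eqType) (act : nat -> V -> V).
Local Notation hb := (@hb R).
Implicit Types (x y s e : R) (v w : V) (X : V -> R).

Lemma rsum_telescope_le C (a f : nat -> R) : dominated C a ->
  (forall m, (1 <= m)%N -> a m <= f m - f m.+1) -> (forall m, (1 <= m)%N -> 0 <= f m) ->
  rsum a <= f 1%N.
Proof.
move=> Da H f0; apply: (cvgr_to_le (cvg_psum Da)); exists 1%N => // n /= n1.
suff h : psum a n <= f 1%N - f n by apply: le_trans h _; rewrite gerBl f0.
elim: n n1 => // -[|n] IH _; first by rewrite /psum big_geq// subrr.
by rewrite psumS//; have := IH isT; have := H n.+1 isT; lra.
Qed.

Lemma rsum_telescope_ge C (a f : nat -> R) (K : R) : dominated C a ->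
  (forall m, (1 <= m)%N -> f m - f m.+1 <= a m) ->
  (forall m, (1 <= m)%N -> f m <= K / m%:R) -> f 1%N <= rsum a.
Proof.
move=> Da H fK; rewrite -subr_ge0.
have c : psum a n.+1 - (f 1%N - K * n.+1%:R^-1) @[n --> \oo] --> rsum a - (f 1%N - K * 0).
  apply: cvgB; first by rewrite (cvg_shiftS (psum a)); exact: cvg_psum Da.
  apply: cvgB; first exact: cvg_cst.
  by apply: cvgM; [exact: cvg_cst|exact: cvg_harmonic].
rewrite mulr0 subr0 in c; apply: (cvgr_to_ge c); apply: nearW => n.
have : f 1%N - f n.+1 <= psum a n.+1.
  elim: n => [|n IH]; first by rewrite /psum big_geq// subrr.
  by rewrite psumS//; have := H n.+1 isT; lra.
by have := fK n.+1 isT; move: (K / _) (f n.+1) => A B; lra.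
Qed.

Definition expsqrt (y : R) := expR (ln y / 2).

Lemma expsqrt_ge1 y : 1 <= y -> 1 <= expsqrt y.
Proof. by move=> y1; apply: expR_ge1; rewrite divr_ge0// ln_ge0. Qed.

Lemma expsqrt_sqr y : 0 < y -> expsqrt y * expsqrt y = y.
Proof.
move=> y0; rewrite /expsqrt -expRD (_ : ln y / 2 + ln y / 2 = ln y) ?lnK//; by field.
Qed.

Lemma expsqrt_le y z : 0 < y -> y <= z -> expsqrt y <= expsqrt z.
Proof. by move=> y0 yz; rewrite ler_expR ler_wpM2r// ler_ln ?posrE//; lra. Qed.

Lemma expsqrt_telescope y : 1 <= y -> expsqrt y / (y * (y + 1)) <= 2 * ((expsqrt y)^-1 - (expsqrt (y + 1))^-1).
Proof.
move=> y1; have y0 : 0 < y by lra.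
have q1 := expsqrt_ge1 y1; have h1 := expsqrt_sqr y0.
have y0' : 0 < y + 1 by lra.
have h2 := expsqrt_sqr y0'; have ab := expsqrt_le y0 (ltac:(lra) : y <= y + 1).
have p1 : 0 < expsqrt y by lra.
have p2 : 0 < expsqrt (y + 1) by lra.
move: (expsqrt y) (expsqrt (y + 1)) q1 h1 h2 ab p1 p2 => a b q1 h1 h2 ab p1 p2.
have -> : a / (y * (y + 1)) = (a * b ^+ 2)^-1.
  by rewrite -h2 -h1; field; rewrite !gt_eqF.
have e : (b - a) * (b + a) = 1.
  have -> : (b - a) * (b + a) = b * b - a * a by ring.
  by rewrite h1 h2; lra.
have -> : 2 * (a^-1 - b^-1) = 2 * (b - a) * b * (a * b ^+ 2)^-1.
  by field; rewrite !gt_eqF.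
have i0 : 0 <= (a * b ^+ 2)^-1.
  by rewrite invr_ge0; apply: mulr_ge0; [exact: ltW|apply: exprn_ge0; exact: ltW].
apply: ler_peMl => //; rewrite -[leLHS]e.
have : (b - a) * (b + a) <= (b - a) * (2 * b) by rewrite ler_wpM2l; lra.
lra.
Qed.

(** By convexity y^{4 e} - 1 <= 8 e (sqrt y - 1): the error is proportional to e, and sqrt y / y^2
    is still summable. *)
Lemma pow_small e y a : 0 < e <= 1 / 8 -> 1 <= y -> a <= 4 * e -> expR (a * ln y) <= 1 + 8 * e * expsqrt y.
Proof.
move=> /andP[e0 e1] y1 ae; have l0 : 0 <= ln y by rewrite ln_ge0.
have c1 : 1 <= (8 * e)^-1 by rewrite invf_ge1; lra.
have z0 : 0 <= 4 * e * ln y by rewrite mulr_ge0//; lra.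
have h := expR_sub1_scale c1 z0.
have e2 : (8 * e)^-1 * (4 * e * ln y) = ln y / 2 by field; rewrite gt_eqF//; lra.
rewrite e2 -/(expsqrt y) ler_pdivrMl in h; last by lra.
have : expR (a * ln y) <= expR (4 * e * ln y) by rewrite ler_expR ler_wpM2r.
nra.
Qed.

Let near_eps e s X : 0 < e <= 1 / 8 -> `|s - 1| <= e -> (forall v, `|X v| <= e) -> near10 s X.
Proof.
move=> /andP[e0 e1]; rewrite ler_norml => /andP[h1 h2] hX; split; first by lra.
by move=> v; apply: le_trans (hX v) _; lra.
Qed.

(** At s = 1 and X = 0 the terms are 1 / ((m + x) (m + x + 1)); they telescope to 1 / (1 + x), which
    gives the value 1. A second telescoping series bounds the perturbation. *)
Lemma square_bound_eps e s X : 0 < e <= 1 / 8 -> `|s - 1| <= e -> (forall v, `|X v| <= e) ->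
  square_bound act s X (expR (2 * e) * (1 + 32 * e)).
Proof.
move=> he hs hX x v hx; have ok := near_eps he hs hX.
have [e0 e1] := andP he; have [x0 x1] := andP hx.
have hs1 : 4 * (1 - s) <= 4 * e by move: hs; rewrite ler_norml => /andP[? ?]; lra.
have D := dominatedZ (1 + x) (wt_sqr_dom act ok v hx).
rewrite -(rsumZ _ (wt_sqr_dom act ok v hx)).
pose f m := expR (2 * e) * (1 + x) * ((m%:R + x)^-1 + 16 * e * (expsqrt (m%:R + x))^-1).
apply: (@le_trans _ _ (f 1%N)).
  apply: (rsum_telescope_le D) => m m1; last first.
    have mR : 0 <= m%:R :> R by [].
    apply: mulr_ge0; first by rewrite mulr_ge0 ?expR_ge0//; lra.
    apply: addr_ge0; first by rewrite invr_ge0; lra.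
    by rewrite !mulr_ge0 ?invr_ge0 ?expR_ge0//; lra.
  have m1R : 1 <= m%:R :> R by rewrite (ler_nat R 1).
  have -> : f m - f m.+1 = expR (2 * e) * (1 + x) * ((m%:R + x)^-1 - (m%:R + x + 1)^-1 +
      16 * e * ((expsqrt (m%:R + x))^-1 - (expsqrt (m%:R + x + 1))^-1)).
    by rewrite /f -(natr1 m) (_ : m%:R + 1 + x = m%:R + x + 1); ring.
  rewrite /cs_weight /wt (_ : hb m x = (m%:R + x)^-1)//= sub0r.
  set y := m%:R + x; have y1 : 1 <= y by rewrite /y; lra.
  have y0 : 0 < y by lra.
  have -> : expR (X (act m v) - 2 * s * ln y) ^+ 2 / (expR (- (2 * 1 * ln y)) * (1 + y^-1)) =
     expR (2 * X (act m v)) * expR (4 * (1 - s) * ln y) * (y * (y + 1))^-1.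
    have -> : expR (- (2 * 1 * ln y)) = (y ^+ 2)^-1.
      by rewrite expRN -mulrA mul1r expRM_natl lnK.
    have -> : expR (X (act m v) - 2 * s * ln y) ^+ 2 = expR (2 * X (act m v)) * expR (4 * (1 - s) * ln y) * (y ^+ 4)^-1.
      have -> : y ^+ 4 = expR (4%:R * ln y) by rewrite expRM_natl lnK.
      by rewrite -expRN -!expRD -expRM_natl; congr expR; ring.
    by field; rewrite !gt_eqF//; lra.
  have t1 := expsqrt_telescope y1; have t2 := pow_small he y1 hs1.
  have t3 : expR (2 * X (act m v)) <= expR (2 * e).
    by rewrite ler_expR ler_pM2l//; apply: le_trans (hX _); exact: ler_norm.
  have yy : 0 < (y * (y + 1))^-1 by rewrite invr_gt0 mulr_gt0//; lra.
  have -> : y^-1 - (y + 1)^-1 = (y * (y + 1))^-1 by field; rewrite !gt_eqF//; lra.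
  move: (expR _) (expR _) (expR (2 * e)) (expR_ge0 (2 * X (act m v))) (expR_ge0 (4 * (1 - s) * ln y)) t1 t2 t3.
  move: (expsqrt y) (_ - _) (y * (y + 1))^-1 yy => q d p p0 E2 E1 E3 E10 E20 t1 t2 t3.
  have -> : (1 + x) * (E1 * E2 * p) = (1 + x) * (E1 * (E2 * p)) by ring.
  have -> : E3 * (1 + x) * (p + 16 * e * d) = (1 + x) * (E3 * (p + 16 * e * d)) by ring.
  rewrite ler_wpM2l//; first by lra.
  apply: ler_pM => //; first by rewrite mulr_ge0// ltW.
  apply: (@le_trans _ _ ((1 + 8 * e * q) * p)); first by rewrite ler_pM2r.
  have : 8 * e * (q * p) <= 8 * e * (2 * d) by rewrite ler_pM2l//; lra.
  lra.
rewrite /f -mulrA ler_wpM2l ?expR_ge0// mulrDr divff ?gt_eqF//; last by lra.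
have q1 : 1 <= expsqrt (1 + x) by apply: expsqrt_ge1; lra.
have : (expsqrt (1 + x))^-1 <= 1 by rewrite invf_le1//; lra.
have : 0 < (expsqrt (1 + x))^-1 by rewrite invr_gt0; lra.
move: (expsqrt _)^-1 => q q0 q2; rewrite lerD2l.
have : (1 + x) * (16 * e * q) <= 2 * (16 * e * 1).
  by apply: ler_pM; rewrite ?ler_wpM2l ?mulr_ge0 ?(ltW q0)//; lra.
lra.
Qed.

Lemma Lr_gauss_low e s X x v : 0 < e <= 1 / 8 -> `|s - 1| <= e -> (forall v, `|X v| <= e) ->
  0 <= x <= 1 ->
  expR (- e) * (1 - 16 * e) <= (1 + x) * Lr act s X (fun y _ => (1 + y)^-1) x v.
Proof.
move=> he hs hX hx; have ok := near_eps he hs hX.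
have [e0 e1] := andP he; have [x0 x1] := andP hx.
have hs1 : 2 * (s - 1) <= 2 * e by move: hs; rewrite ler_norml => /andP[? ?]; lra.
have D0 : dominated (12 * 1) (fun m => wt act s X m x v * (fun y (_ : V) => (1 + y)^-1) (hb m x) (act m v)).
  apply: (@wtM_dom R V act s X (fun y _ => (1 + y)^-1) 1) => // y w /andP[y0 y1]; rewrite gtr0_norm ?invr_gt0; last by lra.
  by rewrite invf_le1; lra.
rewrite /Lr -(rsumZ _ D0); have D := dominatedZ (1 + x) D0.
pose f m := expR (- e) * (1 + x) * ((m%:R + x)^-1 - 8 * e * (expsqrt (m%:R + x))^-1).
apply: (@le_trans _ _ (f 1%N)).
  rewrite /f -mulrA ler_wpM2l ?expR_ge0// mulrBr divff ?gt_eqF//; last by lra.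
  have q1 : 1 <= expsqrt (1 + x) by apply: expsqrt_ge1; lra.
  have : (expsqrt (1 + x))^-1 <= 1 by rewrite invf_le1//; lra.
  have : 0 < (expsqrt (1 + x))^-1 by rewrite invr_gt0; lra.
  move: (expsqrt _)^-1 => q q0 q2.
  have : (1 + x) * (8 * e * q) <= 2 * (8 * e * 1).
    by apply: ler_pM; rewrite ?ler_wpM2l ?mulr_ge0 ?(ltW q0)//; lra.
  lra.
apply: (@rsum_telescope_ge _ _ f 2 D) => m m1; last first.
  have m1R : 1 <= m%:R :> R by rewrite (ler_nat R 1).
  have i1 : (m%:R + x)^-1 <= m%:R^-1 by rewrite lef_pV2 ?posrE; lra.
  have i0 : 0 < (m%:R + x)^-1 by rewrite invr_gt0; lra.
  have j0 : 0 <= 8 * e * (expsqrt (m%:R + x))^-1 by rewrite !mulr_ge0 ?invr_ge0 ?expR_ge0//; lra.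
  have E1 : expR (- e) <= 1 by rewrite -expR0 ler_expR; lra.
  have E0 := expR_ge0 (- e).
  apply: (@le_trans _ _ (expR (- e) * (1 + x) * m%:R^-1)).
    by rewrite /f ler_wpM2l ?mulr_ge0//; lra.
  by rewrite ler_wpM2r ?invr_ge0//; nra.
have m1R : 1 <= m%:R :> R by rewrite (ler_nat R 1).
have -> : f m - f m.+1 = expR (- e) * (1 + x) * ((m%:R + x)^-1 - (m%:R + x + 1)^-1 -
    8 * e * ((expsqrt (m%:R + x))^-1 - (expsqrt (m%:R + x + 1))^-1)).
  by rewrite /f -(natr1 m) (_ : m%:R + 1 + x = m%:R + x + 1); ring.
rewrite /wt (_ : hb m x = (m%:R + x)^-1)//.
set y := m%:R + x; have y1 : 1 <= y by rewrite /y; lra.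
have y0 : 0 < y by lra.
have -> : expR (X (act m v) - 2 * s * ln y) * (1 + y^-1)^-1 =
   expR (X (act m v)) * expR (- (2 * (s - 1) * ln y)) * (y * (y + 1))^-1.
  have -> : X (act m v) - 2 * s * ln y = X (act m v) + - (2 * (s - 1) * ln y) + - (2 * ln y) by ring.
  rewrite !expRD [expR (- (2 * ln y))]expRN expRM_natl lnK//.
  by field; rewrite !gt_eqF//; lra.
have t1 := expsqrt_telescope y1.
have t2 : expR (2 * (s - 1) * ln y) <= 1 + 4 * e * expsqrt y.
  have h2 : 0 < e / 2 <= 1 / 8 by lra.
  have h3 : 2 * (s - 1) <= 4 * (e / 2) by lra.
  by have := pow_small h2 y1 h3; rewrite (_ : 8 * (e / 2) = 4 * e)//; field.
have t2' : 1 - 4 * e * expsqrt y <= expR (- (2 * (s - 1) * ln y)).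
  have := expR_ge1Dx (- (2 * (s - 1) * ln y)).
  move: t2; have := expR_gt0 (2 * (s - 1) * ln y); rewrite expRN.
  move: (expR _) => E E0 h _.
  (* This yields 1 / E >= 2 - E, turning the upper bound on E into a lower bound on 1 / E. *)
  have : 0 <= (E - 1) ^+ 2 by exact: sqr_ge0.
  have EV : E * E^-1 = 1 by rewrite divff ?gt_eqF.
  have : 0 < E^-1 by rewrite invr_gt0.
  move: (E^-1) EV => F EV F0; nra.
have t3 : expR (- e) <= expR (X (act m v)).
  by rewrite ler_expR; have := hX (act m v); rewrite ler_norml => /andP[].
have yy : 0 < (y * (y + 1))^-1 by rewrite invr_gt0 mulr_gt0//; lra.
have -> : y^-1 - (y + 1)^-1 = (y * (y + 1))^-1 by field; rewrite !gt_eqF//; lra.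
move: (expR _) (expR _) (expR (- e)) (expR_ge0 (X (act m v))) (expR_ge0 (- (2 * (s - 1) * ln y))) (expR_ge0 (- e)) t1 t2' t3.
move: (expsqrt y) (_ - _) (y * (y + 1))^-1 yy => q d p p0 E2 E1 E3 E10 E20 E30 t1 t2' t3.
have -> : (1 + x) * (E1 * E2 * p) = (1 + x) * (E1 * (E2 * p)) by ring.
have -> : E3 * (1 + x) * (p - 8 * e * d) = (1 + x) * (E3 * (p - 8 * e * d)) by ring.
rewrite ler_wpM2l//; first by lra.
have h : 4 * e * (q * p) <= 4 * e * (2 * d) by rewrite ler_pM2l//; lra.
have h' : p - 8 * e * d <= (1 - 4 * e * q) * p by lra.
apply: (@le_trans _ _ (E3 * ((1 - 4 * e * q) * p))); first by rewrite ler_wpM2l.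
have [neg|pos] := leP (1 - 4 * e * q) 0.
  apply: (@le_trans _ _ 0); last by rewrite !mulr_ge0// ltW.
  by rewrite mulr_ge0_le0// mulr_le0_ge0// ltW.
apply: ler_pM => //; last by rewrite ler_pM2r.
by rewrite mulr_ge0 ?(ltW p0) ?(ltW pos).
Qed.

(* Compare G with t / (1 + x), for t the infimum of (1 + x) G: 1 / (1 + x) is the
   eigenfunction at the parameter 1. *)
Lemma eigen_low e s X r (G : R -> V -> R) C b (v0 : V) : 0 < e <= 1 / 8 -> `|s - 1| <= e ->
  (forall v, `|X v| <= e) -> 0 < C -> 0 < r -> loglip b G ->
  (forall x v, 0 <= x <= 1 -> C <= G x v) ->
  (forall x v, 0 <= x <= 1 -> Lr act s X G x v = r * G x v) ->
  expR (- e) * (1 - 16 * e) <= r.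
Proof.
move=> he hs hX C0 r0 lG GC eG; have ok := near_eps he hs hX.
pose S := [set z | exists x v, 0 <= x <= 1 /\ z = (1 + x) * G x v].
have S0 : S !=set0 by exists ((1 + 0) * G 0 v0); exists 0, v0; rewrite lexx ler01.
have Slb : lbound S C.
  move=> _ [x [v [/andP[x0 x1] ->]]]; have := GC x v (ltac:(by rewrite x0)).
  by nra.
have Sinf : has_inf S by split=> //; exists C.
pose t := inf S; have tC : C <= t by apply: lb_le_inf.
have t0 : 0 < t by lra.
have tG x v : 0 <= x <= 1 -> t * (1 + x)^-1 <= G x v.
  move=> hx; rewrite ler_pdivrMr; last by lra.
  by rewrite mulrC; apply: ge_inf; [case: Sinf|exists x, v].
have lg : loglip 1 (fun y (_ : V) => (1 + y)^-1 : R).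
  split.
  - by move=> x v hx; rewrite invr_gt0; lra.
  - move=> x y v hx hy; rewrite -[(1 + x)^-1]lnK ?posrE ?invr_gt0; last by lra.
    rewrite -[(1 + y)^-1]lnK ?posrE ?invr_gt0; last by lra.
    rewrite -expRD ler_expR !lnV ?posrE; [|lra|lra].
    by rewrite mul1r /DD; have := ler_norm (ln (1 + y) - ln (1 + x)); rewrite distrC; lra.
  - exists 1 => x v hx; rewrite invf_le1; lra.
have ltg := loglip_scale t0 lg.
have key x v : 0 <= x <= 1 -> t * (expR (- e) * (1 - 16 * e)) <= r * ((1 + x) * G x v).
  move=> hx; rewrite [leRHS]mulrCA -(eG x v hx).
  have h1 := Lr_mono act v ok ltg lG hx (fun y w hy => tG y w hy).
  rewrite (Lr_scale act v t ok lg hx) in h1.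
  have h2 := Lr_gauss_low v he hs hX hx.
  have : (1 + x) * (t * Lr act s X (fun y _ => (1 + y)^-1) x v) <= (1 + x) * Lr act s X G x v by rewrite ler_wpM2l//; lra.
  by move/(le_trans _); apply; rewrite [leRHS]mulrCA ler_pM2l.
(* The quotient is again a lower bound of S, hence at most its infimum t. *)
have : t * (expR (- e) * (1 - 16 * e)) / r <= t.
  by apply: lb_le_inf => // _ [x [v [hx ->]]]; rewrite ler_pdivrMr// [leRHS]mulrC; exact: key.
by rewrite -mulrA ger_pMr// ler_pdivrMr// mul1r.
Qed.

End Pressure.

(** * Interpolation *)

Section Contraction.
Variables (R : realType) (V : eqType) (act : nat -> V -> V) (vs : seq V).
Local Notation hb := (@hb R).
Local Notation normc := (@Normc.normc R).
Implicit Types (x y s t b A : R) (v w : V) (u : R -> V -> R) (X Y : V -> R).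

Lemma Lr_ext s X u (u2 : R -> V -> R) x v : 0 <= x <= 1 ->
  (forall y v, 0 <= y <= 1 -> u y v = u2 y v) -> Lr act s X u x v = Lr act s X u2 x v.
Proof.
move=> hx H; rewrite /Lr /rsum; congr (lim (_ @ \oo)); apply/funext => n.
by rewrite /psum; apply: eq_big_nat => m /andP[m1 _]; rewrite H//; exact: hb01.
Qed.

Lemma majorized_cst b psi u S : 0 <= b -> majorized b psi u ->
  (forall x v, 0 <= x <= 1 -> u x v <= S) -> majorized b psi (fun _ _ => S).
Proof.
move=> b0 [h1 h2] uS; split=> [x v hx|x y v hx hy]; first exact: le_trans (h1 x v hx) (uS x v hx).
apply: le_trans (h2 x y v hx hy) _; apply: ler_wpM2l; last exact: uS.
by rewrite subr_ge0 expR_ge1// mulr_ge0// DD_ge0.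
Qed.

Definition eigen_data (C s : R) X (r : R) (G : R -> V -> R) :=
  [/\ 0 < r, forall v, kcone s (G ^~ v),
    forall x v, 0 <= x <= 1 -> C <= G x v <= 1 &
    forall x v, 0 <= x <= 1 -> Lr act s X G x v = r * G x v].

Definition close_to (e s : R) X := `|s - 1| <= e /\ forall v, `|X v| <= e.

Lemma close_near10 e s X : e <= 1 / 8 -> close_to e s X -> near10 s X.
Proof.
move=> e1 [+ hX]; rewrite ler_norml => /andP[h1 h2]; split; first by lra.
by move=> v; apply: le_trans (hX v) _; lra.
Qed.

Lemma eigen_loglip C s X r G : 0 < C -> near10 s X -> eigen_data C s X r G -> loglip 3 G.
Proof.
move=> C0 [hs _] [_ hk hG _]; split.
- by move=> x v hx; have /andP[h _] := hG x v hx; exact: lt_le_trans h.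
- by move=> x y v hx hy; exact: (kcone_loglip hs (hk v) hx hy).
- by exists 1 => x v hx; have /andP[] := hG x v hx.
Qed.

Lemma iter_eigen C s X r G (k : R) n x v : 0 < C -> 0 < k -> near10 s X -> eigen_data C s X r G ->
  0 <= x <= 1 -> iter n (Lr act s X) (fun y w => k * G y w) x v = k * r ^+ n * G x v.
Proof.
move=> C0 k0 ok ed; have lG := eigen_loglip C0 ok ed; have [r0 _ _ eG] := ed.
elim: n x v => [|n IH] x v hx; first by rewrite expr0 mulr1.
rewrite iterS (Lr_ext _ _ _ hx IH) (Lr_scale act _ _ ok lG hx) eG// exprS; ring.
Qed.

Hypotheses (vs_uniq : uniq vs) (vs_all : forall v, v \in vs) (v0 : V).
Hypothesis act_inj : forall m, injective (act m).

Lemma plain_bound C K s t X Y r G psi N : 0 < C -> 0 < K -> near10 s X -> 4 <= `|t| ->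
  eigen_data C s X r G -> majorized (20 * `|t|) psi (fun _ _ => K) ->
  majorized (20 * `|t|) (iter N (Lc act s X t Y) psi) (fun _ _ => K / C * r ^+ N).
Proof.
move=> C0 K0 ok t4 ed hm; have lG := eigen_loglip C0 ok ed; have [r0 _ hG _] := ed.
have b0 : 0 <= 20 * `|t| by lra.
have k0 : 0 < K / C by exact: divr_gt0.
have l1 : loglip (20 * `|t|) (fun y w => K / C * G y w).
  by apply: loglip_scale => //; apply: loglipW lG; lra.
have KG x v : 0 <= x <= 1 -> K <= K / C * G x v.
  by move=> hx; have /andP[h _] := hG x v hx; rewrite mulrAC ler_pdivlMr// ler_pM2l.
have m1 : majorized (20 * `|t|) psi (fun y w => K / C * G y w).
  case: hm => h1 h2; split=> [x v hx|x y v hx hy]; first by apply: le_trans (h1 x v hx) _; exact: KG.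
  apply: le_trans (h2 x y v hx hy) _; apply: ler_wpM2l; last exact: KG.
  by rewrite subr_ge0 expR_ge1// mulr_ge0// DD_ge0.
have [_ m2] := plain_iter act Y N ok t4 l1 m1.
apply: (majorized_cst b0 m2) => x v hx; rewrite (iter_eigen _ _ C0 k0 ok ed hx).
have /andP[_ h] := hG x v hx; rewrite ler_piMr// mulr_ge0 ?exprn_ge0//; exact: ltW.
Qed.

Lemma pow2_between (y : R) : 1 <= y -> exists n, y <= 2 ^+ n <= 2 * y.
Proof.
move=> y1; have ex : exists n, y <= 2 ^+ n.
  exists (Num.bound y); have y0 : 0 <= y by lra.
  apply: le_trans (ltW (archi_boundP y0)) _.
  by rewrite -natrX ler_nat ltnW// ltn_expl.
exists (ex_minn ex); case: ex_minnP => n h1 h2; rewrite h1/=.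
case: n h1 h2 => [|n] h1 h2; first by rewrite expr0; lra.
rewrite exprS ler_pM2l// leNgt; apply/negP => h; have := h2 n (ltW h); by rewrite ltnn.
Qed.

Lemma expR_le2 (z : R) : 0 <= z <= 1 / 2 -> expR z <= 1 + 2 * z.
Proof. by move=> hz; have := @expR_small R z; rewrite -div1r => /(_ hz); lra. Qed.

(** With e <= c / 200 the loss A - 1 is at most half the saving c, and the eigenvalue is at least 1
    - c / 8; a net decrease survives division by its square. *)
Lemma pressure_consts (c e : R) : 0 < c <= 1 / 4 -> 0 < e <= c / 200 ->
  [/\ 1 <= expR (2 * e) * (1 + 32 * e) , expR (2 * e) * (1 + 32 * e) <= 1 + c / 2 &
      1 - c / 8 <= expR (- e) * (1 - 16 * e)].
Proof.
move=> /andP[c0 c1] /andP[e0 e1].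
have h1 : expR (2 * e) <= 1 + 2 * (2 * e) by apply: expR_le2; lra.
have h2 : 1 <= expR (2 * e) by apply: expR_ge1; lra.
have h3 := expR_ge1Dx (- e).
have ee : e * e <= e / 8 by rewrite ler_pM2l; lra.
have e20 : 0 < e * e by rewrite mulr_gt0.
split.
- have : 1 * 1 <= expR (2 * e) * (1 + 32 * e) by apply: ler_pM; lra.
  lra.
- have : expR (2 * e) * (1 + 32 * e) <= (1 + 2 * (2 * e)) * (1 + 32 * e) by rewrite ler_wpM2r//; lra.
  lra.
- have : (1 + - e) * (1 - 16 * e) <= expR (- e) * (1 - 16 * e) by rewrite ler_wpM2r//; lra.
  lra.
Qed.

Hypothesis act_trans : forall v w, exists l : seq nat,
  all (fun m => 1 <= m)%N l /\ foldl (fun v m => act m v) v l = w.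

(** The n smoothing steps bring no saving. Since A <= 2 (1 - c / 2), they are charged as 2^n,
    comparable to |t|, and all N steps then show the same rate. *)
Lemma mixed_rate (A c : R) n N : (n <= N)%N -> 0 < c <= 1 / 4 -> 1 <= A <= 1 + c / 2 ->
  A ^+ n * (A - c) ^+ (N - n) <= 2 ^+ n * (1 - c / 2) ^+ N.
Proof.
move=> nN hc hA; have -> : 2 ^+ n * (1 - c / 2) ^+ N = (2 * (1 - c / 2)) ^+ n * (1 - c / 2) ^+ (N - n).
  by rewrite exprMn -[in LHS](subnKC nN) exprD; ring.
have h1 : 0 <= A by lra.
have h2 : 0 <= A - c by lra.
have h3 : A <= 2 * (1 - c / 2) by lra.
have h4 : A - c <= 1 - c / 2 by lra.
by apply: ler_pM; rewrite ?exprn_ge0// ?lerXn2r// nnegrE (le_trans _ h3, le_trans _ h4).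
Qed.

(** The majorants have been estimated through their squares, so r enters squared: r^2 >= (1 - c /
    8)^2 >= 1 - c / 4. *)
Lemma normalized_rate (c r : R) N : 0 < c <= 1 / 4 -> 1 - c / 8 <= r ->
  (1 - c / 2) ^+ N <= ((1 - c / 2) / (1 - c / 4)) ^+ N * (r ^+ N) ^+ 2.
Proof.
move=> hc hr; rewrite exprAC -exprMn.
have h1 : 0 <= 1 - c / 2 by lra.
have h2 : 0 < 1 - c / 4 by lra.
suff h : 1 - c / 2 <= (1 - c / 2) / (1 - c / 4) * r ^+ 2.
  by apply: lerXn2r; rewrite ?nnegrE// (le_trans h1).
rewrite mulrAC ler_pdivlMr// ler_wpM2l//.
have : (1 - c / 8) ^+ 2 <= r ^+ 2 by apply: lerXn2r; rewrite ?nnegrE; lra.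
by apply: le_trans; rewrite expr2; have := sqr_ge0 c; rewrite expr2; lra.
Qed.

Lemma decay_bound (A c th Q K s t r : R) X Y psi (M N : nat) :
  0 < c <= 1 / 4 -> c = cgap R M / 4 -> 80 * 100 <= M%:R :> R ->
  1 <= A <= 1 + c / 2 -> square_bound act s X A -> near10 s X -> 4 <= `|t| ->
  th = (1 - c / 2) / (1 - c / 4) -> 1 - c / 8 <= r ->
  Q = 1 + 2 * (expR (40 + 7) * ((size vs)%:R * (2 * K ^+ 2))) -> 
  0 < K -> majorized (20 * `|t|) psi (fun _ _ => K) -> `|t| * th ^+ N < 1 ->
  majorized (20 * `|t|) (iter N (Lc act s X t Y) psi)
    (fun _ _ => Q * expR ((ln `|t| + N%:R * ln th) / 2) * r ^+ N).
Proof.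
move=> /andP[c0 c1] cM M1 /andP[A1 A2] sq ok t4 thE hr QE K0 hm small.
have a0 : 0 <= 1 - c / 2 by lra.
have b0 : 0 <= 20 * `|t| by lra.
have t0 : 0 < `|t| by lra.
have th0 : 1 / 2 <= th by rewrite thE ler_pdivlMr; lra.
have [n /andP[n1 n2]] := pow2_between (ltac:(lra) : 1 <= `|t|).
(* Otherwise 2^N <= |t|, and th >= 1 / 2 would give |t| th^N >= 1. *)
have nN : (n <= N)%N.
  rewrite leqNgt; apply/negP => Nn; move: small; apply/negP; rewrite -leNgt.
  have h2 : (1 / 2) ^+ N <= th ^+ N by apply: lerXn2r; rewrite ?nnegrE//; lra.
  have h3 : 2 ^+ N <= `|t|.
    have : 2 ^+ N.+1 <= 2 ^+ n :> R by rewrite ler_weXn2l//; lra.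
    by rewrite exprS; lra.
  have -> : 1 = 2 ^+ N * (1 / 2) ^+ N :> R by rewrite -exprMn (_ : 2 * (1 / 2) = 1 :> R) ?expr1n//; field.
  by apply: ler_pM => //; rewrite exprn_ge0.
have [u [u1 u2 u3]] := dolgopyat_long vs_uniq vs_all act_inj Y (N - n) ok t4 A1 M1 sq K0 n1 hm.
rewrite subnKC// in u2.
set P := expR (40 + 7) * _ in u3 QE.
have P0 : 0 <= P by rewrite mulr_ge0 ?expR_ge0// mulr_ge0// mulr_ge0// exprn_ge0// ltW.
have r0 : 0 < r by lra.
have rN : 0 < r ^+ N by exact: exprn_gt0.
apply: (majorized_cst b0 u2) => x v hx.
have U0 : 0 < u x v by case: u1 => h _ _; exact: h.
rewrite -(@ler_pXn2r _ 2)// ?nnegrE ?(ltW U0) ?mulr_ge0 ?(ltW E0) ?(ltW rN)//; last by lra.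
apply: le_trans (u3 x v hx) _.
have e1 : expR ((ln `|t| + N%:R * ln th) / 2) ^+ 2 = `|t| * th ^+ N.
  rewrite -expRM_natl (_ : 2%:R * ((ln `|t| + N%:R * ln th) / 2) = ln `|t| + N%:R * ln th); last by field.
  by rewrite expRD lnK ?posrE// expRM_natl lnK// posrE; lra.
rewrite 2!exprMn e1.
have d0 : A - cgap R M / 4 = A - c by rewrite cM.
have hA : A ^+ n * (A - cgap R M / 4) ^+ (N - n) <= 2 * `|t| * (1 - c / 2) ^+ N.
  rewrite d0; apply: (le_trans (mixed_rate nN _ _)); [by rewrite c0|by rewrite A1|].
  by rewrite ler_wpM2r// exprn_ge0.
have hth : (1 - c / 2) ^+ N <= th ^+ N * (r ^+ N) ^+ 2.
  by rewrite thE; apply: normalized_rate => //; rewrite c0.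
apply: (@le_trans _ _ (2 * `|t| * (th ^+ N * (r ^+ N) ^+ 2) * P)).
  apply: ler_wpM2r => //; apply: le_trans hA _; rewrite ler_wpM2l//; lra.
have -> : 2 * `|t| * (th ^+ N * (r ^+ N) ^+ 2) * P = 2 * P * (`|t| * th ^+ N * (r ^+ N) ^+ 2) by ring.
have -> : Q ^+ 2 * (`|t| * th ^+ N) * r ^+ N ^+ 2 = Q ^+ 2 * (`|t| * th ^+ N * (r ^+ N) ^+ 2) by ring.
apply: ler_wpM2r; first by rewrite !mulr_ge0 ?exprn_ge0 ?(ltW r0)//; lra.
(* From Q >= 1 and Q >= 2 P follows Q^2 >= 2 P: Q replaces a square root of 2 P. *)
have : Q * 1 <= Q * Q by rewrite ler_pM2l; lra.
rewrite expr2; lra.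
Qed.

(* With z = ln (|t| th^n), both the bounds 1 and e^{z / 2} are at most e^{xi z},
   the former for z >= 0 and the latter for z < 0. *)
Theorem contraction (K : R) : 0 < K -> exists e C : R, [/\ 0 < e <= 1 / 8, 0 < C,
  forall s X, close_to e s X -> exists r G, eigen_data C s X r G &
  forall xi : R, 0 < xi < 1 / 5 -> exists eta c : R, [/\ 0 < eta < 1, 0 < c &
    forall s X r G t Y psi N, close_to e s X -> eigen_data C s X r G -> 4 <= `|t| ->
      majorized (20 * `|t|) psi (fun _ _ => K) ->
      majorized (20 * `|t|) (iter N (Lc act s X t Y) psi)
        (fun _ _ => c * (eta ^+ N * r ^+ N * `|t| `^ xi))]].
Proof.
move=> K0; have [C C0 hC] := eigenfunction R vs_all v0 act_trans.
have [M Mpos M1] : exists2 M, (0 < M)%N & 80 * 100 <= M%:R :> R.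
  have h : 0 <= 80 * 100 :> R by rewrite mulr_ge0.
  exists (Num.bound (80 * 100 : R)).+1 => //.
  by apply: le_trans (ltW (archi_boundP h)) _; rewrite ler_nat.
have [c1 c1E] : exists c1, c1 = cgap R M / 4 by exists (cgap R M / 4).
have hc1 : 0 < c1 <= 1 / 4.
  have h1 : 0 < cgap R M by exact: cgap_gt0 Mpos.
  have h2 : cgap R M <= 1 by exact: cgap_le1 Mpos.
  by rewrite c1E; lra.
pose e := c1 / 200.
have he : 0 < e <= 1 / 8 by rewrite /e; lra.
have e18 : e <= 1 / 8 by case/andP: he.
have [p1 p2 p3] := pressure_consts hc1 (ltac:(rewrite /e; lra) : 0 < e <= c1 / 200).
exists e, C; split=> //.
  by move=> s X cl; have [r [G [g1 g2 g3 g4]]] := hC s X (close_near10 e18 cl); exists r, G.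
move=> xi hxi.
pose th := (1 - c1 / 2) / (1 - c1 / 4).
have th0 : 0 < th by rewrite divr_gt0; lra.
have th1 : th < 1 by rewrite ltr_pdivrMr; lra.
have lth : ln th < 0 by apply: ln_lt0; rewrite th0.
pose Q := 1 + 2 * (expR (40 + 7) * ((size vs)%:R * (2 * K ^+ 2))).
have Q0 : 0 < Q.
  have : 0 <= 2 * (expR (40 + 7) * ((size vs)%:R * (2 * K ^+ 2))).
    by rewrite !mulr_ge0 ?expR_ge0 ?sqr_ge0 ?(ltW K0).
  by rewrite /Q; move: (2 * _) => z; lra.
have kc0 : 0 < K / C by exact: divr_gt0.
(* This is eta = th^xi, so that eta^N |t|^xi = e^{xi z}. *)
exists (expR (xi * ln th)), (Q + K / C); split.
- by rewrite expR_gt0 -[ltRHS]expR0 ltr_expR nmulr_llt0//; lra.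
- exact: addr_gt0.
move=> s X r G t Y psi N cl ed t4 hm.
have ok : near10 s X by exact: close_near10 e18 cl.
have b0 : 0 <= 20 * `|t| by lra.
have t0 : 0 < `|t| by lra.
have [cl1 cl2] := cl; have [r0 _ hG eG] := ed.
have rl : 1 - c1 / 8 <= r.
  apply: le_trans p3 _; apply: (eigen_low v0 he cl1 cl2 C0 r0 (eigen_loglip C0 ok ed) _ eG).
  by move=> x v hx; have /andP[] := hG x v hx.
pose z := ln `|t| + N%:R * ln th.
have -> : expR (xi * ln th) ^+ N * r ^+ N * `|t| `^ xi = expR (xi * z) * r ^+ N.
  rewrite /powR gt_eqF// mulrAC -expRM_natl -expRD; congr (expR _ * _); rewrite /z; ring.
have rN : 0 < r ^+ N by exact: exprn_gt0.
have [z0|z0] := leP 0 z.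
  apply: (majorized_cst b0 (plain_bound Y N C0 K0 ok t4 ed hm)) => x v hx.
  have E1 : 1 <= expR (xi * z) by apply: expR_ge1; rewrite mulr_ge0//; lra.
  rewrite mulrA ler_pM2r//.
  apply: (@le_trans _ _ ((Q + K / C) * 1)); first by lra.
  by rewrite ler_pM2l//; lra.
have sm : `|t| * th ^+ N < 1.
  have -> : `|t| * th ^+ N = expR z by rewrite /z expRD expRM_natl !lnK.
  by rewrite -[ltRHS]expR0 ltr_expR.
have hA : 1 <= expR (2 * e) * (1 + 32 * e) <= 1 + c1 / 2 by rewrite p1 p2.
apply: (majorized_cst b0 (decay_bound Y hc1 c1E M1 hA (square_bound_eps act he cl1 cl2) ok t4 erefl rl erefl K0 hm sm)) => x v hx.
rewrite -/Q -/z mulrA ler_pM2r//.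
have E1 : expR (z / 2) <= expR (xi * z) by rewrite ler_expR; nra.
apply: ler_pM => //; [exact: ltW|lra].
Qed.

End Contraction.

(** * Transitivity on the cosets *)

Section Generation.
Implicit Types (a b c d k : int).

(** Column swaps and column additions run the Euclidean algorithm on the top row. Division with
    remainder decreases |b| until b = 0, where the matrix is lower triangular with diagonal entries
    1 or -1. *)
Lemma GL2Z_induction (Q : int -> int -> int -> int -> Prop) :
  (forall a b c d, Q b a d c -> Q a b c d) ->
  (forall a b c d, Q a (a + b) c (c + d) <-> Q a b c d) -> Q 1 0 0 1 ->
  forall a b c d, a * d - b * c \is a GRing.unit -> Q a b c d.
Proof.
move=> sw ad Q1.
have addn n a b c d : Q a (b + a *+ n) c (d + c *+ n) <-> Q a b c d.
  elim: n b d => [|n IH] b d; first by rewrite !mulr0n !addr0.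
  by rewrite !mulrS addrCA [d + _]addrCA ad.
have addz k a b c d : Q a (b + a * k) c (d + c * k) <-> Q a b c d.
  have e (x : int) (n : nat) : x * n%:Z = x *+ n by rewrite -mulr_natr natz.
  case: k => n; first by rewrite !e addn.
  by rewrite -(addn n.+1) NegzE !mulrN !e !subrK.
have addz' k a b c d : Q (a + b * k) b (c + d * k) d -> Q a b c d.
  by move=> /sw /addz /sw.
(* Changing the sign of a column is itself a product of column additions and a swap. *)
have neg a b c d : Q (- a) b (- c) d -> Q a b c d.
  move=> h; apply: (addz' 1); apply/(addz (-1)).
  apply: (addz' 1); apply: sw; move: h.
  by congr (Q _ _ _ _); ring.
have neg' a b c d : Q a (- b) c (- d) -> Q a b c d by move=> /sw /neg /sw.
have lower c : Q 1 0 c 1.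
  by apply: (addz' (- c)); rewrite mul0r mul1r addr0 subrr.
move=> a b c d; move: {2}(`|b|%N).+1 (ltnSn `|b|%N) => n.
elim: n a b c d => // n IH a b c d hb hu.
have [b0|b0] := eqVneq b 0.
  move: hu; rewrite b0 mul0r subr0 unitrM => /andP[].
  have dic (x : int) : x \is a GRing.unit -> x = 1 \/ x = - 1.
    by rewrite qualifE /= => /orP[/eqP ->|/eqP ->]; [left|right].
  move=> /dic[->|->] /dic[->|->].
  - exact: lower.
  - by apply: neg'; rewrite oppr0 opprK; exact: lower.
  - by apply: neg; rewrite opprK; exact: lower.
  - by apply: neg; apply: neg'; rewrite oppr0 !opprK; exact: lower.
apply: (addz' (- (a %/ b)%Z)); apply: sw; apply: IH.
  have -> : a + b * - (a %/ b)%Z = (a %% b)%Z by rewrite {1}(divz_eq a b); ring.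
  have h1 := modz_ge0 a b0; have h2 := ltz_mod a b0.
  by move: hb h1 h2; lia.
have -> : b * (c + d * - (a %/ b)%Z) - (a + b * - (a %/ b)%Z) * d = - (a * d - b * c) by ring.
by rewrite unitrN.
Qed.

End Generation.

Section Cosets.
Variable G : set 'M[int]_2.
Hypothesis hfin : finite_index G.
Local Notation V := (coset G).

Lemma mulset_inj (A : 'M[int]_2) (C D : set 'M[int]_2) : GL2Z A ->
  [set B *m A | B in C] = [set B *m A | B in D] -> C = D.
Proof.
move=> uA; have sub (C' D' : set 'M[int]_2) :
    [set B *m A | B in C'] = [set B *m A | B in D'] -> C' `<=` D'.
  move=> e B CB; have : [set B *m A | B in D'] (B *m A) by rewrite -e; exists B.
  move=> [B' DB' e']; have := congr1 (mulmx^~ (invmx A)) e'.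
  by rewrite !mulmxK// => <-.
by move=> e; apply/seteqP; split; apply: sub.
Qed.

Lemma coset_digit_inj m : injective (fun v : V => coset_digit v m).
Proof.
by move=> v w /(congr1 val) /= /(mulset_inj (digit_mx_unit m)) e; apply: val_inj.
Qed.

Lemma coset_enum : exists vs : seq V, uniq vs /\ forall v, v \in vs.
Proof.
have fV : finite_set [set: V].
  have -> : [set: V] = (fun v : V => val v) @^-1` (right_cosets G).
    by apply/seteqP; split=> v //= _; exact: set_valP.
  by apply: finite_preimage => // v w _ _; exact: val_inj.
exists (finmap.enum_fset (fset_set [set: V])); split; first exact: finmap.fset_uniq.
by move=> v; rewrite in_fset_set//; exact: mem_set.
Qed.

Definition reach (v w : V) := exists l : seq nat,
  all (fun m => 1 <= m)%N l /\ foldl (fun v m => coset_digit v m) v l = w.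

Lemma reach_refl v : reach v v. Proof. by exists [::]. Qed.

Lemma reach_trans v w z : reach v w -> reach w z -> reach v z.
Proof.
by move=> [l [al <-]] [k [ak <-]]; exists (l ++ k); rewrite all_cat al ak foldl_cat.
Qed.

Lemma reach_digit v m : (1 <= m)%N -> reach v (coset_digit v m).
Proof. by move=> m1; exists [:: m]; rewrite /= m1. Qed.

(* A digit permutes the finite set reachable from [v], which thus contains the preimage of [v]. *)
Lemma reach_digit_inv v m : (1 <= m)%N -> reach (coset_digit v m) v.
Proof.
move=> m1; have [vs [uvs avs]] := coset_enum.
pose v' := coset_digit v m.
pose S := [seq w <- vs | `[< reach v' w >]].
have mS w : (w \in S) = `[< reach v' w >] by rewrite mem_filter avs andbT.
have uS : uniq S by exact: filter_uniq.
have uI : uniq [seq coset_digit w m | w <- S] by rewrite map_inj_uniq//; exact: coset_digit_inj.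
have sI : {subset [seq coset_digit w m | w <- S] <= S}.
  move=> _ /mapP[w + ->]; rewrite !mS => /asboolP h; apply/asboolP.
  exact: reach_trans h (reach_digit _ m1).
have [_ eS] := uniq_min_size uI sI (ltac:(by rewrite size_map)).
have : v' \in S by rewrite mS; apply/asboolP; exact: reach_refl.
rewrite -eS => /mapP[w + /coset_digit_inj e]; rewrite -e mS => /asboolP; exact.
Qed.

Lemma reach_sym v w : reach v w -> reach w v.
Proof.
move=> [l [al <-]] {w}; elim: l v al => [|m l IH] v /=; first by move=> _; exact: reach_refl.
by move=> /andP[m1 al]; apply: reach_trans (IH _ al) (reach_digit_inv v m1).
Qed.

Definition reaching (A : 'M[int]_2) := GL2Z A /\
  forall v w : V, val w = [set B *m A | B in val v] -> reach v w.

Lemma reachingM A B : reaching A -> reaching B -> reaching (A *m B).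
Proof.
move=> [uA hA] [uB hB]; split; first by rewrite /GL2Z /= unitmx_mul uA.
move=> v w e.
pose z : V := exist _ [set C *m A | C in val v] (mem_set (right_cosets_mulr uA (set_valP v))).
apply: (reach_trans (hA v z erefl)); apply: hB; rewrite e /=; apply/seteqP; split=> X /=.
  by move=> [C hC <-]; exists (C *m A); [exists C|rewrite mulmxA].
by move=> [_ [C hC <-] <-]; exists C => //; rewrite mulmxA.
Qed.

Lemma reachingV A : reaching A -> reaching (invmx A).
Proof.
move=> [uA hA]; split; first by rewrite /GL2Z /= unitmx_inv.
move=> v w e; apply/reach_sym/hA; rewrite e; apply/seteqP; split=> X /=.
  by move=> hX; exists (X *m invmx A); [exists X|rewrite mulmxKV].
by move=> [_ [C hC <-] <-]; rewrite mulmxKV.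
Qed.

Lemma reaching_digit m : (1 <= m)%N -> reaching (digit_mx m).
Proof.
move=> m1; split; first exact: digit_mx_unit.
move=> v w e; have -> : w = coset_digit v m by apply: val_inj; rewrite e.
exact: reach_digit.
Qed.

Definition mx2 (a b c d : int) : 'M[int]_2 :=
  \matrix_(i, j) if i == 0 then (if j == 0 then a else b) else (if j == 0 then c else d).

Lemma mx2_mul a b c d a' b' c' d' : mx2 a b c d *m mx2 a' b' c' d' =
  mx2 (a * a' + b * c') (a * b' + b * d') (c * a' + d * c') (c * b' + d * d').
Proof.
apply/matrixP => i j; rewrite !mxE !big_ord_recl big_ord0 !mxE /= addr0.
by case: i => -[|[|]] //= ?; case: j => -[|[|]].
Qed.

Lemma mx2E (A : 'M[int]_2) : A = mx2 (A 0 0) (A 0 1) (A 1 0) (A 1 1).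
Proof.
apply/matrixP => i j; rewrite !mxE.
by case: i => -[|[|]] //= hi; case: j => -[|[|]] //= hj; congr (A _ _); apply: val_inj.
Qed.

Lemma mx2_det a b c d : \det (mx2 a b c d) = a * d - b * c.
Proof.
rewrite (expand_det_row _ 0) !big_ord_recl big_ord0 /cofactor !det_mx11 !mxE /=.
by rewrite expr0 expr1; ring.
Qed.

(** Inverses of digit matrices are available because [reach] is symmetric. The transvection A_1^{-1}
    A_2 and the swap, which is A_1 times the inverse transvection, generate the group. *)
Lemma GL2Z_reaching A : GL2Z A -> reaching A.
Proof.
have dE m : digit_mx m = mx2 0 1 1 m%:Z by [].
have mx21 : mx2 1 0 0 1 = 1%:M.
  by apply/matrixP => i j; rewrite !mxE; case: i => -[|[|]] //= ?; case: j => -[|[|]].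
have V1 : invmx (digit_mx 1) = mx2 (-1) 1 1 0.
  rewrite -[RHS](mulmxK (digit_mx_unit 1)) -[LHS]mul1mx; congr (_ *m _).
  by rewrite dE mx2_mul -mx21; congr mx2; ring.
have rT : reaching (mx2 1 1 0 1).
  have -> : mx2 1 1 0 1 = invmx (digit_mx 1) *m digit_mx 2.
    by rewrite V1 dE mx2_mul; congr mx2; ring.
  by apply: reachingM; [apply: reachingV|]; exact: reaching_digit.
have rT' : reaching (mx2 1 (-1) 0 1).
  suff -> : mx2 1 (-1) 0 1 = invmx (mx2 1 1 0 1) by exact: reachingV.
  case: rT => uT _; rewrite -[LHS](mulmxK uT) -[RHS]mul1mx; congr (_ *m _).
  by rewrite mx2_mul -mx21; congr mx2; ring.
have rW : reaching (mx2 0 1 1 0).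
  have -> : mx2 0 1 1 0 = digit_mx 1 *m mx2 1 (-1) 0 1 by rewrite dE mx2_mul; congr mx2; ring.
  by apply: reachingM => //; exact: reaching_digit.
rewrite [A]mx2E /GL2Z /= unitmxE mx2_det.
move: (A 0 0) (A 0 1) (A 1 0) (A 1 1).
apply: (GL2Z_induction (Q := fun a b c d => reaching (mx2 a b c d))).
- move=> a b c d h; have -> : mx2 a b c d = mx2 b a d c *m mx2 0 1 1 0.
    by rewrite mx2_mul; congr mx2; ring.
  exact: reachingM.
- move=> a b c d; split=> h.
    have -> : mx2 a b c d = mx2 a (a + b) c (c + d) *m mx2 1 (-1) 0 1.
      by rewrite mx2_mul; congr mx2; ring.
    exact: reachingM.
  have -> : mx2 a (a + b) c (c + d) = mx2 a b c d *m mx2 1 1 0 1.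
    by rewrite mx2_mul; congr mx2; ring.
  exact: reachingM.
- have -> : mx2 1 0 0 1 = mx2 1 1 0 1 *m mx2 1 (-1) 0 1.
    by rewrite mx2_mul; congr mx2; ring.
  exact: reachingM.
Qed.

Theorem coset_transitive (v w : V) : reach v w.
Proof.
have [g ug eg] := set_valP v; have [h uh eh] := set_valP w.
have uA : GL2Z (invmx g *m h) by rewrite /GL2Z /= unitmx_mul unitmx_inv ug.
have [_ H] := GL2Z_reaching uA; apply: H; rewrite eg eh; apply/seteqP; split=> X /=.
  by move=> [B GB <-]; exists (B *m g); [exists B|rewrite mulmxA mulmxK].
by move=> [_ [B GB <-] <-]; exists B => //; rewrite mulmxA mulmxK.
Qed.

Lemma coset_inhabited : inhabited V.
Proof.
apply: inhabits; exists [set B *m 1%:M | B in G]; apply: mem_set.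
by exists 1%:M => //; rewrite /GL2Z /= unitmx1.
Qed.

Lemma index_gt0 : (0 < GL2Z_index G)%N.
Proof.
rewrite /GL2Z_index finmap.cardfs_gt0; apply/finmap.fset0Pn; exists [set B *m 1%:M | B in G].
rewrite in_fset_set//; apply: mem_set; exists 1%:M => //; by rewrite /GL2Z /= unitmx1.
Qed.

End Cosets.

(** * Differentiability within the unit interval *)

Section DerivativeOnUnitInterval.
Variable R : realType.
Local Notation normc := (@Normc.normc R).
Implicit Types (x y z d e B K : R) (q : R -> R) (f : R -> R[i]).
Local Notation pnbhs x := (within [set` `[(0:R), 1]] (dnbhs (x : R))).

Lemma near01P x (P : R -> Prop) : (\forall y \near pnbhs x, P y) <->
  exists2 d, 0 < d & forall y, 0 <= y <= 1 -> y != x -> `|y - x| < d -> P y.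
Proof.
split.
  move=> /nbhs_ballP[d /= d0 H]; exists d => // y hy yx yd.
  by apply: (H y) => //; rewrite /ball /= distrC.
move=> [d d0 H]; apply/nbhs_ballP; exists d => // y; rewrite /ball /= => yd yx.
by rewrite in_itv /= => hy; apply: H => //; rewrite distrC.
Qed.

Lemma pnbhs_filter x : Filter (pnbhs x).
Proof. exact: within_filter. Qed.

Lemma pnbhs_proper x : 0 <= x <= 1 -> ProperFilter (pnbhs x).
Proof.
move=> /andP[x0 x1]; split; last exact: pnbhs_filter.
move=> /near01P[d d0 H].
have [e /andP[e0 e1] ed] : exists2 e, 0 < e <= 1 / 2 & e < d.
  have [h|h] := leP d (1 / 2); first by exists (d / 2); lra.
  by exists (1 / 2); lra.
have [h|h] := leP x (1 / 2).
  apply: (H (x + e)); first by lra.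
    by rewrite gt_eqF// ltrDl.
  by rewrite addrAC subrr add0r gtr0_norm.
apply: (H (x - e)); first by lra.
  by rewrite lt_eqF// ltrBlDr ltrDl.
by rewrite addrAC subrr add0r normrN gtr0_norm.
Qed.

Lemma normc_dquot f x y : normc (dquot01 f x y) = normc (f y - f x) / `|y - x|.
Proof. by rewrite /dquot01 Normc.normcM -fmorphV normcR normfV. Qed.

Lemma C1_01_local f x e : C1_01 f -> 0 <= x <= 1 -> 0 < e ->
  exists2 d, 0 < d & forall y, 0 <= y <= 1 -> `|y - x| < d ->
    normc (f y - f x) <= (normc (deriv01 f x) + e) * `|y - x|.
Proof.
move=> [C _] hx e0; have PF := pnbhs_proper hx.
have /cvg_normcP/(_ e e0)/near01P[d d0 H] : dquot01 f x y @[y --> pnbhs x] --> deriv01 f x.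
  by apply: C; rewrite in_itv.
exists d => // y hy yd; have [->|yx] := eqVneq y x.
  by rewrite !subrr normr0 mulr0 -[0]/((0 : R)%:C) normcR normr0.
have yx0 : 0 < `|y - x| by rewrite normr_gt0 subr_eq0.
rewrite -ler_pdivrMr// -normc_dquot.
have := H y hy yx yd; have := ler_normcB (deriv01 f x) (deriv01 f x - dquot01 f x y).
by rewrite opprB addrCA subrr addr0; lra.
Qed.

(** The mean value equality fails for complex values. Instead, the supremum of the points z that
    satisfy the bound with slope B + e is shown to be y: the local estimate lets one enter the
    supremum and pass beyond it. *)
Lemma C1_01_lip f B : C1_01 f -> (forall x, 0 <= x <= 1 -> normc (deriv01 f x) <= B) ->
  forall x y, 0 <= x <= 1 -> 0 <= y <= 1 -> normc (f x - f y) <= B * `|x - y|.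
Proof.
move=> C hB x y hx hy.
wlog xy : x y hx hy / x <= y => [H|].
  have [h|/ltW h] := leP x y; first exact: H.
  by rewrite normcB distrC; exact: H.
rewrite normcB distrC ger0_norm ?subr_ge0//.
apply/ler_addgt0Pr => e0 e00.
have [e e1 e2] : exists2 e, 0 < e & e * (y - x) <= e0.
  exists (e0 / 2); first by lra.
  have : e0 / 2 * (y - x) <= e0 / 2 * 1 by rewrite ler_wpM2l; lra.
  lra.
suff H : normc (f y - f x) <= (B + e) * (y - x) by lra.
pose S := [set z | x <= z <= y /\ normc (f z - f x) <= (B + e) * (z - x)].
have Sx : S x.
  by split; [rewrite lexx xy|rewrite !subrr mulr0 -[0]/((0 : R)%:C) normcR normr0].
have Sub : ubound S y by move=> z [/andP[]].
have hS : has_sup S by split; [exists x|exists y].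
pose s := sup S.
have xs : x <= s by apply: ub_le_sup => //; exists y.
have sy : s <= y by apply: ge_sup => //; exists x.
have hs : 0 <= s <= 1 by apply/andP; split; lra.
have [d d0 Hd] := C1_01_local C hs e1.
have Hd' w : 0 <= w <= 1 -> `|w - s| < d -> normc (f w - f s) <= (B + e) * `|w - s|.
  move=> hw ws; apply: le_trans (Hd w hw ws) _; apply: ler_wpM2r => //.
  by rewrite lerD2r; exact: hB.
have Ss : S s.
  split; first by rewrite xs sy.
  have [z [hz Sz] zs] := sup_adherent d0 hS; rewrite -/s in zs.
  have zs' : z <= s by apply: ub_le_sup; [exists y|].
  have hz1 : 0 <= z <= 1 by lra.
  have nz : `|z - s| = s - z by rewrite distrC ger0_norm ?subr_ge0.
  have := Hd' z hz1; rewrite nz => /(_ ltac:(lra)) h.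
  have := ler_normcB (f z - f x) (f z - f s).
  have -> : f z - f x - (f z - f s) = f s - f x by ring.
  move: h Sz; move: (normc _) (normc _) (normc _) => n1 n2 n3; lra.
have [//|sy'] : s = y \/ s < y by move: sy; rewrite le_eqVlt => /orP[/eqP|]; [left|right].
  by move=> <-; case: Ss.
have [w [ws wy wd]] : exists w, [/\ s < w, w <= y & w - s < d].
  have [h|h] := leP (y - s) (d / 2); first by exists y; split; lra.
  by exists (s + d / 2); split; lra.
have nw : `|w - s| = w - s by rewrite ger0_norm ?subr_ge0 ?ltW.
have hw1 : 0 <= w <= 1 by lra.
have Sw : S w.
  split; first by apply/andP; split; lra.
  case: Ss => _ h1; have := Hd' w hw1; rewrite nw => /(_ wd) h2.
  have := ler_normcD (f w - f s) (f s - f x).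
  have -> : f w - f s + (f s - f x) = f w - f x by rewrite addrA subrK.
  move: h1 h2; move: (normc _) (normc _) (normc _) => n1 n2 n3; lra.
have : w <= s by apply: ub_le_sup => //; exists y.
by rewrite leNgt ws.
Qed.

Lemma C1_01_bounded f : C1_01 f -> exists U, forall x, 0 <= x <= 1 -> normc (f x) <= U.
Proof.
move=> C; have cont : {within `[0, 1], continuous (fun x => normc (f x))}.
  apply/subspace_continuousP => x /=; rewrite in_itv /= => hx.
  apply/cvgrPdist_lt => e e0.
  have [d d0 H] := C1_01_local C hx (ltr01 : 0 < (1 : R)).
  pose L := normc (deriv01 f x) + 1.
  have L0 : 0 < L by have := normc_ge0 (deriv01 f x); rewrite /L; lra.
  apply/nbhs_ballP; exists (Num.min d (e / L)); first by rewrite /= lt_min d0 divr_gt0.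
  move=> y; rewrite /ball /= lt_min => /andP[h1 h2]; rewrite in_itv /= => hy.
  rewrite distrC in h1; rewrite distrC in h2.
  rewrite distrC; apply: le_lt_trans (ler_dist_normc _ _) _.
  by apply: le_lt_trans (H y hy h1) _; rewrite mulrC -ltr_pdivlMr.
have [c _ hc] := EVT_max (@ler01 R) cont.
by exists (normc (f c)) => x hx; apply: hc; rewrite in_itv.
Qed.

(** The condition makes the difference quotients Cauchy at each point; comparing the quotient over
    the pair x, y with both derivatives shows that the derivative is 2 K-Lipschitz. *)
Lemma C1_01_three q K :
  (forall x y z, 0 <= x <= 1 -> 0 <= y <= 1 -> 0 <= z <= 1 -> x != y -> x != z ->
    `|(q y - q x) / (y - x) - (q z - q x) / (z - x)| <= K * (`|y - x| + `|z - x|)) ->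
  C1_01 (fun x => (q x)%:C).
Proof.
move=> H; pose dq x y := (q y - q x) / (y - x).
have K0 : 0 <= K.
  have h : 0 <= (0 : R) <= 1 by lra.
  have h1 : 0 <= (1 : R) <= 1 by lra.
  have n01 : (0 : R) != 1 by rewrite lt_eqF.
  have := H 0 1 1 h h1 h1 n01 n01; rewrite subrr normr0 subr0 normr1; lra.
have small e : 0 < e -> exists2 d, 0 < d & K * d < e.
  move=> e0; exists (e / (K + 1)); first by apply: divr_gt0; lra.
  by rewrite mulrA ltr_pdivrMr ?mulrDr; [rewrite mulrC; lra|lra].
have cv x : 0 <= x <= 1 -> exists l : R, dq x y @[y --> pnbhs x] --> l.
  move=> hx; have PF := pnbhs_proper hx.
  apply/cvg_ex; apply: (@R_complete R (dq x y @[y --> pnbhs x])); apply: (@cauchy_exP R R) => e e0.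
  have [d d0 hd] := small (e / 2) (ltac:(lra)).
  have [y [hy [yx yd]]] : exists y, 0 <= y <= 1 /\ y != x /\ `|y - x| < d.
    apply: (@filter_ex _ (pnbhs x) _ (fun y => 0 <= y <= 1 /\ y != x /\ `|y - x| < d)).
    by apply/near01P; exists d.
  exists (dq x y); apply/near01P; exists d => // z hz zx zd; rewrite /ball /=.
  apply: le_lt_trans (H x y z hx hy hz _ _) _; [by rewrite eq_sym|by rewrite eq_sym|].
  have : K * (`|y - x| + `|z - x|) <= K * (d + d) by rewrite ler_wpM2l//; lra.
  lra.
have [D hD] : exists D : R -> R, forall x, 0 <= x <= 1 -> dq x y @[y --> pnbhs x] --> D x.
  have /choice[D hD] : forall x, exists l : R, 0 <= x <= 1 -> dq x y @[y --> pnbhs x] --> l.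
    move=> x; have [/cv[l hl]|h] := boolP (0 <= x <= 1); first by exists l.
    by exists 0.
  by exists D.
have DqD x y : 0 <= x <= 1 -> 0 <= y <= 1 -> y != x -> `|dq x y - D x| <= K * `|y - x|.
  move=> hx hy yx; have PF := pnbhs_proper hx.
  apply/ler_addgt0Pr => e e0; have e2 : 0 < e / 2 by lra.
  have [d d0 hd] := small _ e2.
  have /cvgrPdist_lt/(_ _ e2) h1 := hD x hx.
  have h2 : \forall z \near pnbhs x, 0 <= z <= 1 /\ z != x /\ `|z - x| < d by apply/near01P; exists d.
  have [z [z1 [hz [zx zd]]]] := filter_ex (filterI h1 h2).
  rewrite /= in z1.
  have := H x y z hx hy hz; rewrite eq_sym yx eq_sym zx => /(_ isT isT); rewrite -/(dq x y) -/(dq x z) => h3.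
  have : K * `|z - x| <= K * d by rewrite ler_wpM2l// ltW.
  have := ler_normD (dq x y - dq x z) (dq x z - D x).
  by rewrite addrA subrK [`|dq x z - D x|]distrC mulrDr in h3 *; lra.
have Dlip x y : 0 <= x <= 1 -> 0 <= y <= 1 -> `|D x - D y| <= 2 * K * `|x - y|.
  move=> hx hy; have [->|xy] := eqVneq x y; first by rewrite !subrr normr0 mulr0.
  have h1 := DqD x y hx hy; rewrite eq_sym in h1; have h2 := DqD y x hy hx xy.
  have e : dq x y = dq y x by rewrite /dq -[q y - _]opprB -[y - x]opprB invrN mulrNN.
  have := h1 xy; rewrite e => h3.
  have := ler_normB (dq y x - D y) (dq y x - D x).
  have -> : dq y x - D y - (dq y x - D x) = D x - D y by ring.
  by rewrite [`|y - x|]distrC in h3; lra.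
have dC x y : dquot01 (fun x => (q x)%:C) x y = (dq x y)%:C.
  by rewrite /dquot01 /dq -rmorphB -fmorphV -rmorphM.
have cC x : 0 <= x <= 1 -> dquot01 (fun x => (q x)%:C) x y @[y --> pnbhs x] --> (D x)%:C.
  move=> hx; have PF := pnbhs_proper hx; apply/cvg_normcP => e e0.
  have /cvgrPdist_lt/(_ _ e0) := hD x hx; apply: filterS => y.
  by rewrite dC -rmorphB normcR.
have dE x : 0 <= x <= 1 -> deriv01 (fun x => (q x)%:C) x = (D x)%:C.
  by move=> hx; have PF := pnbhs_proper hx; apply: cvg_limC; exact: cC.
split=> [x|].
  by rewrite in_itv /= => hx; apply/cvg_ex; exists (D x)%:C; exact: cC.
apply/subspace_continuousP => x /=; rewrite in_itv /= => hx.
apply/cvg_normcP => e e0; have [d d0 hd] := small (e / 2) (ltac:(lra)).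
apply/nbhs_ballP; exists d => // y; rewrite /ball /= => h1; rewrite in_itv /= => hy.
change (normc (deriv01 (fun x => (q x)%:C) x - deriv01 (fun x => (q x)%:C) y) < e).
rewrite !dE// -rmorphB normcR; apply: le_lt_trans (Dlip x y hx hy) _.
have : K * `|x - y| <= K * d by rewrite ler_wpM2l// ltW.
lra.
Qed.

End DerivativeOnUnitInterval.

(** * The operator norm *)

Section NeighbourhoodOfParameters.
Variables (R : realType) (V : choiceType).
Implicit Types (e : R) (v : V).

Lemma nbhs_ptws_eval e v : 0 < e ->
  nbhs ((fun=> 0) : {ptws V -> R}) [set X : {ptws V -> R} | `|X v| <= e].
Proof.
move=> e0.
have c : @proj V (fun=> R) v X @[X --> ((fun=> 0) : {ptws V -> R})] --> (0 : R).
  exact: (@proj_continuous V (fun=> R) v (fun=> 0)).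
have n0 : nbhs (0 : R) [set z : R | `|z| <= e].
  by apply/nbhs_ballP; exists e => // z; rewrite /ball /= sub0r normrN; exact: ltW.
exact: (c _ n0).
Qed.

(** In the topology of pointwise convergence a uniform bound defines a neighbourhood because there
    are finitely many cosets. *)
Lemma nbhs_close (vs : seq V) e : 0 < e -> (forall v, v \in vs) ->
  nbhs ((1, fun=> 0) : R * {ptws V -> R}) [set p | close_to e p.1 p.2].
Proof.
move=> e0 avs.
exists ([set s | `|s - 1| <= e], [set X : {ptws V -> R} | forall v, `|X v| <= e]); last by move=> [s X].
split=> /=.
  by apply/nbhs_ballP; exists e => // s; rewrite /ball /= distrC; exact: ltW.
have hv v := nbhs_ptws_eval v e0.
have : Filter (nbhs ((fun=> 0) : {ptws V -> R})) by exact: nbhs_filter.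
move: (nbhs _) hv => F hv FF.
have h (l : seq V) : F [set X | forall v, v \in l -> `|X v| <= e].
  elim: l => [|v l IH]; first by apply: (@filterS _ F FF setT) filterT => X _ v.
  apply: (@filterS2 _ F FF _ _ _ _ IH (hv v)) => X h1 h2 w; rewrite inE => /orP[/eqP -> //|]; exact: h1.
by apply: (@filterS _ F FF _ _ _ (h vs)) => X H v; exact: H.
Qed.

End NeighbourhoodOfParameters.

(** * Between the operator norm and the majorants *)

Section TransferBridge.
Variables (R : realType) (G : set 'M[int]_2).
Local Notation V := (coset G).
Local Notation normc := (@Normc.normc R).
Local Notation act := (fun m (v : V) => coset_digit v m).
Implicit Types (s t x y r b S : R) (v w : V) (X Y : V -> R) (psi : R -> V -> R[i]).

Lemma transferE s t X Y psi :
  transfer (s +i* t) (fun v => X v +i* Y v) psi = Lc act s X t Y psi.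
Proof.
apply/funext => x; apply/funext => v; rewrite /transfer /Lc /csum.
congr (lim (_ @ \oo)); apply/funext => n; apply: eq_bigr => m _.
rewrite cexpM cexpE /cwt /wt /hb; congr (_ %:C * cis _ * _).
  by congr expR; simpc => /=; ring.
by simpc => /=; ring.
Qed.

Lemma transfer_real s X : transfer s%:C (fun v => (X v)%:C) = Lc act s X 0 (fun=> 0).
Proof. by apply/funext => psi; exact: (transferE s 0 X (fun=> 0) psi). Qed.

Lemma Lc_real s X b (u : R -> V -> R) x v : near10 s X -> loglip b u -> 0 <= x <= 1 ->
  Lc act s X 0 (fun=> 0) (fun y w => (u y w)%:C) x v = (Lr act s X u x v)%:C.
Proof.
move=> ok hu hx; have [C hC] := loglip_dom act ok hu.
rewrite /Lr -(csum_real (hC x v hx)); congr (csum _); apply/funext => m.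
rewrite /cwt mulr0 mul0r subr0.
have -> : cis (0 : R) = 1 by rewrite /cis cos0 sin0.
by rewrite mulr1 -rmorphM.
Qed.

Hypothesis hfin : finite_index G.

(** A maximum principle: for T the supremum of |psi| / g, applying the operator to |psi| <= T g
    gives |mu| |psi| <= r T g, hence |mu| T <= r T. *)
Lemma eigenvalue_le C s X r (g : R -> V -> R) (mu : R[i]) : 0 < C -> near10 s X ->
  eigen_data act C s X r g ->
  is_eigenvalue (transfer s%:C (fun v => (X v)%:C)) mu -> normc mu <= r.
Proof.
move=> C0 ok ed [psi [psiC [x0 hx0 [v0 nz]] eig]].
have lg := eigen_loglip C0 ok ed; have [r0 _ hg eg] := ed.
have [vs [_ avs]] := coset_enum hfin.
have /choice[U hU] : forall v, exists U, forall x, 0 <= x <= 1 -> normc (psi x v) <= U.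
  by move=> v; exact: C1_01_bounded.
pose S := [set z | exists x v, 0 <= x <= 1 /\ z = normc (psi x v) / g x v].
have gp x v : 0 <= x <= 1 -> 0 < g x v.
  by move=> hx; have /andP[h _] := hg x v hx; exact: lt_le_trans h.
have Sub : ubound S ((\sum_(v <- vs) `|U v|) / C).
  move=> _ [x [v [hx ->]]]; apply: ler_pM; rewrite ?normc_ge0 ?invr_ge0 ?(ltW (gp x v hx))//.
    apply: le_trans (hU v x hx) _; apply: le_trans (ler_norm _) _.
    by rewrite (big_rem v) ?avs//= lerDl; apply: sumr_ge0.
  by rewrite lef_pV2 ?posrE ?gp//; have /andP[] := hg x v hx.
have hx0' : 0 <= x0 <= 1 by move: hx0; rewrite in_itv.
have hS : has_sup S.
  by split; [exists (normc (psi x0 v0) / g x0 v0), x0, v0|exists ((\sum_(v <- vs) `|U v|) / C)].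
pose T := sup S.
have TS x v : 0 <= x <= 1 -> normc (psi x v) <= T * g x v.
  move=> hx; rewrite -ler_pdivrMr ?gp//; apply: ub_le_sup; first by case: hS.
  by exists x, v.
have T0 : 0 < T.
  rewrite -(pmulr_lgt0 _ (gp x0 v0 hx0')); apply: lt_le_trans (TS x0 v0 hx0').
  rewrite lt_def normc_ge0 andbT; apply: contra nz => /eqP h.
  by apply/eqP; exact: Normc.eq0_normc.
have key x v : 0 <= x <= 1 -> normc mu * normc (psi x v) <= r * T * g x v.
  move=> hx; rewrite -Normc.normcM -eig ?in_itv// transfer_real.
  have h := Lc_le act 0 (fun=> 0) v ok (loglip_scale T0 lg) TS hx.
  apply: le_trans h _; rewrite (Lr_scale act v T ok lg hx) eg//.
  by rewrite mulrA [r * T]mulrC.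
have : normc mu * T <= r * T.
  have [->|m0] := eqVneq (normc mu) 0; first by rewrite mul0r mulr_ge0// ltW.
  have mp : 0 < normc mu by rewrite lt_def m0 normc_ge0.
  rewrite mulrC -ler_pdivlMr//; apply: ge_sup; first by case: hS.
  move=> _ [x [v [hx ->]]]; rewrite ler_pdivrMr ?gp// mulrAC ler_pdivlMr// mulrC.
  exact: key.
by rewrite ler_pM2r.
Qed.

Lemma eigen_C1 C s X r (g : R -> V -> R) : near10 s X -> eigen_data act C s X r g ->
  C1 (fun x v => (g x v)%:C).
Proof.
move=> [hs _] [_ hk hg _] v; apply: (@C1_01_three _ _ (12 * 8)) => x y z hx hy hz xy xz.
apply: le_trans (kcone_three hs (hk v) hx hy hz xy xz) _.
have /andP[_ g1] := hg x v hx.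
have : 0 <= 12 * (`|y - x| + `|z - x|) * 8 by rewrite !mulr_ge0 ?addr_ge0.
move=> h; have := ler_wpM2l h g1; lra.
Qed.

(** [xget] picks some dominant eigenvalue; r is dominant as well, and of two such numbers each
    bounds the other. *)
Lemma lambdaE C s X r (g : R -> V -> R) : 0 < C -> near10 s X ->
  eigen_data act C s X r g -> lambda s X = r.
Proof.
move=> C0 ok ed; have lg := eigen_loglip C0 ok ed; have [r0 _ hg eg] := ed.
have er : is_eigenvalue (transfer s%:C (fun v => (X v)%:C)) r%:C.
  exists (fun x v => (g x v)%:C); split.
  - exact: eigen_C1 ok ed.
  - exists 0; first by rewrite in_itv /= lexx ler01.
    have [v0] := coset_inhabited G; exists v0.
    have /andP[h _] := hg 0 v0 (ltac:(by rewrite lexx ler01)).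
    apply/eqP => /(congr1 (@complex.Re R)) /= e; move: h; rewrite e; lra.
  - move=> x v; rewrite in_itv /= => hx; rewrite transfer_real (Lc_real _ ok lg hx) eg//.
    by rewrite rmorphM.
have dr : is_dominant_eigenvalue (transfer s%:C (fun v => (X v)%:C)) r.
  by split=> // mu; exact: eigenvalue_le ok ed.
have [l0 el ml] := xgetPex 0 (ex_intro _ r dr).
rewrite -/(lambda s X) in l0 el ml.
apply/eqP; rewrite eq_le; apply/andP; split.
  by have := eigenvalue_le C0 ok ed el; rewrite normcR gtr0_norm.
by have := ml _ er; rewrite normcR gtr0_norm.
Qed.

Lemma partialIE (Psi : fun_I R G) x v : 0 <= x <= 1 ->
  partialI Psi x v = (GL2Z_index G)%:R^-1 * deriv01 (Psi ^~ v) x.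
Proof.
move=> hx; rewrite /partialI; congr (_ * _).
have d0 : deriv01 (fun=> 0 : R[i]) x = 0.
  rewrite /deriv01 (_ : dquot01 (fun=> 0) x = fun=> 0); last first.
    by apply/funext => y; rewrite /dquot01 subrr mul0r.
  by have PF := pnbhs_proper hx; apply: cvg_limC; exact: cvg_cst.
rewrite -(@fsbig_widen _ _ _ _ [set v] setT).
- rewrite fsbig_set1; congr (deriv01 _ x); apply/funext => y.
  by rewrite /restr eqxx.
- by [].
- move=> u [_ uv] /=; rewrite -[RHS]d0; congr (deriv01 _ x); apply/funext => y.
  by rewrite /restr; case: eqVneq => // e; case: uv; rewrite /= e.
Qed.

Lemma norm0_le (Psi : fun_I R G) S :
  (forall x v, 0 <= x <= 1 -> normc (Psi x v) <= S) -> (norm0 Psi <= S%:E)%E.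
Proof.
move=> H; apply: ge_ereal_sup => _ [x hx [v _ <-]]; rewrite lee_fin; apply: H.
by move: hx; rewrite /= in_itv.
Qed.

Lemma le_norm0 (Psi : fun_I R G) x v : 0 <= x <= 1 -> ((normc (Psi x v))%:E <= norm0 Psi)%E.
Proof.
move=> hx; apply: ereal_sup_ubound; exists x; first by rewrite /= in_itv.
by exists v.
Qed.

(** The factor 1 / k in [partialI] leaves the bound k |t| for the derivative, whence the constant
    majorant k. By [DD_ge] the oscillation is then at most 2 k |t| D, within the allowed 20. *)
Lemma normt_majorized t (Psi : fun_I R G) : 4 <= `|t| -> C1 Psi -> (normt t Psi <= 1)%E ->
  majorized (20 * `|t|) Psi (fun _ _ => (GL2Z_index G)%:R).
Proof.
move=> t4 C1P nP; have t0 : 0 < `|t| by lra.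
have k1 : 1 <= (GL2Z_index G)%:R :> R by rewrite (ler_nat R 1) index_gt0.
set k := (GL2Z_index G)%:R in k1 *.
have [v0] := coset_inhabited G.
have h01 : 0 <= (0 : R) <= 1 by rewrite lexx ler01.
have p1 : (0 <= norm0 Psi)%E by apply: le_trans (le_norm0 Psi v0 h01); rewrite lee_fin normc_ge0.
have p2 : (0 <= norm0 (partialI Psi))%E.
  by apply: le_trans (le_norm0 (partialI Psi) v0 h01); rewrite lee_fin normc_ge0.
have n1 : (norm0 Psi <= 1)%E by apply: le_trans nP; rewrite leeDl// mule_ge0.
have n2 : (`|t|^-1%:E * norm0 (partialI Psi) <= 1)%E by apply: le_trans nP; rewrite leeDr// mule_ge0.
have b1 x v : 0 <= x <= 1 -> normc (Psi x v) <= 1.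
  by move=> hx; rewrite -lee_fin; apply: le_trans (le_norm0 Psi v hx) n1.
have b2 x v : 0 <= x <= 1 -> normc (deriv01 (Psi ^~ v) x) <= k * `|t|.
  move=> hx; have : ((`|t|^-1 * normc (partialI Psi x v))%:E <= 1)%E.
    by apply: le_trans n2; rewrite EFinM lee_pmul2l ?lte_fin ?invr_gt0//; exact: le_norm0.
  rewrite lee_fin partialIE// Normc.normcM.
  have -> : normc ((GL2Z_index G)%:R^-1 : R[i]) = k^-1.
    by rewrite -(rmorph_nat (real_complex R)) -fmorphV normcR gtr0_norm ?invr_gt0//; lra.
  by rewrite mulrA -invfM mulrC ler_pdivrMr ?mulr_gt0 ?(lt_le_trans ltr01 k1)// mul1r [k * _]mulrC.
split=> [x v hx|x y v hx hy]; first by apply: le_trans (b1 x v hx) _.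
have k0 : 0 < k by lra.
apply: le_trans (C1_01_lip (C1P v) (fun z hz => b2 z v hz) hx hy) _.
have -> : k * `|t| * `|x - y| = `|t| * `|x - y| * k by ring.
rewrite ler_pM2r//.
have h := expR_ge1Dx (20 * `|t| * DD x y).
have d := DD_ge hx hy; have d0 := DD_ge0 x y.
have : `|t| * `|x - y| <= `|t| * (2 * DD x y) by rewrite ler_pM2l.
have : 0 <= `|t| * DD x y by rewrite mulr_ge0.
move: h; rewrite -!mulrA; lra.
Qed.

(** Difference quotients at distance below 1 / (40 |t|) are at most 40 |t| S, since e^z - 1 <= 2 z
    for small z; 41 adds the supremum S itself. As Psi is arbitrary, this applies to iterates
    without differentiating their series. *)
Lemma majorized_normt t (Psi : fun_I R G) S : 4 <= `|t| -> 0 <= S ->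
  majorized (20 * `|t|) Psi (fun _ _ => S) -> (normt t Psi <= (41 * S)%:E)%E.
Proof.
move=> t4 S0 [m1 m2]; have t0 : 0 < `|t| by lra.
have k1 : 1 <= (GL2Z_index G)%:R :> R by rewrite (ler_nat R 1) index_gt0.
set k := (GL2Z_index G)%:R in k1 *.
have dle x v : 0 <= x <= 1 -> normc (deriv01 (Psi ^~ v) x) <= 40 * `|t| * S.
  move=> hx; have PF := pnbhs_proper hx.
  have [C|nC] := pselect (cvg (dquot01 (Psi ^~ v) x y @[y --> within `[0, 1] x^'])); last first.
    (* Without a limit, [lim] returns the default point 0, for which the bound is immediate. *)
    rewrite /deriv01 (dvgP nC) -[point]/(0 : R[i]) -[0]/((0 : R)%:C) normcR normr0.
    by rewrite !mulr_ge0.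
  apply/ler_addgt0Pr => e e0.
  have h1 := (@cvg_normcP R _ _ _ (dquot01 (Psi ^~ v) x) _).1 C e e0.
  have h2 : \forall y \near within `[0, 1] x^', normc (dquot01 (Psi ^~ v) x y) <= 40 * `|t| * S.
    apply/near01P; exists ((40 * `|t|)^-1); first by rewrite invr_gt0 mulr_gt0.
    move=> y hy yx yd; have yx0 : 0 < `|y - x| by rewrite normr_gt0 subr_eq0.
    rewrite normc_dquot ler_pdivrMr//.
    have DDy : DD y x <= `|y - x| by apply: DD_le; [case/andP: hy|case/andP: hx].
    have ty : `|t| * `|y - x| < 1 / 40.
      by move: yd; rewrite -[ltRHS]mul1r ltr_pdivlMr ?mulr_gt0//; lra.
    have tD : `|t| * DD y x <= `|t| * `|y - x| by rewrite ler_pM2l.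
    have D0 : 0 <= `|t| * DD y x by rewrite mulr_ge0// DD_ge0.
    have hsm : 0 <= 20 * `|t| * DD y x <= 2^-1 by lra.
    apply: le_trans (m2 y x v hy hx) _.
    have -> : 40 * `|t| * S * `|y - x| = 40 * (`|t| * `|y - x|) * S by ring.
    rewrite ler_wpM2r//; have := expR_small hsm; lra.
  have [y [/= y1 y2]] := filter_ex (filterI (h1 _) h2).
  have := ler_normcD (deriv01 (Psi ^~ v) x - dquot01 (Psi ^~ v) x y) (dquot01 (Psi ^~ v) x y).
  rewrite subrK; move: y1 y2; rewrite -/(deriv01 (Psi ^~ v) x); lra.
have n1 : (norm0 Psi <= S%:E)%E by apply: norm0_le => x v hx; exact: m1.
have n2 : (norm0 (partialI Psi) <= (40 * `|t| * S)%:E)%E.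
  apply: norm0_le => x v hx; rewrite partialIE// Normc.normcM.
  have -> : normc ((GL2Z_index G)%:R^-1 : R[i]) = k^-1.
    by rewrite -(rmorph_nat (real_complex R)) -fmorphV normcR gtr0_norm ?invr_gt0//; lra.
  apply: le_trans (dle x v hx); rewrite ler_piMl ?normc_ge0// invf_le1//; lra.
apply: (@le_trans _ _ (S%:E + `|t|^-1%:E * (40 * `|t| * S)%:E)%E).
  by apply: leeD => //; rewrite lee_pmul2l ?lte_fin ?invr_gt0.
rewrite -EFinM -EFinD lee_fin.
have -> : `|t|^-1 * (40 * `|t| * S) = 40 * S by field; rewrite gt_eqF.
lra.
Qed.

End TransferBridge.

Theorem theorem6p5 (R : realType) (G : set 'M[int]_2)
    (hG : is_subgroup_GL2Z G) (hfin : finite_index G) :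
  exists2 K : set (R * {ptws coset G -> R}),
    nbhs ((1, fun=> 0) : R * {ptws coset G -> R}) K &
    forall xi : R, 0 < xi < 5^-1 ->
    exists2 eta : R, 0 < eta < 1 &
    exists2 c : R, 0 < c &
    forall (sigma t : R) (x y : coset G -> R) (n : nat),
      K (sigma, x) -> (1 <= n)%N -> 1 / rho R ^+ 2 <= `|t| ->
      (opnormt t (iter n (transfer (sigma +i* t) (fun u => (x u +i* y u))))
        <= (c * (eta ^+ n * lambda sigma x ^+ n * `|t| `^ xi))%:E)%E.
Proof.
have [vs [uvs avs]] := coset_enum hfin.
have [v0] := coset_inhabited G.
have k0 : 0 < (GL2Z_index G)%:R :> R by rewrite ltr0n index_gt0.
(* The constant K of [contraction] is the index, the majorant that [normt_majorized] provides on the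
   unit ball. *)
have [e [C [he C0 hE hC]]] := contraction uvs avs v0 (@coset_digit_inj G)
  (@coset_transitive G hfin) k0.
have [e0 e1] := andP he.
exists [set p | close_to e p.1 p.2]; first exact: (@nbhs_close R (coset G) vs).
move=> xi hxi.
have [eta [c [heta c0 H]]] := hC xi (ltac:(by rewrite div1r)).
exists eta => //; exists (41 * c); first by rewrite mulr_gt0.
move=> s t X Y n /= cl _ ht.
have t4 : 4 <= `|t|.
  apply: le_trans ht; rewrite /rho (_ : 1 / 2^-1 ^+ 2 = 4 :> R)//.
  by rewrite exprVn invrK mul1r expr2 -natrM.
have ok := close_near10 e1 cl.
have [r [g ed]] := hE s X cl.
rewrite (lambdaE hfin C0 ok ed).
have r0 : 0 < r by case: ed.
have -> : transfer (s +i* t) (fun u => X u +i* Y u) = Lc (fun m (v : coset G) => coset_digit v m) s X t Y.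
  by apply/funext => psi; exact: transferE.
apply: ge_ereal_sup => _ [psi [C1psi npsi] <-].
have m1 := normt_majorized hfin t4 C1psi npsi.
have m2 := H s X r g t Y psi n cl ed t4 m1.
rewrite -mulrA; apply: (majorized_normt hfin t4 _ m2).
have [eta0 _] := andP heta.
by rewrite !mulr_ge0 ?exprn_ge0 ?powR_ge0// ltW.
Qed.
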